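(* In the scaled framework described in the context, assume (A1)–(A11), (H1)–(H3), that $F(u) < 0$ and $G(u) > 0$ for all $u \in W\setminus\{0\}$, and that (for every $c\in\mathbb{R}$) $h(u)\neq 0$ for all $u\in\mathcal{N}_c$. Let $I^+ = (0,\infty)$. Then: (i) For each $c \in I^+$, $\lambda_{c,k} \nearrow \infty$ ($k\ge1$) is a sequence of critical values of $\lambda_c$. Moreover, $\Phi_{\lambda_{c,k}}$ has a nontrivial critical point $u_{c,k}$ with $\Phi_{\lambda_{c,k}}(u_{c,k}) = c$. (ii) For each $k \ge 1$, the mapping $I^+ \to \mathbb{R}$, $c \mapsto \lambda_{c,k}$ is continuous, decreasing, and satisfies $\lim_{c \to 0^+} \lambda_{c,k} = \infty$ and $\lim_{c \to \infty} \lambda_{c,k} = -\infty$. (iii) For each $\lambda \in \mathbb{R}$, $\Phi_\lambda$ has a sequence of nontrivial critical points $(v_{\lambda,k})$ such that $\Phi_\lambda(v_{\lambda,k}) \nearrow \infty$ and $\|v_{\lambda,k}\| \to \infty$. Moreover, $\Phi_\lambda$ has no nontrivial critical point with critical value in $\mathbb{R}\setminus I^+$.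
   Context: Scaled framework. $W$ is a reflexive (real) Banach space with dual $W^*$; $\rightharpoonup$ is weak convergence. $W$ carries a scaling: a continuous map $W\times[0,\infty)\to W$, $(u,t)\mapsto u_t$, with (A1) $(u_{t_1})_{t_2}=u_{t_1t_2}$ for all $u\in W$, $t_1,t_2\ge0$; (A2) $(\tau u)_t=\tau u_t$ for all $u\in W$, $\tau\in\mathbb{R}$, $t\ge0$; (A3) $u_0=0$, $u_1=u$; (A4) $u_t$ is bounded on bounded sets in $W\times[0,\infty)$; (A5) for some (fixed) $s>0$, $\|u_t\|=O(t^s)$ as $t\to\infty$ uniformly in $u$ on bounded sets. A potential operator is $p\in C(W,W^* )$ that is the Fréchet derivative of some $P\in C^1(W,\mathbb{R})$ (its potential, normalized by $P(0)=0$). A scaled operator is an odd potential operator $A_s$ that maps bounded sets into bounded sets and satisfies $A_s(u_t)v_t=t^sA_s(u)v$ for all $u,v\in W$, $t\ge0$. Given are scaled operators $A_s,B_s$ with potentials $I_s(u)=\int_0^1A_s(\tau u)u\,d\tau$, $J_s(u)=\int_0^1B_s(\tau u)u\,d\tau$, and odd potential operators $f,g\in C(W,W^* )$ with potentials $F(u)=\int_0^1f(\tau u)u\,d\tau$, $G(u)=\int_0^1g(\tau u)u\,d\tau$, satisfying: (A6) $A_s(u)u>0$ for $u\ne0$; (A7) every sequence with $u_j\rightharpoonup u$ and $A_s(u_j)(u_j-u)\to0$ has a subsequence converging strongly to $u$; (A8) $B_s(u)u>0$ for $u\neq0$; (A9) $u_j\rightharpoonup u$ implies $B_s(u_j)\to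 B_s(u)$ in $W^*$; (A10) $I_s(u)\to\infty$ as $\|u\|\to\infty$; (A11) every solution of $A_s(u)=\lambda B_s(u)$ ($\lambda\in\mathbb{R}$) satisfies $I_s(u)=\lambda J_s(u)$; (H1) for some $r>s>q>0$, $f(u_t)v_t=t^qf(u)v$ and $g(u_t)v_t=t^rg(u)v$ for all $u,v\in W$, $t\ge0$; (H2) $u_j\rightharpoonup u$ implies $f(u_j)\to f(u)$ and $g(u_j)\to g(u)$ in $W^*$ (in particular $f,g$ map bounded sets into bounded sets); (H3) for all $\alpha,\beta,\gamma,\delta\in\mathbb{R}$, every solution of $\alpha A_s(u)=\beta B_s(u)+\gamma f(u)+\delta g(u)$ satisfies $s\alpha I_s(u)=s\beta J_s(u)+q\gamma F(u)+r\delta G(u)$. Notation. $\Phi_\lambda(u)=I_s(u)-\lambda J_s(u)-F(u)-G(u)$ on $W$. For $c\in\mathbb{R}$, $\lambda_c(u)=\dfrac{I_s(u)-F(u)-G(u)-c}{J_s(u)}$ on $W\setminus\{0\}$ (note $J_s>0$ there). $\mathcal{M}_s=\{u\in W:I_s(u)=1\}$. The scaled Nehari set is $\mathcal{N}_c=\{u_t:u\in\mathcal{M}_s,\ t>0,\ \varphi_{c,u}'(t)=0\}$ with $\varphi_{c,u}(t)=\lambda_c(u_t)$; equivalently $\mathcal{N}_c=\{u\in W\setminus\{0\}:(s-q)F(u)-(r-s)G(u)+cs=0\}$. $h(u)=(s-q)f(u)-(r-s)g(u)$. $\Lambda_c=\lambda_c|_{\mathcal{N}_c}$. $i(M)$ is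 the Fadell–Rabinowitz $\mathbb{Z}_2$-cohomological index of a symmetric ($M=-M$) set $M\subset W\setminus\{0\}$: $i(\emptyset)=0$, and for $M\neq\emptyset$, with $\overline M=M/\{u\sim-u\}$, classifying map $\theta:\overline M\to\mathbb{RP}^\infty$ of $M\to\overline M$, and $\omega$ the generator of $H^1(\mathbb{RP}^\infty;\mathbb{Z}_2)$, $i(M)=\sup\{m\ge1:\theta^*(\omega^{m-1})\neq0\}$ (Alexander–Spanier cohomology, $\mathbb{Z}_2$ coefficients). For $k\ge1$, $$\lambda_{c,k}=\inf\Big\{\sup_{u\in M}\Lambda_c(u): M\subset\mathcal{N}_c\text{ symmetric},\ i(M)\ge k\Big\}.$$ $a_k\nearrow a$ means $(a_k)$ is nondecreasing with limit $a$ (possibly $\infty$). ''Decreasing'' means strictly decreasing.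
   Formalization: W is additionally assumed infinite-dimensional: in finite dimension the index of a symmetric subset of W∖{0} is at most dim W, so λ_{c,k} = inf ∅ = ∞ for k > dim W and the claim fails (for example W = ℝ with power-type f and g). *)

(* Defs.v *)
From HB Require Import structures.
From mathcomp Require Import all_boot all_order all_algebra.
From mathcomp Require Import all_classical all_reals all_analysis.

Set Implicit Arguments.
Unset Strict Implicit.
Unset Printing Implicit Defensive.

Import Order.TTheory GRing.Theory Num.Theory.
Import numFieldNormedType.Exports.

Local Open Scope classical_set_scope.
Local Open Scope ring_scope.

Section dual.
Context (R : realType) (W : normedModType R).

Definition dual_pred : {pred W -> R^o} :=
  fun f => `[< linear f /\ continuous f >].

Record dual := Dual { dual_fun :> W -> R^o ; dual_funP : dual_fun \in dual_pred }.

HB.instance Definition _ := [isSub for dual_fun].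
HB.instance Definition _ := [Choice of dual by <:].

Lemma dual_pred_submod : submod_closed dual_pred.
Proof.
split=> [|a f g /asboolP[lf cf] /asboolP[lg cg]]; apply/asboolP.
  by split=> [a u v|]; [rewrite /= /GRing.zero /= scaler0 addr0|exact: cst_continuous].
split=> [b u v|u].
  rewrite -[LHS]/(a *: f (b *: u + v) + g (b *: u + v)).
  rewrite -[RHS]/(b *: (a *: f u + g u) + (a *: f v + g v)).
  rewrite lf lg !scalerDr !scalerA (mulrC a b) -!addrA; congr (_ + _).
  by rewrite addrCA.
apply: (@cvgD _ _ _ _ _ (fun x => a *: f x) g); last exact: cg.
by apply: cvgZl_tmp; exact: cf.
Qed.

HB.instance Definition _ :=
  GRing.isSubmodClosed.Build R (W -> R^o) dual_pred dual_pred_submod.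
HB.instance Definition _ := [SubChoice_isSubLmodule of dual by <:].

Implicit Types f g : dual.

Lemma dual_linear f : linear f.
Proof. by have /asboolP[] := dual_funP f. Qed.

Lemma dual_continuous f : continuous f.
Proof. by have /asboolP[] := dual_funP f. Qed.

Lemma dual_addE f g u : (f + g) u = f u + g u. Proof. by []. Qed.

Lemma dual_scaleE a f u : (a *: f) u = a * f u. Proof. by []. Qed.

Lemma dual_scale f a u : f (a *: u) = a * f u.
Proof.
have lf := @dual_linear f; have f0 : f 0 = 0.
  by have := lf (-1) 0 0; rewrite scaler0 addr0 scaleN1r addNr.
by have := lf a u 0; rewrite !addr0 f0 addr0.
Qed.

Definition dual_norm f : R := sup [set `|f u| | u in [set u : W | `|u| <= 1]].

Lemma dual_has_sup f : has_sup [set `|f u| | u in [set u : W | `|u| <= 1]].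
Proof.
split; first by exists `|f 0|, 0 => //=; rewrite normr0.
pose lf : {linear W -> R^o} := HB.pack (f : W -> R^o)
  (GRing.isLinear.Build _ _ _ _ (f : W -> R^o) (@dual_linear f)).
have /linear_bounded_continuous/bounded_funP/(_ 1)[M fM] :
  continuous lf by exact: dual_continuous.
by exists M => _ [u /= u1 <-]; exact: fM.
Qed.

Lemma dual_norm_ub f u : `|u| <= 1 -> `|f u| <= dual_norm f.
Proof. by move=> u1; apply: (ub_le_sup (dual_has_sup f).2); exists u. Qed.

Lemma dual_norm_le f M :
  (forall u, `|u| <= 1 -> `|f u| <= M) -> dual_norm f <= M.
Proof.
move=> fM; apply: ge_sup; first exact: (dual_has_sup f).1.
by move=> _ [u u1 <-]; exact: fM.
Qed.

Lemma dual_normD f g : dual_norm (f + g) <= dual_norm f + dual_norm g.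
Proof.
apply: dual_norm_le => u u1; rewrite dual_addE (le_trans (ler_normD _ _))//.
by rewrite lerD// dual_norm_ub.
Qed.

Lemma dual_normZ a f : dual_norm (a *: f) = `|a| * dual_norm f.
Proof.
have le b h : dual_norm (b *: h) <= `|b| * dual_norm h.
  apply: dual_norm_le => u u1; rewrite dual_scaleE normrM.
  by rewrite ler_wpM2l// dual_norm_ub.
have ge0 h : 0 <= dual_norm h.
  by apply: le_trans (dual_norm_ub h (u := 0) _) => //; rewrite normr0.
apply/eqP; rewrite eq_le le /=; have [->|a0] := eqVneq a 0.
  by rewrite normr0 mul0r ge0.
have := le a^-1 (a *: f); rewrite scalerA mulVf// scale1r normfV.
by rewrite -ler_pdivrMl ?invr_gt0 ?normr_gt0// invrK.
Qed.

Lemma dual_norm0_eq0 f : dual_norm f = 0 -> f = 0.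
Proof.
move=> f0; apply/val_inj/funext => u /=; rewrite -[RHS]/(0 : R).
have [->|u0] := eqVneq u 0; first by rewrite -(scale0r 0) dual_scale mul0r.
have nu : `|u| != 0 by rewrite normr_eq0.
have : `|f (`|u|^-1 *: u)| <= 0.
  rewrite -f0 dual_norm_ub// normrZ normfV normr_id mulVf//.
by rewrite normr_le0 dual_scale mulf_eq0 invr_eq0 (negbTE nu) => /eqP.
Qed.

HB.instance Definition _ := @Lmodule_isNormed.Build R dual dual_norm
  dual_normD dual_normZ dual_norm0_eq0.

End dual.

Section functional_analysis.
Context (R : realType) (W : normedModType R).

Definition reflexive_space :=
  forall phi : dual (dual W), exists u : W, forall f : dual W, phi f = f u.

Definition infinite_dimensional :=
  forall (n : nat) (e : 'I_n -> W),
    exists u : W, forall a : 'I_n -> R, u <> \sum_(i < n) a i *: e i.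

Definition weak_cvg (u : nat -> W) (w : W) :=
  forall f : dual W, f (u j) @[j --> \oo] --> f w.

Definition weak_to_strong (p : W -> dual W) :=
  forall u w, weak_cvg u w -> p (u j) @[j --> \oo] --> p w.

Definition potential_operator (p : W -> dual W) :=
  continuous p /\
  exists P : W -> R^o, forall u, is_diff u P (p u : W -> R^o).

Definition odd_operator (p : W -> dual W) := forall u, p (- u) = - p u.

Definition potential (p : W -> dual W) (u : W) : R :=
  \int[lebesgue_measure]_(t in `[0, 1]) p (t *: u) u.

Definition critical_point (P : W -> R) (u : W) :=
  is_diff u (P : W -> R^o) (0 : W -> R^o).

(* [sc u t] is u_t; only its values for [0 <= t] matter *)
Record is_scaling (s : R) (sc : W -> R -> W) : Prop := {
  scaling_continuous :
    {within [set x : W * R | 0 <= x.2], continuous (fun x => sc x.1 x.2)} ;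
  scalingM : forall u t1 t2, 0 <= t1 -> 0 <= t2 ->
    sc (sc u t1) t2 = sc u (t1 * t2) ;
  scalingZ : forall u tau t, 0 <= t -> sc (tau *: u) t = tau *: sc u t ;
  scaling0 : forall u, sc u 0 = 0 ;
  scaling1 : forall u, sc u 1 = u ;
  scaling_bounded : forall K T : R, exists C : R, forall u t,
    `|u| <= K -> 0 <= t <= T -> `|sc u t| <= C ;
  scaling_growth : forall K : R, exists C : R, \forall t \near +oo,
    forall u, `|u| <= K -> `|sc u t| <= C * t `^ s }.

Definition homogeneous (sc : W -> R -> W) (a : R) (p : W -> dual W) :=
  forall u v t, 0 <= t -> p (sc u t) (sc v t) = t `^ a * p u v.

Record scaled_operator (s : R) (sc : W -> R -> W) (p : W -> dual W) : Prop := {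
  scaled_odd : odd_operator p ;
  scaled_potential : potential_operator p ;
  scaled_bounded : forall B : set W, bounded_set B -> bounded_set (p @` B) ;
  scaled_homogeneous : homogeneous sc s p }.

End functional_analysis.

(* Alexander-Spanier cohomology with coefficients in Z/2: classes are handled
   through representatives, modulo the cochains that vanish on a neighbourhood
   of the diagonal.  Signs in the coboundary are superfluous mod 2. *)

Section alexander_spanier.
Implicit Types X Y : topologicalType.

Definition cochain (X : Type) (n : nat) := ('I_n.+1 -> X) -> 'F_2.

Definition locally_zero X n (phi : cochain X n) :=
  forall x : X, exists2 U : set X, nbhs x U &
    forall y : 'I_n.+1 -> X, (forall i, U (y i)) -> phi y = 0.

Definition coboundary (X : Type) n (phi : cochain X n) : cochain X n.+1 :=
  fun y => \sum_(i < n.+2) phi (y \o lift i).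

Definition is_cocycle X n (phi : cochain X n) := locally_zero (coboundary phi).

(* the class of the cocycle [phi] in H^n is zero *)
Definition null_class X n : cochain X n -> Prop :=
  match n with
  | 0 => fun phi => locally_zero phi
  | m.+1 => fun phi => exists psi : cochain X m,
      locally_zero (fun y => phi y - coboundary psi y)
  end.

Definition cup (X : Type) m n (phi : cochain X m) (psi : cochain X n) :
    cochain X (m + n) :=
  fun y => phi (fun i => y (inord i)) * psi (fun j => y (inord (m + j))).

Fixpoint cup_pow (X : Type) (phi : cochain X 1) n : cochain X n :=
  match n with
  | 0 => fun=> 1
  | m.+1 => cup phi (@cup_pow X phi m)
  end.

Definition pullback (X Y : Type) (h : X -> Y) n (phi : cochain Y n) :
    cochain X n :=
  fun x => phi (h \o x).

Definition H1_generator X (omega : cochain X 1) :=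
  [/\ is_cocycle omega, ~ null_class omega &
      forall phi : cochain X 1, is_cocycle phi ->
        exists a : 'F_2, null_class (fun y => phi y - a * omega y)].

End alexander_spanier.

Arguments cup_pow {X} phi n _.

Section orbit_space.
Local Open Scope quotient_scope.
Context {E : PreTopologicalZmodule.type} (A : set E).

Let antipodal_rel (u v : A) := (\val u == \val v) || (\val u == - \val v).

Let antipodal_refl : reflexive antipodal_rel.
Proof. by move=> u; rewrite /antipodal_rel eqxx. Qed.

Let antipodal_sym : symmetric antipodal_rel.
Proof.
by move=> u v; rewrite /antipodal_rel eq_sym [X in _ || X]eq_sym eqr_oppLR.
Qed.

Let antipodal_trans : transitive antipodal_rel.
Proof.
move=> v u w; rewrite /antipodal_rel => /orP[]/eqP -> //.
by rewrite eqr_opp eqr_oppLR orbC.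
Qed.

Definition antipodal :=
  EquivRel _ antipodal_refl antipodal_sym antipodal_trans.

Definition orbit_space := {eq_quot antipodal}.

HB.instance Definition _ :=
  Topological.copy orbit_space (quotient_topology orbit_space).
HB.instance Definition _ := Quotient.on orbit_space.

Definition orbit_proj (u : A) : orbit_space := \pi_orbit_space u.

End orbit_space.

(* R^oo: finitely supported sequences, realized as coefficient sequences of
   polynomials, with the direct limit topology of R^0 < R^1 < R^2 < ... *)
Definition Rinfty (R : realType) : Type := {poly R}.

Section Rinfty.
Context (R : realType).

HB.instance Definition _ := GRing.Zmodule.on (Rinfty R).

Definition Rinfty_open : set_system (Rinfty R) :=
  fun U => forall n, open [set v : 'rV[R]_n | U (rVpoly v)].

Lemma Rinfty_openT : Rinfty_open setT.
Proof. by move=> n; exact: openT. Qed.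

Lemma Rinfty_openI : setI_closed Rinfty_open.
Proof. by move=> U V oU oV n; exact: openI (oU n) (oV n). Qed.

Lemma Rinfty_open_bigU (I : Type) (f : I -> set (Rinfty R)) :
  (forall i, Rinfty_open (f i)) -> Rinfty_open (\bigcup_i f i).
Proof.
move=> of_ n.
have -> : [set v : 'rV[R]_n | (\bigcup_i f i) (rVpoly v)] =
  \bigcup_i [set v : 'rV[R]_n | f i (rVpoly v)] by [].
by apply: bigcup_open => i _; exact: of_.
Qed.

HB.instance Definition _ := isOpenTopological.Build (Rinfty R)
  Rinfty_openT Rinfty_openI Rinfty_open_bigU.

Definition Sinfty : set (Rinfty R) :=
  [set x | \sum_(i < size (x : {poly R})) (x : {poly R})`_i ^+ 2 = 1].

Definition RPinfty := orbit_space Sinfty.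

End Rinfty.

Arguments Sinfty R : clear implicits.

Section index.
Context (R : realType) (W : normedModType R).

Definition symmetric_set (M : set W) := forall u, M u -> M (- u).

(* [theta] pulls the double cover S^oo -> RP^oo back to M -> M/{u ~ -u}:
   it is covered by a continuous odd map M -> S^oo. *)
Definition classifying_map (M : set W) (theta : orbit_space M -> RPinfty R) :=
  continuous theta /\
  exists lift : M -> Sinfty R,
    [/\ continuous lift,
        forall u v : M, \val v = - \val u -> \val (lift v) = - \val (lift u) &
        forall u : M, theta (orbit_proj u) = orbit_proj (lift u)].

(* For a symmetric M contained in W \ {0}, which is metrizable, a classifying
   map exists and is unique up to homotopy; the generator omega is unique up
   to cohomology.  Hence the quantification below is independent of choices. *)
Definition fr_index (M : set W) : \bar R :=
  if `[< M = set0 >] then 0%E else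
  ereal_sup [set m%:R%:E | m in [set m : nat | (1 <= m)%N /\
    forall (theta : orbit_space M -> RPinfty R)
           (omega : cochain (RPinfty R) 1),
      classifying_map theta -> H1_generator omega ->
      ~ null_class (pullback theta (cup_pow omega m.-1))]].

End index.

Section functionals.
Context (R : realType) (W : normedModType R).
Variables (sc : W -> R -> W) (As Bs f g : W -> dual W).

Definition Phi (lambda : R) (u : W) : R :=
  potential As u - lambda * potential Bs u - potential f u - potential g u.

(* lambda_c; only its values for u <> 0 are meaningful *)
Definition lambda_fun (c : R) (u : W) : R :=
  (potential As u - potential f u - potential g u - c) / potential Bs u.

Definition Ms : set W := [set u | potential As u = 1].

Definition nehari (c : R) : set W :=
  [set w | exists u (t : R), [/\ Ms u, 0 < t,
     is_derive t 1 (fun t : R => lambda_fun c (sc u t)) 0 &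
     w = sc u t]].

Definition minimax (c : R) (k : nat) : \bar R :=
  ereal_inf [set ereal_sup [set (lambda_fun c u)%:E | u in M] | M in
    [set M : set W | [/\ M `<=` nehari c, symmetric_set M &
                         (k%:R%:E <= fr_index M)%E]]].

End functionals.

(* Main.v *)
(* Along each fibre [t |-> u_t] the function [lambda_c] has a unique critical point,
   where it is maximal; call the maximum [fibre_max c u].  It is even and invariant
   under scaling, so projecting onto the Nehari set, or back onto [I = 1], turns the
   minimax over [nehari c] into the minimax of [fibre_max c] over symmetric subsets
   of [I = 1].

   Minimax levels are critical: (A7) and the weak continuity of [Bs], [f], [g] give
   the Palais-Smale condition for the formal differential [fibre_diff c] of
   [fibre_max c].  As the operators are merely continuous, there is no gradient flow;
   a continuous odd field of descent directions comes from A. H. Stone's partition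
   of unity, and Euler polygons with locally chosen step lengths, which converge
   because their lengths are summable, push sublevels down.  No constraint is
   needed: the energy [I] varies little along the polygons, and the reduced
   functional is scale invariant.

   For the index, [H^1] of infinite projective space is generated by the transition
   cocycle of its double cover.  An odd map to [R^m \ 0] makes its m-th power vanish,
   and pairing the powers with iterated cones over antipodal chains shows that they
   do not vanish on odd images of spheres.  Sublevels have finite index since [Bs]
   maps them to totally bounded sets away from 0; hence the levels tend to infinity.

   Finally [fibre_max c] decreases in [c] at a rate controlled uniformly on
   sublevels, which gives (ii), and (iii) follows by solving [lambda_{c,k} = lambda]
   for [c]. *)
Require Import Defs.
From HB Require Import structures.
From mathcomp Require Import all_boot all_order all_algebra.
From mathcomp Require Import all_classical all_reals all_analysis.
From mathcomp Require wochoice.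
From mathcomp Require Import ring lra.

Set Implicit Arguments.
Unset Strict Implicit.
Unset Printing Implicit Defensive.

Import Order.TTheory GRing.Theory Num.Theory.
Import numFieldNormedType.Exports.

Local Open Scope classical_set_scope.
Local Open Scope ring_scope.

(** * Cochains modulo 2 and antipodal chains on the sphere *)

(** [fr_index] ranges over all classifying maps and all generators of H^1. An upper bound needs one
    explicit pair whose power pulls back to zero, so a generator on infinite projective space has to
    be exhibited; that takes connectedness and vanishing H^1 of the infinite sphere. A lower bound
    needs every pair, and each yields the same datum: an odd primitive of the lifted cocycle. As
    [fibre_max] is a maximum over time, evaluating an earlier point at the maximizing time of a
    later one bounds increments from above; the deformation uses only this one-sided estimate. The
    number of Euler steps needed varies from point to point; the polygons become a continuous odd
    map because the last step is carried out in part, governed by a continuous even bound for that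
    number. Weak limits of points of unit energy might be 0, where the reduced functional makes no
    sense. A bound on [fibre_max] excludes this: at a suitable time the energy term would persist
    while all others become small. Hence many uniform estimates are stated on sublevels only. *)

Section two_element_field.
Implicit Types x y z : 'F_2.

Lemma F2_addxx x : x + x = 0.
Proof. by rewrite -mulr2n -mulr_natr (_ : 2%:R = 0) ?mulr0//; apply/val_inj. Qed.

Lemma F2_opp x : - x = x.
Proof. by apply/eqP; rewrite eq_sym -subr_eq0 opprK F2_addxx. Qed.

(** [ring] does not know that 2 = 0 here. The doubled [z] collects the terms that cancel in pairs,
    so that the remaining identity holds in every commutative ring. *)
Lemma F2_eq z x y : x + y = z + z -> x = y.
Proof. by rewrite F2_addxx => /eqP; rewrite addr_eq0 F2_opp => /eqP. Qed.

Lemma F2_case x : x = 0 \/ x = 1.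
Proof. by case: x => -[|[|//]] i; [left|right]; exact/val_inj. Qed.

Lemma F2_neq01 : (0 : 'F_2) <> 1.
Proof. by []. Qed.

End two_element_field.

Section seq_cochains.
Context {X : Type}.
Implicit Types (phi psi : seq X -> 'F_2) (s t : seq X) (w : X -> X -> 'F_2).

(** Sum of [phi] over the lists obtained by deleting one entry of [s]. Cochains are taken on lists
    of all lengths at once, so that computations with [lift] become inductions on lists. On a
    singleton the value is [phi [::]], whence the later conditions on the empty list. *)
Fixpoint bd phi s : 'F_2 :=
  if s is x :: t then phi t + bd (fun u => phi (x :: u)) t else 0.

Lemma eq_bd phi psi s : phi =1 psi -> bd phi s = bd psi s.
Proof.
elim: s phi psi => //= x s ih phi psi e; rewrite e; congr (_ + _).
by apply: ih => u; exact: e.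
Qed.

Lemma bdD phi psi s : bd (fun u => phi u + psi u) s = bd phi s + bd psi s.
Proof.
elim: s phi psi => [|x s ih] phi psi /=; first by rewrite addr0.
by rewrite (ih (fun u => phi (x :: u)) (fun u => psi (x :: u))) addrACA.
Qed.

Lemma bdZ a phi s : bd (fun u => a * phi u) s = a * bd phi s.
Proof.
elim: s phi => [|x s ih] phi /=; first by rewrite mulr0.
by rewrite (ih (fun u => phi (x :: u))) mulrDr.
Qed.

Lemma bd_codom n psi (y : 'I_n.+1 -> X) :
  bd psi (codom y) = \sum_(i < n.+1) psi (codom (y \o lift i)).
Proof.
have codomS m (z : 'I_m.+1 -> X) : codom z = z ord0 :: codom (z \o lift ord0).
  by rewrite !codomE enum_ordSl /= -map_comp.
elim: n psi y => [|n ih] psi y; rewrite codomS /=.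
  by rewrite big_ord1 [codom _](_ : _ = [::]) ?addr0// codomE enum_ord0.
rewrite ih [RHS]big_ord_recl; congr (_ + _); apply: eq_bigr => i _.
rewrite [in RHS](codomS _ (y \o lift (lift ord0 i))) /=.
congr psi; congr (_ :: _).
  by congr y; apply/val_inj.
rewrite (_ : (_ \o _) \o _ = (y \o lift (lift ord0 i)) \o lift ord0)//.
by apply/funext => j /=; congr y; apply/val_inj; rewrite /= /bump /= !add1n ltnS addnS.
Qed.

Lemma coboundary_codom n psi (y : 'I_n.+2 -> X) :
  coboundary (fun z : 'I_n.+1 -> X => psi (codom z)) y = bd psi (codom y).
Proof. by rewrite bd_codom. Qed.

Definition seq_cochain n (phi : cochain X n) s : 'F_2 :=
  if s is x :: _ then phi (fun i => nth x s i) else 0.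

Lemma seq_cochain_codom n (phi : cochain X n) y :
  seq_cochain phi (codom y) = phi y.
Proof.
rewrite /seq_cochain; case E : (codom y) => [|x s].
  by have := f_equal size E; rewrite size_codom card_ord.
rewrite -E; congr phi; apply/funext => i.
by rewrite codomE (nth_map i) ?size_enum_ord// nth_ord_enum.
Qed.

Lemma coboundaryE n (phi : cochain X n) y :
  coboundary phi y = bd (seq_cochain phi) (codom y).
Proof. by rewrite bd_codom; apply: eq_bigr => i _; rewrite seq_cochain_codom. Qed.

Fixpoint cup_prod w s : 'F_2 :=
  if s is x :: t then if t is y :: _ then w x y * cup_prod w t else 1 else 1.

Definition cochain2 (omega : cochain X 1) x y : 'F_2 :=
  seq_cochain omega [:: x; y].

Lemma cup_powE (omega : cochain X 1) n y :
  cup_pow omega n y = cup_prod (cochain2 omega) (codom y).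
Proof.
elim: n y => [|n ih] y.
  by rewrite codomE enum_ordSl enum_ord0.
rewrite (_ : codom y = [seq y i | i <- [:: ord0, lift ord0 ord0 &
  map (lift ord0 \o lift ord0) (enum 'I_n)]]); last first.
  by rewrite codomE 2!enum_ordSl /= -!map_comp.
rewrite -[LHS]/(omega (fun i => y (inord i)) *
  cup_pow omega n (fun j => y (inord (1 + j)))) ih.
rewrite [RHS]/=; congr (_ * _).
  rewrite /cochain2 /=; congr omega; apply/funext => -[[|[|//]] i] /=.
    by congr y; apply/val_inj; rewrite /= inordK.
  by congr y; apply/val_inj; rewrite /= inordK.
rewrite codomE enum_ordSl; congr (cup_prod _ (_ :: _)).
  by congr y; apply/val_inj; rewrite /= inordK.
rewrite -[LHS]/(map _ _) -!map_comp; apply: eq_map => i /=; congr y; apply/val_inj.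
by rewrite /= inordK /bump//= !add1n !ltnS.
Qed.

Lemma seq_codom n s : size s = n.+1 -> exists y : 'I_n.+1 -> X, s = codom y.
Proof.
case: s => // x s /= sn; exists (fun i => nth x (x :: s) i).
rewrite codomE; apply: (@eq_from_nth _ x) => [|i]; first by rewrite /= size_map size_enum_ord.
by rewrite /= sn => ni; rewrite (nth_map ord0) ?size_enum_ord// nth_enum_ord.
Qed.

Definition cup1 w psi s : 'F_2 :=
  if s is x :: t then if t is y :: _ then w x y * psi t else 0 else 0.

(** Leibniz rule mod 2: the term with the coboundary of [w] drops out by the cocycle identity on
    triples starting with [x] and [y]. *)
Lemma bd_cup1 w psi x y t : psi [::] = 0 ->
  (forall z, List.In z t -> w y z + w x z + w x y = 0) ->
  bd (cup1 w psi) (x :: y :: t) = w x y * bd psi (y :: t).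
Proof.
move=> psi0; case: t => [_|z t cw] /=; first by rewrite psi0 !(addr0, mulr0).
rewrite -[X in _ = X]/(w x y * (psi (z :: t) +
  (psi (y :: t) + bd (fun u => psi [:: y, z & u]) t))).
rewrite -[X in X = _]/(w y z * psi (z :: t) + (w x z * psi (z :: t) +
   (w x y * psi (y :: t) + bd (fun u => w x y * psi [:: y, z & u]) t))).
rewrite bdZ !mulrDr addrA -mulrDl; congr (_ + _); congr (_ * _).
by apply: (@F2_eq 0); rewrite addr0 (cw z)//; left.
Qed.

Lemma bd_cup0 (chi : X -> 'F_2) psi x y t :
  bd (fun s => if s is z :: _ then chi z * psi s else 0) (x :: y :: t) =
  (chi x + chi y) * psi (y :: t) + chi x * bd psi (x :: y :: t).
Proof.
rewrite /= bdZ !mulrDr; set b := bd _ _.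
by apply: (@F2_eq ((chi x + chi y) * psi (y :: t) +
  chi x * (psi (x :: t) + b))); ring.
Qed.

End seq_cochains.

Lemma bd_map (X Y : Type) (h : X -> Y) phi s :
  bd (fun u => phi (map h u)) s = bd phi (map h s).
Proof.
by elim: s phi => //= x s ih phi; rewrite (ih (fun u => phi (h x :: u))).
Qed.

Section twisted_products.
Context {X : Type} (w : X -> X -> 'F_2) (U : X -> Prop).
Hypothesis wU : forall x y z, U x -> U y -> U z -> w y z + w x z + w x y = 0.

(** [w] plus the coboundary of [chi]: another representative of the same class. *)
Definition twist (chi : X -> 'F_2) x y := w x y + (chi x + chi y).

(** A power of the class of [w] in which every factor has its own representative, twisted by the
    corresponding entry of [l]. The factors can then be made to vanish on different open sets. *)
Fixpoint twisted_prod (l : seq (X -> 'F_2)) s : 'F_2 :=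
  if s is x :: t then if t is y :: _ then
    twist (head (fun=> 0) l) x y * twisted_prod (behead l) t else 1 else 1.

Lemma twisted_prodS l x y t : twisted_prod l [:: x, y & t] =
  twist (head (fun=> 0) l) x y * twisted_prod (behead l) (y :: t).
Proof. by []. Qed.

Lemma bd_twisted_prod l s : List.Forall U s -> (1 < size s)%N ->
  bd (twisted_prod l) s = 0.
Proof.
elim: s l => // x [//|y [|z t]] ih l; first by rewrite /= addr0 F2_addxx.
move=> Us _; rewrite (_ : bd _ _ = bd (cup1 (twist (head (fun=> 0) l))
   (fun s => if s is [::] then 0 else twisted_prod (behead l) s)) [:: x, y, z & t]).
  rewrite bd_cup1//.
    rewrite (_ : bd _ _ = 0) ?mulr0//.
    rewrite -[RHS](ih (behead l)) //=; last by inversion Us.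
  move=> v vt; rewrite /twist.
  have Uv : U v by move/List.Forall_forall: Us; apply; right; right.
  have Ux : U x by inversion Us.
  have Uy : U y by inversion Us as [|? ? ? Us']; inversion Us'.
  apply: (@F2_eq (head (fun=> 0) l x + head (fun=> 0) l y + head (fun=> 0) l v)).
  by rewrite addr0 -[RHS]add0r -(wU Ux Uy Uv); ring.
by rewrite /=; congr (_ + (_ + (_ + _))); apply: eq_bd => u.
Qed.

End twisted_products.

(** The representatives of the factors are exchanged one at a time, by the two Leibniz rules. [psi]
    depends on [w], [l] and [n] but not on [U]: one and the same [psi] serves all members of a
    cover. *)
Lemma cup_prod_cohom (X : Type) (w : X -> X -> 'F_2) (l : seq (X -> 'F_2)) n :
  exists2 psi : seq X -> 'F_2, psi [::] = 0 &
  forall U : X -> Prop,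
    (forall x y z, U x -> U y -> U z -> w y z + w x z + w x y = 0) ->
    forall s, List.Forall U s -> size s = n.+1 ->
      cup_prod w s = twisted_prod w l s + bd psi s.
Proof.
elim: n l => [|n ih] l.
  by exists (fun=> 0) => // U _ [//|x [|//]] _ _ /=; rewrite !addr0.
have [psi psi0 psiE] := ih (behead l).
pose chi : X -> 'F_2 := head (fun=> 0) l.
pose P := twisted_prod w (behead l).
pose eta s : 'F_2 := if s is z :: _ then chi z * P s else 0.
exists (fun s => cup1 w psi s + eta s); first by rewrite addr0.
move=> U wU [//|x [//|y t]] Us st.
have Ux : U x by inversion Us.
have Uyt : List.Forall U (y :: t) by inversion Us.
have Uy : U y by inversion Uyt.
rewrite bdD bd_cup1// /eta; last first.
  move=> z zt; apply: wU => //; move/List.Forall_forall: Uyt; apply.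
  by right.
rewrite bd_cup0 (bd_twisted_prod wU)// mulr0 addr0.
have -> : cup_prod w [:: x, y & t] = w x y * cup_prod w (y :: t) by [].
rewrite (psiE U)//; last by case: st => /= ->.
rewrite twisted_prodS -/chi -/P /twist.
move: (P (y :: t)) (bd psi (y :: t)) => p b.
by apply: (@F2_eq (w x y * (p + b) + (chi x + chi y) * p)); ring.
Qed.

Section prism.
Context {V : Type}.
Implicit Types (h : V -> V) (phi psi : seq V -> 'F_2) (s t : seq V).
Implicit Types c : seq (seq V).

Definition ev phi c := \sum_(s <- c) phi s.

(** The usual subdivision of a prism into the lists h v_0, ..., h v_i, h' v_i, ..., h' v_n; it is a
    chain homotopy between [map h] and [map h']. *)
Fixpoint prism h h' s : seq (seq V) :=
  if s is v :: t then (h v :: map h' s) :: map (cons (h v)) (prism h h' t)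
  else [::].

Lemma ev_cat phi c1 c2 : ev phi (c1 ++ c2) = ev phi c1 + ev phi c2.
Proof. by rewrite /ev big_cat. Qed.

Lemma ev_cons phi s c : ev phi (s :: c) = phi s + ev phi c.
Proof. by rewrite /ev big_cons. Qed.

Lemma ev_map phi (h : seq V -> seq V) c : ev phi (map h c) = ev (phi \o h) c.
Proof. by rewrite /ev big_map. Qed.

Lemma evD phi psi c : ev (fun s => phi s + psi s) c = ev phi c + ev psi c.
Proof. by rewrite /ev big_split. Qed.

Lemma eq_ev phi psi c : phi =1 psi -> ev phi c = ev psi c.
Proof. by move=> e; apply: eq_bigr. Qed.

Lemma prism_homotopy h h' phi s :
  ev (bd phi) (prism h h' s) + bd (fun u => ev phi (prism h h' u)) s =
  phi (map h s) + phi (map h' s).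
Proof.
elim: s phi => [|v t ih] phi; first by rewrite /ev /= big_nil addr0 F2_addxx.
rewrite [prism _ _ _]/= ev_cons ev_map.
rewrite (@eq_ev (bd phi \o _) (fun u => phi u + bd (phi \o cons (h v)) u))// evD.
rewrite [X in _ + X = _]/=.
rewrite (@eq_bd _ _ (fun u => phi [:: h v, h' v & map h' u] +
  ev (phi \o cons (h v)) (prism h h' u)) t); last first.
  by move=> u; rewrite ev_cons ev_map.
rewrite bdD (@bd_map _ _ h' (fun u => phi [:: h v, h' v & u])).
have := ih (phi \o cons (h v)) => /=.
set a := ev (bd _) _; set b := bd (fun u => ev (_ \o _) _) _ => e.
have {}e : a = phi (h v :: map h t) + phi (h v :: map h' t) + b.
  by rewrite -e -addrA F2_addxx addr0.
rewrite -/a {}e.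
set p1 := phi (h' v :: _); set p2 := phi (h v :: _ h' _); set p3 := bd _ _.
set p4 := ev _ _; set p5 := phi _.
by apply: (@F2_eq (p1 + p2 + p3 + p4 + p5 + b)); ring.
Qed.

End prism.

Section sphere_chain.
Context {R : realType} {V : normedModType R} (e : nat -> V) (N : nat).
Hypothesis N0 : (0 < N)%N.
Implicit Types (phi psi : seq V -> 'F_2) (s : seq V) (x y v : V).

Definition level (a : V) (i : nat) v : V := (1 - i%:R / N%:R) *: v + (i%:R / N%:R) *: a.

(* Cone with apex [a] over [c + Tc], T the antipodal map. *)
Definition cone (a : V) (c : seq (seq V)) :=
  flatten [seq flatten [seq prism (level a i) (level a i.+1) s
                       | s <- c ++ map (map -%R) c] | i <- iota 0 N].

(** Hemispheres of increasing dimension: the boundary of each is the preceding one plus its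
    antipode, that is, the equator. *)
Fixpoint sphere_chain (j : nat) : seq (seq V) :=
  if j is j'.+1 then cone (e j) (sphere_chain j') else [:: [:: e 0]].

Lemma ev_flatten (T : Type) phi (F : T -> seq (seq V)) (r : seq T) :
  ev phi (flatten [seq F i | i <- r]) = \sum_(i <- r) ev phi (F i).
Proof.
elim: r => [|i r ih]; first by rewrite big_nil /ev big_nil.
by rewrite [map _ _]/= [flatten _]/= ev_cat ih big_cons.
Qed.

Lemma sum_telescope (a : nat -> 'F_2) n :
  \sum_(i <- iota 0 n) (a i + a i.+1) = a 0 + a n.
Proof.
elim: n => [|n ih]; first by rewrite big_nil F2_addxx.
have -> : iota 0 n.+1 = iota 0 n ++ [:: n] by rewrite -[in LHS]addn1 iotaD.
rewrite big_cat ih /= big_cons big_nil addr0.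
by rewrite addrA -(addrA (a 0)) F2_addxx addr0.
Qed.

Lemma level0 a v : level a 0 v = v.
Proof. by rewrite /level mul0r subr0 scale1r scale0r addr0. Qed.

Lemma levelN a v : level a N v = a.
Proof.
by rewrite /level divff ?pnatr_eq0 -?lt0n// subrr scale0r add0r scale1r.
Qed.

(** The prisms between consecutive levels telescope. The bottom gives [c] and its antipode; at level
    [N] everything is collapsed to [a], so there the two contributions agree and cancel mod 2. The
    lateral terms vanish because the base is a cycle. *)
Lemma cone_bd a c phi :
  (forall chi, ev (bd chi) c + ev (bd chi \o map -%R) c = 0) ->
  ev (bd phi) (cone a c) = ev phi c + ev (phi \o map -%R) c.
Proof.
move=> c0; rewrite ev_flatten; set z := _ ++ _.
have bdz chi : ev (bd chi) z = 0 by rewrite ev_cat ev_map c0.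
pose b i := ev (phi \o map (level a i)) z.
rewrite (eq_bigr (fun i => b i + b i.+1)); last first.
  move=> i _; rewrite ev_flatten /b -evD -[RHS]addr0.
  set h := level _ _; set h' := level _ _.
  rewrite -[X in _ + X](bdz (fun u => ev phi (prism h h' u))) -evD /ev.
  apply: eq_bigr => s _; rewrite -/(ev _ _) -[in RHS](prism_homotopy h h' phi).
  by rewrite -addrA F2_addxx addr0.
rewrite sum_telescope /b.
have -> : phi \o map (level a 0) = phi.
  apply/funext => s /=; congr phi; rewrite -[RHS]map_id; apply: eq_map => v.
  exact: level0.
rewrite ev_cat ev_map -[RHS]addr0; congr (_ + _).
rewrite ev_cat ev_map (_ : (_ \o _) \o _ = phi \o map (level a N)).
  by rewrite F2_addxx.
apply/funext => s /=; rewrite -map_comp; congr phi; apply: eq_map => v /=.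
by rewrite !levelN.
Qed.

Lemma sphere_chain_cycle j phi :
  ev (bd phi) (sphere_chain j) + ev (bd phi \o map -%R) (sphere_chain j) = 0.
Proof.
elim: j phi => [|j ih] phi.
  by rewrite /= !ev_cons /ev !big_nil /= !addr0 F2_addxx.
rewrite (_ : bd phi \o _ = bd (phi \o map -%R)); last first.
  by apply/funext => s /=; rewrite -bd_map.
rewrite -[sphere_chain j.+1]/(cone (e j.+1) (sphere_chain j)) !cone_bd//.
rewrite (_ : (phi \o map -%R) \o map -%R = phi); last first.
  apply/funext => s /=; rewrite -map_comp (_ : map _ s = s)//.
  by rewrite -[RHS]map_id; apply: eq_map => v /=; rewrite opprK.
by rewrite (addrC (ev phi _)) F2_addxx.
Qed.

Lemma sphere_chain_bd j phi :
  ev (bd phi) (sphere_chain j.+1) =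
  ev phi (sphere_chain j) + ev (phi \o map -%R) (sphere_chain j).
Proof. exact/cone_bd/sphere_chain_cycle. Qed.

Lemma prism_mem (h h' : V -> V) s s' x : s' \in prism h h' s -> x \in s' ->
  exists2 v, v \in s & x = h v \/ x = h' v.
Proof.
elim: s s' => //= v t ih s'; rewrite inE => /orP[/eqP ->|].
  rewrite inE => /orP[/eqP ->|]; first by exists v; [rewrite inE eqxx|left].
  rewrite -map_cons => /mapP[u ut ->]; exists u => //; by right.
case/mapP => t' t't ->; rewrite inE => /orP[/eqP ->|xt'].
  by exists v; [rewrite inE eqxx|left].
by have [u ut xu] := ih _ t't xt'; exists u; rewrite // inE ut orbT.
Qed.

Lemma prism_size (h h' : V -> V) s s' : s' \in prism h h' s ->
  size s' = (size s).+1.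
Proof.
elim: s s' => //= v t ih s'; rewrite inE => /orP[/eqP ->|].
  by rewrite /= size_map.
by case/mapP => t' /ih st' ->; rewrite /= st'.
Qed.

Lemma sphere_chainS_mem j s' : s' \in sphere_chain j.+1 ->
  exists i s, [/\ (i < N)%N, s \in sphere_chain j \/
    exists2 t, t \in sphere_chain j & s = map -%R t &
    s' \in prism (level (e j.+1) i) (level (e j.+1) i.+1) s].
Proof.
case/flattenP => c /mapP[i]; rewrite mem_iota add0n => iN ->.
case/flattenP => d /mapP[s + ->] s's; rewrite mem_cat => sz.
exists i, s; split => //; case/orP: sz => [|/mapP[t tj ->]]; first by left.
by right; exists t.
Qed.

Lemma sphere_chain_size j s : s \in sphere_chain j -> size s = j.+1.
Proof.
elim: j s => [|j ih] s; first by rewrite /= inE => /eqP ->.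
case/sphere_chainS_mem => i [t [_ tj /prism_size ->]].
by case: tj => [/ih ->//|[u /ih uj ->]]; rewrite size_map uj.
Qed.

(** [K j] stands for a symmetric j-dimensional sphere carrying the j-th chain; the segments from its
    points to the next apex lie in the next sphere. *)
Variables (n : nat) (K : nat -> V -> Prop).
Hypothesis K0 : K 0 (e 0).
Hypothesis KN : forall j v, K j v -> K j (- v).
Hypothesis KS : forall j v (t : R), (j < n)%N -> K j v -> 0 <= t <= 1 ->
  K j.+1 ((1 - t) *: v + t *: e j.+1).
Hypothesis K1 : forall j v, K j v -> `|v| <= 1.
Hypothesis e1 : forall j, `|e j| <= 1.

Lemma itv_level i : (i <= N)%N -> 0 <= i%:R / N%:R :> R /\ i%:R / N%:R <= 1 :> R.
Proof.
move=> iN; have N0' : 0 < N%:R :> R by rewrite ltr0n.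
by rewrite divr_ge0// ler_pdivrMr// mul1r ler_nat iN; split.
Qed.

Lemma sphere_chain_sub j s v : (j <= n)%N ->
  s \in sphere_chain j -> v \in s -> K j v.
Proof.
elim: j s v => [|j ih] s v jn.
  by rewrite /= inE => /eqP ->; rewrite inE => /eqP ->.
have {}ih s' v' := ih s' v' (ltnW jn).
case/sphere_chainS_mem => i [t [iN tj /prism_mem vs /vs [u ut uv]]].
have Ku : K j u.
  case: tj => [/ih|[t' /ih t't tE]]; first exact.
  by move: ut; rewrite tE => /mapP[u' /t't Ku' ->]; exact: KN.
by case: uv => ->; apply: KS => //; apply/andP; apply: itv_level; rewrite // ltnW.
Qed.

Lemma level_dist a v v' i k : `|a| <= 1 -> `|v'| <= 1 -> (i <= N)%N ->
  (i <= k.+1)%N -> (k <= i.+1)%N ->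
  `|level a i v - level a k v'| <= `|v - v'| + 2 / N%:R.
Proof.
move=> a1 v'1 iN ik ki; rewrite /level.
have [t0 t1] := itv_level iN.
set p := i%:R / N%:R in t0 t1 *; set q := k%:R / N%:R.
have -> : (1 - p) *: v + p *: a - ((1 - q) *: v' + q *: a) =
          (1 - p) *: (v - v') + (q - p) *: (v' - a).
  rewrite scalerBr [in RHS]scalerBr [(q - p) *: a]scalerBl.
  rewrite (_ : q - p = (1 - p) - (1 - q)); last by ring.
  rewrite [(1 - p - (1 - q)) *: v']scalerBl.
  move: (_ *: v) ((1 - p) *: v') (_ *: v') (q *: a) (p *: a) => A B C D E.
  by rewrite opprD opprB [LHS]addrACA [RHS]addrA; congr (_ + _); rewrite addrA subrK.
rewrite (le_trans (ler_normD _ _))// !normrZ.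
apply: lerD; first by rewrite ler_piMl// ger0_norm ?subr_ge0// gerBl.
rewrite mulrC ler_pM//.
  by rewrite (le_trans (ler_normB _ _))//; rewrite -[2]/(1 + 1) lerD.
rewrite -mulrBl normrM normfV normr_nat ler_piMl ?invr_ge0//.
have ik' : i%:R <= k%:R + 1 :> R by rewrite natr1 ler_nat.
have ki' : k%:R <= i%:R + 1 :> R by rewrite natr1 ler_nat.
by rewrite ler_norml; apply/andP; split; lra.
Qed.

(** Contraction towards the apex does not increase distances, and passing to an adjacent level moves
    a point of the unit ball by at most 2/N. So every cone adds at most 2/N to the diameters. *)
Lemma sphere_chain_mesh j s x y : (j <= n)%N -> s \in sphere_chain j -> x \in s -> y \in s ->
  `|x - y| <= j%:R * (2 / N%:R).
Proof.
elim: j s x y => [|j ih] s x y jn.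
  by rewrite /= inE => /eqP ->; rewrite !inE => /eqP -> /eqP ->; rewrite subrr normr0 mul0r.
case/sphere_chainS_mem => i [t [iN tj sP xs ys]].
have {}ih s' x' y' := ih s' x' y' (ltnW jn).
have subj := sphere_chain_sub (ltnW jn).
have [u ut xu] := prism_mem sP xs; have [v vt yv] := prism_mem sP ys.
have [uv Kv] : `|u - v| <= j%:R * (2 / N%:R) /\ K j v.
  case: tj => [tj|[t' t'j tE]].
    by split; [exact: ih ut vt|exact: subj tj vt].
  move: ut vt; rewrite tE => /mapP[u' u't' ->] /mapP[v' v't' ->].
  rewrite -opprD normrN; split; first exact: ih t'j u't' v't'.
  exact/KN/(subj _ _ t'j v't').
rewrite -natr1 mulrDl mul1r.
have v1 := K1 Kv; have e1' := e1 j.+1.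
case: xu yv => -> [] ->; apply: (le_trans (level_dist _ _ _ _ _ _)) => //;
  rewrite ?lerD2r// ?(leqW (leqW _))//; exact: ltnW.
Qed.

Variable eps : V -> 'F_2.
Hypothesis epsN : forall j v, K j v -> eps (- v) = eps v + 1.

Let w x y := eps x + eps y.

Lemma cup_prod_antipode j s : (forall v, v \in s -> K j v) ->
  cup_prod w (map -%R s) = cup_prod w s.
Proof.
elim: s => // x [//|y t] ih Ks; rewrite [LHS]/=.
rewrite -[X in _ * X]/(cup_prod w (map -%R (y :: t))) ih; last first.
  by move=> v vt; apply: Ks; rewrite inE vt orbT.
rewrite [RHS]/=; congr (_ * _); rewrite /w.
have Kx : K j x by apply: Ks; rewrite inE eqxx.
have Ky : K j y by apply: Ks; rewrite !inE eqxx orbT.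
rewrite (epsN Kx) (epsN Ky).
by rewrite addrACA F2_addxx addr0.
Qed.

(** As [w] is the coboundary of [eps], its power of degree j + 1 is the coboundary of [eps] times
    the power of degree j. On the equator a simplex and its antipode contribute [eps x] and
    [eps x + 1] times the same number, so the pairing equals the one in dimension j; in dimension 0
    it is 1. *)
Lemma ev_cup_prod j : (j <= n)%N -> ev (cup_prod w) (sphere_chain j) = 1.
Proof.
elim: j => [|j ih] jn; first by rewrite /= ev_cons /ev big_nil addr0.
pose phi s : 'F_2 := if s is z :: _ then eps z * cup_prod w s else 0.
have -> : ev (cup_prod w) (sphere_chain j.+1) = ev (bd phi) (sphere_chain j.+1).
  rewrite /ev; apply: eq_big_seq => s /sphere_chain_size.
  case: s => // x [//|y t] st; rewrite bd_cup0.
  have -> : bd (cup_prod w) [:: x, y & t] = 0; last by rewrite mulr0 addr0.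
  rewrite -[RHS](@bd_twisted_prod _ w xpredT _ [::] [:: x, y & t])//.
  - apply: eq_bd => s; elim: s => // a [//|b s'] ihs.
    by rewrite twisted_prodS -ihs /twist /= !addr0.
  - by move=> a b c _ _ _; rewrite /w; apply: (@F2_eq (eps a + eps b + eps c)); ring.
  - by apply/List.Forall_forall.
rewrite sphere_chain_bd -evD -(ih (ltnW jn)) /ev; apply: eq_big_seq => s sj.
have Ks v : v \in s -> K j v by exact: (sphere_chain_sub (ltnW jn)).
move: (sphere_chain_size sj) Ks; case: s {sj} => // x s _ Ks.
have Kx : K j x by apply: Ks; rewrite inE eqxx.
rewrite -[X in _ + X]/(eps (- x) * cup_prod w (map -%R (x :: s))) /phi.
rewrite (cup_prod_antipode Ks) (epsN Kx) mulrDl mul1r addrA.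
by rewrite F2_addxx add0r.
Qed.

(** An antipodally invariant [psi] pairs to 0 with the equator, hence its coboundary pairs to 0 with
    the hemisphere, whereas the power of [w] pairs to 1. *)
Lemma cup_prod_neq_bd j psi : (j < n)%N ->
  (forall s, s \in sphere_chain j -> psi (map -%R s) = psi s) ->
  ~ (forall s, s \in sphere_chain j.+1 -> cup_prod w s = bd psi s).
Proof.
move=> jn psiN wE; apply: F2_neq01; rewrite -(ev_cup_prod jn).
rewrite (_ : ev _ _ = ev (bd psi) (sphere_chain j.+1)); last first.
  by apply: eq_big_seq => s /wE.
rewrite sphere_chain_bd -evD /ev big_seq big1// => s /psiN /= ->.
by rewrite F2_addxx.
Qed.

End sphere_chain.

(** * The generator of H^1 of infinite projective space *)

Section orbit_space_topology.
Local Open Scope quotient_scope.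
Context {E : PreTopologicalZmodule.type} (A : set E).
Hypothesis AN : forall u, A u -> A (- u).
Hypothesis oppC : continuous (-%R : E -> E).
Implicit Types u v : A.

Lemma orbit_proj_continuous : continuous (@orbit_proj E A).
Proof. by move=> u; exact: (@pi_continuous A (orbit_space A)). Qed.

Lemma orbit_projP u v : orbit_proj u = orbit_proj v <->
  \val u = \val v \/ \val u = - \val v.
Proof.
split=> [/eqmodP /orP[/eqP|/eqP]|uv]; [by left|by right|].
by apply/eqmodP/orP; case: uv => /eqP; [left|right].
Qed.

Lemma orbit_proj_surj (p : orbit_space A) : exists u, p = orbit_proj u.
Proof. by exists (repr p); rewrite /orbit_proj reprK. Qed.

Lemma set_val_mem u : A (\val u).
Proof. exact/set_mem/(valP u). Qed.

Definition antipode u : A := exist _ (- \val u) (mem_set (AN (set_val_mem u))).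

Lemma orbit_proj_antipode u : orbit_proj (antipode u) = orbit_proj u.
Proof. by apply/orbit_projP; right. Qed.

Lemma antipode_val u v : \val v = - \val u -> v = antipode u.
Proof. by move=> vu; apply/val_inj. Qed.

Lemma orbit_proj_fiber u v : orbit_proj u = orbit_proj v ->
  u = v \/ u = antipode v.
Proof.
by move=> /orbit_projP[uv|uv]; [left; exact/val_inj|right; exact: antipode_val].
Qed.

(** The saturation of an open set D is the union of D and -D. *)
Lemma orbit_proj_open u (N : set A) : nbhs u N ->
  nbhs (orbit_proj u) (@orbit_proj E A @` N).
Proof.
rewrite nbhsE => -[D [[D' oD' DE] Du] DN].
rewrite nbhsE; exists (@orbit_proj E A @` D); last exact: image_subset.
split; last by exists u.
rewrite /open /= /quotient_open.
exists (D' `|` -%R @^-1` D').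
  by apply: openU => //; apply: open_comp => // x _; exact: oppC.
rewrite -DE; apply/seteqP; split=> [v [vD|vD]|v [w /= wD wv]].
- by exists v.
- by exists (antipode v) => //; exact: orbit_proj_antipode.
- by case: (orbit_proj_fiber wv) wD => -> ; [left|right].
Qed.

(** As the projection is open, a tuple close to the orbit of [u] lifts entrywise into [N]; local
    vanishing can thus be tested upstairs. *)
Lemma locally_zero_orbit n (phi : cochain (orbit_space A) n) :
  (forall u, exists2 N : set A, nbhs u N &
     forall y : 'I_n.+1 -> A, (forall i, N (y i)) -> phi (@orbit_proj E A \o y) = 0) ->
  locally_zero phi.
Proof.
move=> phi0 p; have [u ->] := orbit_proj_surj p; have [N uN N0] := phi0 u.
exists (@orbit_proj E A @` N); first exact: orbit_proj_open.
move=> y yN; have /choice[z zP] : forall i, exists v, N v /\ orbit_proj v = y i.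
  by move=> i; have [v Nv <-] := yN i; exists v.
have -> : y = @orbit_proj E A \o z by apply/funext => i /=; rewrite (zP i).2.
by apply: N0 => i; exact: (zP i).1.
Qed.

End orbit_space_topology.

Lemma cochain2E (X : Type) (omega : cochain X 1) (y : 'I_2 -> X) :
  omega y = cochain2 omega (y ord0) (y ord_max).
Proof.
rewrite /cochain2 /=; congr omega; apply/funext => -[[|[|//]] i] /=.
  by congr y; exact/val_inj.
by congr y; exact/val_inj.
Qed.

Lemma continuous_sum_fun (K : numFieldType) (V : normedModType K)
    (T : topologicalType) (A : Type) (l : seq A) (F : A -> T -> V) (p : T) :
  (forall i, {for p, continuous (F i)}) ->
  {for p, continuous (fun y => \sum_(i <- l) F i y)}.
Proof.
move=> cF; elim: l => [|i l ih].
  rewrite (_ : (fun y => _) = fun=> 0); first exact: cvg_cst.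
  by apply/funext => y; rewrite big_nil.
rewrite (_ : (fun y => _) = fun y => F i y + \sum_(j <- l) F j y).
  exact: cvgD (cF i) ih.
by apply/funext => y; rewrite big_cons.
Qed.

Lemma cvg_rV (R : numFieldType) (T : Type) (F : set_system T) n
    (f : T -> 'rV[R]_n) (M : 'rV[R]_n) : Filter F ->
  (forall j, f x 0 j @[x --> F] --> M 0 j) -> f x @[x --> F] --> M.
Proof.
move=> FF fM A [P MP PA].
have FP : forall j, F [set x | P 0 j (f x 0 j)].
  by move=> j; exact: (fM j _ (MP 0 j)).
have := @filter_forall _ _ _ F FF FP.
apply: filterS => x Px; apply: PA => i j; rewrite ord1.
exact: Px.
Qed.

(** * The infinite sphere and its contraction *)

Section square_norm.
Context {R : realType}.
Implicit Types p q : {poly R}.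

Definition sqn p : R := \sum_(i < size p) p`_i ^+ 2.

Lemma sqnE n p : (size p <= n)%N -> sqn p = \sum_(i < n) p`_i ^+ 2.
Proof.
move=> pn; rewrite /sqn (big_ord_widen _ (fun i => p`_i ^+ 2) pn) big_mkcond /=.
apply: eq_bigr => i _; case: ltnP => // pi.
by rewrite nth_default// expr0n.
Qed.

Lemma sqn_ge0 p : 0 <= sqn p.
Proof. by apply: sumr_ge0 => i _; exact: sqr_ge0. Qed.

Lemma sqn0 : sqn 0 = 0.
Proof. by rewrite /sqn size_poly0 big_ord0. Qed.

Lemma sqn_eq0 p : (sqn p == 0) = (p == 0).
Proof.
apply/eqP/eqP => [p0|->]; last exact: sqn0.
apply/polyP => i; rewrite coef0; have [pi|ip] := leqP (size p) i.
  by rewrite nth_default.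
apply/eqP; rewrite -sqrf_eq0; apply/eqP.
apply: (@psumr_eq0P _ _ predT (fun i : 'I_(size p) => p`_i ^+ 2) _ p0 (Ordinal ip)) => //.
by move=> j _; exact: sqr_ge0.
Qed.

Lemma sqn_gt0 p : (0 < sqn p) = (p != 0).
Proof. by rewrite lt0r sqn_ge0 andbT sqn_eq0. Qed.

Lemma sqnZ a p : sqn (a *: p) = a ^+ 2 * sqn p.
Proof.
rewrite (@sqnE (size p)) ?size_scale_leq// mulr_sumr; apply: eq_bigr => i _.
by rewrite coefZ exprMn.
Qed.

Lemma sqnN p : sqn (- p) = sqn p.
Proof. by rewrite -scaleN1r sqnZ sqrrN expr1n mul1r. Qed.

Lemma sqn_parallelogram p q :
  sqn (p + q) + sqn (p - q) = 2 * (sqn p + sqn q).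
Proof.
pose n := maxn (size p) (size q).
rewrite !(@sqnE n) ?leq_maxl ?leq_maxr ?size_polyD//; last first.
  by rewrite (leq_trans (size_polyD _ _))// size_polyN.
rewrite -!big_split mulr_sumr; apply: eq_bigr => i _ /=.
by rewrite coefB coefD; ring.
Qed.

Lemma sqn_triangle p q s : sqn (p - s) <= 2 * (sqn (p - q) + sqn (q - s)).
Proof.
rewrite -sqn_parallelogram addrA subrK lerDl; exact: sqn_ge0.
Qed.

Lemma coef_rVpoly_continuous n i : continuous (fun v : 'rV[R]_n => (rVpoly v)`_i).
Proof.
rewrite (_ : (fun v => _) = fun v : 'rV[R]_n =>
    if insub i is Some j then v 0 (j : 'I_n) else 0); last first.
  by apply/funext => v; rewrite coef_rVpoly.
by case: insubP => [j _ _|_]; [exact: coord_continuous|exact: cst_continuous].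
Qed.

Lemma sqn_dist_continuous n p : continuous (fun v : 'rV[R]_n => sqn (rVpoly v - p)).
Proof.
rewrite (_ : (fun v => _) = fun v : 'rV[R]_n =>
    \sum_(i < maxn n (size p)) ((rVpoly v)`_i - p`_i) ^+ 2).
  move=> v; apply: continuous_sum_fun => i.
  have c : {for v, continuous (fun w : 'rV[R]_n => (rVpoly w)`_i - p`_i)}.
    exact: cvgB (@coef_rVpoly_continuous n i v) (cvg_cst _).
  exact: (cvgM c c).
apply/funext => v; rewrite (@sqnE (maxn n (size p))).
  by apply: eq_bigr => i _; rewrite coefB.
rewrite (leq_trans (size_polyD _ _))// size_polyN geq_max leq_maxr andbT.
by rewrite leq_max size_poly.
Qed.

Lemma rVpoly_continuous n : continuous (rVpoly : 'rV[R]_n -> Rinfty R).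
Proof. by apply/continuousP => U; exact. Qed.

Lemma Rinfty_oppr_continuous : continuous (-%R : Rinfty R -> Rinfty R).
Proof.
apply/continuousP => U oU; rewrite -[open _]/(Rinfty_open _) => n.
rewrite (_ : [set v | _] = -%R @^-1` [set v : 'rV[R]_n | U (rVpoly v)]).
  by apply: open_comp => [x _|]; [exact: opp_continuous|exact: oU].
by apply/seteqP; split=> v /=; rewrite (linearN rVpoly).
Qed.

End square_norm.

Section infinite_sphere.
Context {R : realType}.
Local Notation S := (Sinfty R).
Implicit Types (x y : S) (p : {poly R}).

Definition sph (x : S) : {poly R} := \val x.

Lemma sqn_sph x : sqn (sph x) = 1.
Proof. exact: (set_mem (valP x)). Qed.

Lemma sph_inj : injective sph. Proof. exact: val_inj. Qed.

Definition mk_sph p (p1 : sqn p = 1) : S := exist _ (p : Rinfty R) (mem_set p1).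

Lemma SinftyN (x : Rinfty R) : S x -> S (- x).
Proof. by rewrite /Sinfty /= => x1; rewrite -[LHS]/(sqn _) sqnN. Qed.

Lemma nbhs_sph x (N : set S) : nbhs x N <->
  exists U : set (Rinfty R), [/\ open U, U (sph x) & forall y, U (sph y) -> N y].
Proof.
rewrite nbhsE; split=> [[D [[U oU <-] Ux] DN]|[U [oU Ux UN]]].
  by exists U; split => // y Uy; exact: DN.
exists (sph @^-1` U); last by move=> y /UN.
by split=> //; exists U.
Qed.

Lemma nbhs_sph_rV x (N : set S) n (v : 'rV[R]_n) : nbhs x N -> sph x = rVpoly v ->
  \forall w \near v, forall y, sph y = rVpoly w -> N y.
Proof.
move=> /nbhs_sph[U [oU Ux UN]] xv.
have : nbhs v [set w : 'rV[R]_n | U (rVpoly w)].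
  by apply: open_nbhs_nbhs; split; [exact: oU|rewrite /= -xv].
by apply: filterS => w Uw y yw; apply: UN; rewrite yw.
Qed.

(** Openness in the direct limit topology is tested on each R^n. The ambient open set is the largest
    one with trace [N]; it contains all vectors off the sphere, and near such a vector [sqn] stays
    different from 1. *)
Lemma open_sph (N : set S) :
  (forall x, N x -> forall n (v : 'rV[R]_n), sph x = rVpoly v ->
     \forall w \near v, forall y, sph y = rVpoly w -> N y) ->
  forall x, N x -> nbhs x N.
Proof.
move=> NP x Nx; apply/nbhs_sph.
exists [set p : Rinfty R | forall y, sph y = p -> N y]; split; last 2 first.
- by move=> y /sph_inj ->.
- by move=> y; exact.
rewrite -[open _]/(Rinfty_open _) => n.
rewrite openE => v /= Nv; rewrite /interior/=.
have [v1|v1] := eqVneq (sqn (rVpoly v)) 1.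
  by apply: (NP (mk_sph v1) _ n v) => //; exact: Nv.
have : \forall w \near v, sqn (rVpoly w - 0) != 1.
  have c : sqn (rVpoly w - 0) - 1 @[w --> v] --> sqn (rVpoly v - 0) - 1.
    exact: cvgB (@sqn_dist_continuous R n 0 v) (cvg_cst _).
  have : \forall w \near v, sqn (rVpoly w - 0) - 1 != 0.
    by apply: cvgr_neq0 c _; rewrite subr0 subr_eq0.
  by apply: filterS => w; rewrite subr_eq0.
by apply: filterS => w; rewrite subr0 => w1 y yw; rewrite -yw sqn_sph eqxx in w1.
Qed.

Lemma nbhs_sph_ball x (e : R) : 0 < e -> nbhs x [set y | sqn (sph y - sph x) < e].
Proof.
move=> e0; apply: open_sph; last by rewrite /= subrr sqn0.
move=> y /= ye n v yv.
have : \forall w \near v, sqn (rVpoly w - sph x) < e.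
  by apply: cvgr_lt (@sqn_dist_continuous R n (sph x) v) _ _; rewrite -yv.
by apply: filterS => w we z ->.
Qed.

Lemma nbhs_sph_coef x i : (sph x)`_i != 0 ->
  nbhs x [set y | (sph y)`_i != 0 /\ ((sph y)`_i < 0) = ((sph x)`_i < 0)].
Proof.
move=> xi; apply: open_sph; last by split.
move=> y /= [yi yxi] n v yv.
have cv := @coef_rVpoly_continuous R n i v.
have [y0|y0] := ltP (sph y)`_i 0.
  have : \forall w \near v, (rVpoly w)`_i < 0 by apply: cvgr_lt cv _ _; rewrite -yv.
  by apply: filterS => w w0 z ->; rewrite w0 lt_eqF// -yxi y0.
have {}y0 : 0 < (sph y)`_i by rewrite lt0r yi.
have : \forall w \near v, 0 < (rVpoly w)`_i by apply: cvgr_gt cv _ _; rewrite -yv.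
apply: filterS => w w0 z ->; rewrite gt_eqF//; split=> //.
by rewrite -yxi !ltNge !ltW.
Qed.

Lemma sph1_subproof : sqn (1 : {poly R}) = 1.
Proof. by rewrite /sqn size_poly1 big_ord1 coef1 expr1n. Qed.

Definition sph1 : S := mk_sph sph1_subproof.

Lemma sph_normalize_subproof p : p != 0 -> sqn ((Num.sqrt (sqn p))^-1 *: p) = 1.
Proof.
by move=> p0; rewrite sqnZ exprVn sqr_sqrtr ?sqn_ge0// mulVf// sqn_eq0.
Qed.

Definition sph_normalize p : S :=
  if pselect (p != 0) is left p0 then mk_sph (sph_normalize_subproof p0) else sph1.

Lemma sph_normalizeE p : p != 0 ->
  sph (sph_normalize p) = (Num.sqrt (sqn p))^-1 *: p.
Proof. by rewrite /sph_normalize; case: pselect. Qed.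

Lemma sph_normalize_id x : sph_normalize (sph x) = x.
Proof.
apply: sph_inj; rewrite sph_normalizeE ?sqn_sph ?sqrtr1 ?invr1 ?scale1r//.
by rewrite -sqn_gt0 sqn_sph.
Qed.

Lemma sph_normalize_cvg (T : Type) (F : set_system T) n (f : T -> 'rV[R]_n)
    (v : 'rV[R]_n) :
  Filter F -> f t @[t --> F] --> v -> rVpoly v != 0 ->
  sph_normalize (rVpoly (f t)) @[t --> F] --> sph_normalize (rVpoly v).
Proof.
move=> FF fv v0 N /nbhs_sph[U [oU Uv UN]].
pose g (w : 'rV[R]_n) : 'rV[R]_n := (Num.sqrt (sqn (rVpoly w - 0)))^-1 *: w.
have gv : g w @[w --> v] --> g v.
  have c1 : Num.sqrt (sqn (rVpoly w - 0)) @[w --> v] --> Num.sqrt (sqn (rVpoly v - 0)).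
    apply: (@cvg_comp _ _ _ (fun w : 'rV[R]_n => sqn (rVpoly w - 0)) Num.sqrt).
      exact: sqn_dist_continuous.
    exact: sqrt_continuous.
  have c2 : (Num.sqrt (sqn (rVpoly w - 0)))^-1 @[w --> v] --> (Num.sqrt (sqn (rVpoly v - 0)))^-1.
    by apply: cvgV c1; rewrite subr0 sqrtr_eq0 -ltNge sqn_gt0.
  exact: cvgZ c2 cvg_id.
have gE w : rVpoly w != 0 -> sph (sph_normalize (rVpoly w)) = rVpoly (g w).
  by move=> w0; rewrite sph_normalizeE// /g subr0 linearZ.
have vP : \forall w \near v, rVpoly w != 0 /\ U (rVpoly (g w)).
  apply: filterI.
    have : \forall w \near v, sqn (rVpoly w - 0) != 0.
      by apply: cvgr_neq0 (@sqn_dist_continuous R n 0 v) _; rewrite subr0 sqn_eq0.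
    by apply: filterS => w; rewrite subr0 sqn_eq0.
  have gU : nbhs (g v) (rVpoly @^-1` U).
    apply: (@rVpoly_continuous R n (g v)).
    by apply: open_nbhs_nbhs; split=> //; rewrite -gE.
  exact: gv gU.
have FP : F [set t | rVpoly (f t) != 0 /\ U (rVpoly (g (f t)))] := fv _ vP.
apply: (@filterS _ F FF _ _ _ FP) => t [t0 Ut].
by apply: UN; rewrite gE.
Qed.

(* This path from [p] to 1 avoids 0, because [p * (a + b 'X)] is never a nonzero
   constant when [b != 0]. *)
Definition sph_path p (t : R) : {poly R} :=
  p * ((1 - t)%:P + (t * (1 - t)) *: 'X) + t%:P.

Lemma sph_path_neq0 p t : p != 0 -> sph_path p t != 0.
Proof.
move=> p0; rewrite /sph_path.
have [->|t0] := eqVneq t 0.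
  by rewrite mul0r scale0r subr0 !addr0 mulr1.
have [->|t1] := eqVneq t 1.
  by rewrite subrr mulr0 scale0r !addr0 mulr0 add0r oner_eq0.
have b0 : t * (1 - t) != 0 by rewrite mulf_neq0// subr_eq0 eq_sym.
have sq : size ((1 - t)%:P + (t * (1 - t)) *: 'X) = 2.
  rewrite addrC size_polyDl ?size_scale ?size_polyX//.
  by rewrite (leq_ltn_trans (size_polyC_leq1 _)).
have q0 : (1 - t)%:P + (t * (1 - t)) *: 'X != 0 by rewrite -size_poly_gt0 sq.
rewrite -size_poly_gt0 size_polyDl.
  by rewrite size_poly_gt0 mulf_neq0.
rewrite (leq_ltn_trans (size_polyC_leq1 _))// size_mul// sq addn2 /=.
by rewrite ltnS size_poly_gt0.
Qed.

Lemma size_sph_path p t n : (size p <= n)%N -> (size (sph_path p t) <= n.+1)%N.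
Proof.
move=> pn; rewrite (leq_trans (size_polyD _ _))// geq_max.
rewrite (leq_trans (size_polyC_leq1 _))// andbT.
rewrite (leq_trans (size_mul_leq _ _))//.
have s2 : (size ((1 - t)%:P + (t * (1 - t)) *: 'X)%R <= 2)%N.
  rewrite (leq_trans (size_polyD _ _))// geq_max.
  rewrite (leq_trans (size_polyC_leq1 _))//=.
  by rewrite (leq_trans (size_scale_leq _ _))// size_polyX.
by have := leq_add pn s2; case: (_ + _)%N => // m; rewrite addn2.
Qed.

Definition sph_homotopy p t : S := sph_normalize (sph_path p t).

Lemma sph_homotopy0 x : sph_homotopy (sph x) 0 = x.
Proof.
rewrite /sph_homotopy /sph_path mul0r scale0r subr0 !addr0 mulr1.
exact: sph_normalize_id.
Qed.

Lemma sph_homotopy1 p : sph_homotopy p 1 = sph1.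
Proof.
rewrite /sph_homotopy /sph_path subrr mulr0 scale0r !addr0 mulr0 add0r.
exact: (sph_normalize_id sph1).
Qed.

(** From polynomials with n coefficients the path stays among those with n + 1, so joint continuity
    is a matter of finitely many coefficients. It is asserted on each R^n only. *)
Lemma sph_homotopy_cvg n (v : 'rV[R]_n) t : rVpoly v != 0 ->
  sph_homotopy (rVpoly z.1) z.2 @[z --> (v, t)] --> sph_homotopy (rVpoly v) t.
Proof.
move=> v0; pose g (z : 'rV[R]_n * R) : 'rV[R]_n.+1 := poly_rV (sph_path (rVpoly z.1) z.2).
have gK z : rVpoly (g z) = sph_path (rVpoly z.1) z.2.
  by rewrite poly_rV_K// size_sph_path// size_poly.
rewrite /sph_homotopy -[sph_path (rVpoly v) t](gK (v, t)).
rewrite (_ : (fun z => _) = fun z => sph_normalize (rVpoly (g z))); last first.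
  by apply/funext => z; rewrite gK.
apply: sph_normalize_cvg; last by rewrite gK sph_path_neq0.
apply: cvg_rV => j.
have coefP p s : (sph_path p s)`_j = p`_j * (1 - s) +
    (if j == 0%N :> nat then 0 else p`_(j.-1)) * (s * (1 - s)) + (if j == 0%N :> nat then s else 0).
  rewrite /sph_path mulrDr -scalerAr !coefD coefMC coefZ coefMX coefC.
  by rewrite [_ * (s * _)]mulrC.
rewrite (_ : (fun z => _) = fun z => (rVpoly z.1)`_j * (1 - z.2) +
    (if j == 0%N :> nat then 0 else (rVpoly z.1)`_(j.-1)) * (z.2 * (1 - z.2)) +
    (if j == 0%N :> nat then z.2 else 0)); last first.
  by apply/funext => z; rewrite mxE coefP.
rewrite mxE coefP /=.
have c1 i : (rVpoly z.1)`_i @[z --> (v, t)] --> (rVpoly v)`_i.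
  apply: (@cvg_comp _ _ _ fst (fun w : 'rV[R]_n => (rVpoly w)`_i)).
    exact: cvg_fst.
  exact: coef_rVpoly_continuous.
have c2 : z.2 @[z --> (v, t)] --> t by exact: cvg_snd.
have c3 : (1 - z.2) @[z --> (v, t)] --> 1 - t by apply: cvgB => //; exact: cvg_cst.
apply: cvgD; first (apply: cvgD; first exact: cvgM).
  by apply: cvgM; [case: ifP => _; [exact: cvg_cst|exact: c1]|exact: cvgM].
by case: ifP => _ //; exact: cvg_cst.
Qed.

End infinite_sphere.

(** Decides implications between equations over ['F_2] by running through all values of the
    variables in the context; the calls are preceded by [clear] to keep only those that matter. *)
Ltac f2 :=
  intros;
  repeat match goal with x : _ |- _ =>
    let e := fresh in destruct (F2_case x) as [e|e]; subst x end;
  first [ apply/eqP; vm_compute; reflexivity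
        | exfalso; match goal with H : @eq _ _ _ |- _ =>
            move/eqP: H; vm_compute; discriminate end ].

(** * Vanishing of H^1 on the interval and on the infinite sphere *)

Section unit_interval.
Context {R : realType}.

(** Take the supremum of the points where [P] holds. The local condition there carries [P] from a
    point just below to the supremum, and beyond it unless it equals 1. *)
Lemma itv_induction (P : R -> Prop) : P 0 ->
  (forall t : R, 0 <= t <= 1 -> exists2 e : R, 0 < e &
     forall a b : R, 0 <= a <= 1 -> 0 <= b <= 1 -> `|a - t| < e -> `|b - t| < e ->
     P a -> P b) ->
  P 1.
Proof.
move=> P0 PP; pose A := [set t : R | 0 <= t <= 1 /\ P t].
have supA : has_sup A.
  split; first by exists 0; rewrite /A /= lexx ler01.
  by exists 1 => t [/andP[]].
have A0 : A 0 by rewrite /A /= lexx ler01.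
have s0 : 0 <= sup A by apply: (ub_le_sup supA.2).
have s1 : sup A <= 1 by apply: ge_sup; [exact: supA.1|move=> t [/andP[]]].
have [|e e0 ePP] := PP (sup A); first by rewrite s0.
have [a [a01 Pa] sa] := sup_adherent e0 supA.
have as_ : a <= sup A by apply: (ub_le_sup supA.2).
have ae : `|a - sup A| < e by rewrite ler0_norm ?subr_le0//; lra.
have [s_lt1|s_ge1] := ltP (sup A) 1; last first.
  apply: (ePP a 1) => //; first by rewrite ler01 lexx.
  by rewrite (_ : sup A = 1) ?subrr ?normr0//; apply/eqP; rewrite eq_le s1.
pose b := Num.min 1 (sup A + e / 2).
have sb : sup A < b by rewrite lt_min s_lt1 ltrDl divr_gt0.
have b1 : b <= 1 by rewrite ge_min lexx.
have b01 : 0 <= b <= 1 by rewrite b1 (le_trans s0)// ltW.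
have be : `|b - sup A| < e.
  rewrite gtr0_norm ?subr_gt0// ltrBlDl.
  by rewrite gt_min; apply/orP; right; rewrite ltrD2l ltr_pdivrMr// ltr_pMr// ltr1n.
have : b <= sup A by apply: (ub_le_sup supA.2); split=> //; exact: (ePP a).
by rewrite leNgt sb.
Qed.

(* H^1 of the unit interval vanishes *)
Lemma itv_cocycle (phi : R -> R -> 'F_2) :
  (forall t : R, 0 <= t <= 1 -> exists2 e : R, 0 < e &
    forall a b c : R, `|a - t| < e -> `|b - t| < e -> `|c - t| < e ->
      phi b c + phi a c + phi a b = 0) ->
  exists chi : R -> 'F_2, forall t : R, 0 <= t <= 1 -> exists2 e : R, 0 < e &
    forall a b : R, 0 <= a <= 1 -> 0 <= b <= 1 -> `|a - t| < e -> `|b - t| < e ->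
      phi a b = chi a + chi b.
Proof.
move=> cphi.
pose good T := exists chi : R -> 'F_2, forall t : R, 0 <= t <= T -> exists2 e : R, 0 < e &
    forall a b : R, 0 <= a <= T -> 0 <= b <= T -> `|a - t| < e -> `|b - t| < e ->
      phi a b = chi a + chi b.
suff : good 1 by [].
have phixx t : 0 <= t <= 1 -> phi t t = 0.
  move=> /cphi[e e0 /(_ t t t)]; rewrite subrr normr0 => /(_ e0 e0 e0).
  by rewrite F2_addxx add0r.
apply: itv_induction.
  exists (fun=> 0) => t /andP[t0 t0']; exists 1 => // a b.
  rewrite addr0 -!eq_le => /eqP <- /eqP <- _ _; apply: phixx.
  by rewrite lexx ler01.
move=> t t01; have [e e0 cU] := cphi t t01; exists e => // T T' T01 T'01 Te T'e.
have [T'T|TT'] := leP T' T; move=> -[chi chiP].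
  exists chi => u /andP[u0 uT'].
  have [|d d0 dP] := chiP u; first by rewrite u0 (le_trans uT').
  exists d => // a b /andP[a0 aT'] /andP[b0 bT']; apply: dP.
    by rewrite a0 (le_trans aT').
  by rewrite b0 (le_trans bT').
(* The primitive is prolonged beyond [T] by the values that the cocycle identity forces on the ball
   around [t]. *)
pose chi' a := if a <= T then chi a else chi T + phi T a.
have [T0 T1] := andP T01; have [T'0 T'1] := andP T'01.
have eball a : T <= a -> a <= T' -> `|a - t| < e.
  by move: Te T'e; rewrite !ltr_norml => /andP[? ?] /andP[? ?] ? ?; apply/andP; split; lra.
(* near [T], both descriptions of [phi] agree *)
have [|d d0 dP] := chiP T; first by rewrite T0 lexx.
have nearT a b : 0 <= a <= T' -> 0 <= b <= T' -> `|a - t| < e -> `|b - t| < e ->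
    (a <= T -> `|a - T| < d) -> (b <= T -> `|b - T| < d) ->
    phi a b = chi' a + chi' b.
  move=> /andP[a0 aT'] /andP[b0 bT'] ae be aT bT.
  have chiT x : 0 <= x -> x <= T' -> `|x - t| < e -> (x <= T -> `|x - T| < d) ->
      chi' x = chi T + phi T x.
    move=> x0 xT' xe xd; rewrite /chi'; case: ifPn => // xT.
    rewrite (dP T x) ?T0 ?lexx ?x0 ?xT ?subrr ?normr0//; last exact: xd.
    by rewrite addrA F2_addxx add0r.
  rewrite !chiT//; have := cU T a b Te ae be.
  by move: (phi a b) (phi T a) (phi T b) (chi T); clear; f2.
exists chi' => u /andP[u0 uT'].
have [uT|uT|uT] := ltgtP u T.
- have [|d' d'0 d'P] := chiP u; first by rewrite u0 ltW.
  exists (Num.min d' (T - u)); first by rewrite lt_min d'0 subr_gt0.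
  move=> a b /andP[a0 aT'] /andP[b0 bT']; rewrite !lt_min => /andP[ad au] /andP[bd bu].
  have aT : a <= T by move: au; rewrite ltr_norml => /andP[? ?]; lra.
  have bT : b <= T by move: bu; rewrite ltr_norml => /andP[? ?]; lra.
  by rewrite /chi' aT bT; apply: d'P => //; rewrite ?a0 ?b0.
- exists (Num.min (e - `|u - t|) (u - T)).
    by rewrite lt_min !subr_gt0 eball// ltW.
  move=> a b a01 b01; rewrite !lt_min => /andP[ad au] /andP[bd bu].
  have aT : T < a by move: au; rewrite ltr_norml => /andP[? ?]; lra.
  have bT : T < b by move: bu; rewrite ltr_norml => /andP[? ?]; lra.
  apply: nearT => //.
  + by rewrite eball//; [exact: ltW|case/andP: a01].
  + by rewrite eball//; [exact: ltW|case/andP: b01].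
  + by rewrite leNgt aT.
  + by rewrite leNgt bT.
exists (Num.min (e - `|T - t|) d); first by rewrite lt_min subr_gt0 Te.
move=> a b a01 b01; rewrite uT !lt_min => /andP[ad au] /andP[bd bu].
have tri x : `|x - T| < e - `|T - t| -> `|x - t| < e.
  move=> h; rewrite (_ : x - t = (x - T) + (T - t)); last by ring.
  by rewrite (le_lt_trans (ler_normD _ _))//; lra.
by apply: nearT => //; exact: tri.
Qed.

End unit_interval.

Section sphere_cohomology.
Context {R : realType}.
Local Notation S := (Sinfty R).
Implicit Types x y z : S.

Definition local_cocycle {X : topologicalType} (w : X -> X -> 'F_2) :=
  forall x : X, exists2 U : set X, nbhs x U &
    forall a b c : X, U a -> U b -> U c -> w b c + w a c + w a b = 0.

Definition local_coboundary {X : topologicalType} (w : X -> X -> 'F_2)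
    (chi : X -> 'F_2) :=
  forall x : X, exists2 U : set X, nbhs x U &
    forall a b, U a -> U b -> w a b = chi a + chi b.

Lemma sph_rV x : exists n (v : 'rV[R]_n), sph x = rVpoly v.
Proof.
exists (size (sph x)), (poly_rV (sph x)).
by rewrite poly_rV_K.
Qed.

Lemma sph_neq0 x : sph x != 0.
Proof. by rewrite -sqn_gt0 sqn_sph. Qed.

Lemma sph_homotopy_continuous x : continuous (sph_homotopy (sph x)).
Proof.
move=> t; have [n [v xv]] := sph_rV x.
have v0 : rVpoly v != 0 by rewrite -xv sph_neq0.
have h : (v, s) @[s --> t] --> (v, t) by exact: cvg_pair (cvg_cst _) cvg_id.
by rewrite xv; exact: cvg_comp h (sph_homotopy_cvg v0).
Qed.

(** A locally constant function does not change along the contraction path from [x] to 1. *)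
Lemma Sinfty_connected (D : S -> 'F_2) :
  (forall x, exists2 U : set S, nbhs x U & forall a, U a -> D a = D x) ->
  forall x y, D x = D y.
Proof.
move=> Dloc; suff D1 x : D x = D sph1 by move=> x y; rewrite !D1.
rewrite -{1}(sph_homotopy0 x) -(sph_homotopy1 (sph x)).
apply: (@itv_induction _ (fun t => D (sph_homotopy (sph x) 0) = D (sph_homotopy (sph x) t))) => //.
move=> t _; have [U xU UD] := Dloc (sph_homotopy (sph x) t).
have /nbhs_ballP[e e0 eU] := sph_homotopy_continuous xU.
exists e => // a b _ _ ae be ->.
by rewrite !UD//; apply: eU; rewrite /= /ball /= distrC.
Qed.

Lemma local_cocyclexx (X : topologicalType) (w : X -> X -> 'F_2) :
  local_cocycle w -> forall x : X, w x x = 0.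
Proof.
move=> cw x; have [U xU UP] := cw x; have Ux := nbhs_singleton xU.
by have := UP x x x Ux Ux Ux; rewrite F2_addxx add0r.
Qed.

(** [psi x] is the integral of [w] along the contraction path from [x] to 1. For [y] near [x] the
    two paths are close uniformly in time, and a ladder between them, ending at the common point 1,
    compares the two integrals. *)
Lemma Sinfty_cocycle (w : S -> S -> 'F_2) :
  local_cocycle w -> exists psi, local_coboundary w psi.
Proof.
move=> cw; have wxx := local_cocyclexx cw.
pose gam x := sph_homotopy (sph x).
have /choice[chi chiP] x : exists chi : R -> 'F_2,
    forall t : R, 0 <= t <= 1 -> exists2 e : R, 0 < e &
    forall a b : R, 0 <= a <= 1 -> 0 <= b <= 1 -> `|a - t| < e -> `|b - t| < e ->
      w (gam x a) (gam x b) = chi a + chi b.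
  apply: itv_cocycle => t _; have [U xU UP] := cw (gam x t).
  have /nbhs_ballP[e e0 eU] := sph_homotopy_continuous xU.
  exists e => // a b c ae be ce.
  by apply: UP; apply: eU; rewrite /ball /= distrC.
pose psi x := chi x 0 + chi x 1.
(* Only for [y] varying in a given R^n that contains [x]: there the homotopy is jointly continuous,
   and compactness of the time interval gives closeness uniform in time. *)
have step n (v : 'rV[R]_n) x : sph x = rVpoly v ->
    \forall u \near v, forall y, sph y = rVpoly u -> w x y = psi x + psi y.
  move=> xv; have v0 : rVpoly v != 0 by rewrite -xv sph_neq0.
  pose Q (u : 'rV[R]_n) (t : R) := exists2 U : set S,
    [/\ open U, U (gam x t) & U (sph_homotopy (rVpoly u) t)] &
    forall a b c, U a -> U b -> U c -> w b c + w a c + w a b = 0.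
  have : \forall u \near v, `[0, 1]%classic `<=` Q u.
    have /compact_near_coveringP ncov := @segment_compact R 0 1.
    apply: (ncov _ (nbhs v) Q) => t _.
    have [U xU UP] := cw (gam x t).
    move: xU; rewrite nbhsE => -[V [oV Vx] VU].
    have xV : nbhs (gam x t) V by apply: open_nbhs_nbhs.
    have h1 : \forall s \near t, V (gam x s) by exact: sph_homotopy_continuous xV.
    have h2 : \forall z \near (v, t), V (sph_homotopy (rVpoly z.1) z.2).
      by apply: (sph_homotopy_cvg v0); rewrite -xv.
    case: h2 => -[A B] /= [vA tB] AB.
    exists (B `&` [set s | V (gam x s)], A) => /=.
      by split => //; exact: filterI.
    move=> [s u] /= [[Bs Vs] Au]; exists V; last by move=> a b c /VU ? /VU ? /VU ?; exact: UP.
    by split => //; exact: (AB (u, s)).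
  apply: filterS => u uP y yu.
  (* Two triangles in a small square of the ladder show that [D] is locally constant; its values at
     0 and 1 compare [w x y] with [psi x + psi y]. *)
  pose D t := chi x t + chi y t + w (gam x t) (gam y t).
  have : D 0 = D 1.
    apply: (@itv_induction _ (fun t => D 0 = D t)) => // t t01.
    have [|U [oU Ux]] := uP t; first by rewrite /= in_itv.
    rewrite -yu -/(gam y t) => Uy UP.
    have /nbhs_ballP[e1 e10 e1U] : nbhs t (gam x @^-1` U).
      by apply: sph_homotopy_continuous; exact: open_nbhs_nbhs.
    have /nbhs_ballP[e2 e20 e2U] : nbhs t (gam y @^-1` U).
      by apply: sph_homotopy_continuous; exact: open_nbhs_nbhs.
    have [e3 e30 e3P] := chiP x t t01; have [e4 e40 e4P] := chiP y t t01.
    exists (Num.min (Num.min e1 e2) (Num.min e3 e4)).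
      by rewrite !lt_min e10 e20 e30 e40.
    move=> a b a01 b01; rewrite !lt_min => /andP[/andP[a1 a2] /andP[a3 a4]].
    move=> /andP[/andP[b1 b2] /andP[b3 b4]] ->.
    have Ux' s : `|s - t| < e1 -> U (gam x s).
      by move=> h; apply: e1U; rewrite /ball /= distrC.
    have Uy' s : `|s - t| < e2 -> U (gam y s).
      by move=> h; apply: e2U; rewrite /ball /= distrC.
    have hx := e3P a b a01 b01 a3 b3; have hy := e4P a b a01 b01 a4 b4.
    have h1 := UP _ _ _ (Ux' a a1) (Uy' a a2) (Uy' b b2).
    have h2 := UP _ _ _ (Ux' a a1) (Ux' b b1) (Uy' b b2).
    rewrite /D; move: h1 h2; rewrite hx hy.
    move: (w (gam x a) (gam y a)) (w (gam x b) (gam y b)) (w (gam x a) (gam y b)).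
    move: (chi x a) (chi x b) (chi y a) (chi y b); clear; f2.
  rewrite /D /gam !sph_homotopy0 !sph_homotopy1 wxx addr0 /psi.
  move: (chi x 0) (chi y 0) (chi x 1) (chi y 1) (w x y); clear; f2.
exists psi => x; have [V xV VP] := cw x.
have [V' [oV' V'x] V'V] : exists2 B, open_nbhs x B & B `<=` V.
  by move: xV; rewrite nbhsE.
(* The cocycle identity carries the relation from [y] to the points near [y], so this set is open on
   each R^n and hence open. *)
exists [set y | V' y /\ w x y = psi x + psi y]; last first.
  move=> a b [/V'V Va aP] [/V'V Vb bP].
  have := VP x a b (V'V _ V'x) Va Vb; rewrite aP bP.
  move: (psi x) (psi a) (psi b) (w a b); clear; f2.
apply: open_sph; last by split; rewrite ?wxx ?F2_addxx.
move=> y [V'y yP] n v yv.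
have h1 : \forall u \near v, forall z, sph z = rVpoly u -> V' z.
  by apply: nbhs_sph_rV yv; exact: open_nbhs_nbhs.
have h2 := step n v y yv.
apply: filterS (filterI h1 h2) => u [u1 u2] z zu.
have V'z := u1 z zu; split=> //.
have := VP x y z (V'V _ V'x) (V'V _ V'y) (V'V _ V'z).
rewrite yP (u2 z zu); move: (psi x) (psi y) (psi z) (w x z); clear; f2.
Qed.

End sphere_cohomology.

Section low_degree.
Context {X : topologicalType}.
Implicit Types omega : cochain X 1.

Lemma is_cocycleP omega : is_cocycle omega <-> local_cocycle (cochain2 omega).
Proof.
have E (y : 'I_3 -> X) a b c : [:: a; b; c] = codom y -> coboundary omega y =
    cochain2 omega b c + cochain2 omega a c + cochain2 omega a b.
  by move=> ye; rewrite coboundaryE -ye /= addr0 addrA.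
split=> [co x|co x].
  have [U xU U0] := co x; exists U => // a b c Ua Ub Uc.
  have [y ye] : exists y : 'I_3 -> X, [:: a; b; c] = codom y by exact: seq_codom.
  rewrite -(E y)//; apply: U0 => i.
  have : y i \in [:: a; b; c] by rewrite ye codom_f.
  by rewrite !inE => /or3P[] /eqP ->.
have [U xU U0] := co x; exists U => // y Uy.
have ye : [:: y ord0; y (lift ord0 ord0); y (lift ord0 (lift ord0 ord0))] = codom y.
  by rewrite codomE !enum_ordSl enum_ord0.
by rewrite (E _ _ _ _ ye); exact: U0.
Qed.

Lemma null_class1P omega :
  null_class omega <-> exists chi, local_coboundary (cochain2 omega) chi.
Proof.
have E (psi : cochain X 0) (y : 'I_2 -> X) : coboundary psi y =
    seq_cochain psi [:: y ord0] + seq_cochain psi [:: y ord_max].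
  rewrite coboundaryE codomE !enum_ordSl enum_ord0 /= addr0 addrC.
  by rewrite (_ : lift ord0 ord0 = ord_max)//; exact: val_inj.
split=> [[psi psi0]|[chi chiP]].
  exists (fun x => seq_cochain psi [:: x]) => x.
  have [U xU U0] := psi0 x; exists U => // a b Ua Ub.
  pose y (i : 'I_2) := if i == ord0 then a else b.
  have /eqP := U0 y (fun i => ltac:(rewrite /y; case: ifP => _ //)).
  by rewrite subr_eq0 cochain2E E => /eqP.
exists (fun y => chi (y ord0)) => x; have [U xU UP] := chiP x; exists U => // y Uy.
by rewrite cochain2E E /= UP// subrr.
Qed.

End low_degree.

Lemma locally_zero_pullback (X Y : topologicalType) (h : X -> Y) n
    (phi : cochain Y n) :
  continuous h -> locally_zero phi -> locally_zero (pullback h phi).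
Proof.
move=> ch phi0 x; have [U xU U0] := phi0 (h x).
by exists (h @^-1` U); [exact: ch|move=> y Uy; exact: U0].
Qed.

Lemma null_class_pullback (X Y : topologicalType) (h : X -> Y) n
    (phi : cochain Y n) :
  continuous h -> null_class phi -> null_class (pullback h phi).
Proof.
move=> ch; case: n phi => [|n] phi; first exact: locally_zero_pullback.
by case=> psi psi0; exists (pullback h psi); exact: locally_zero_pullback psi0.
Qed.

Section generator.
Context {R : realType}.
Local Notation S := (Sinfty R).
Local Notation RP := (RPinfty R).
Local Notation pr := (@orbit_proj (Rinfty R) S).
Implicit Types (x y : S) (p q : RP).

Let anti : S -> S := antipode (@SinftyN R).

Lemma sph_antipode x : sph (anti x) = - sph x.
Proof. by []. Qed.

(* Whether the chosen representatives of [p] and [q] lie further apart than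
   [sqrt 2]: the transition cocycle of the double cover of [RP] by [S]. *)
Definition transition p q : 'F_2 :=
  if 2 < sqn (sph (repr p) - sph (repr q)) then 1 else 0.

Definition omega0 : cochain RP 1 :=
  fun z : 'I_2 -> RP => transition (z ord0) (z ord_max).

(** The sheet of the double cover on which [x] lies with respect to the chosen representatives; it
    changes by 1 under the antipode. *)
Definition sheet x : 'F_2 := if repr (pr x) == x then 0 else 1.

Lemma cochain2_omega0 : cochain2 omega0 = transition.
Proof. by apply/funext => p; apply/funext. Qed.

Lemma repr_proj x : repr (pr x) = x \/ repr (pr x) = anti x.
Proof. by apply: orbit_proj_fiber; rewrite /orbit_proj reprK. Qed.

Lemma anti_neq x : anti x != x.
Proof.
apply/eqP => /(f_equal sph); rewrite sph_antipode => /eqP.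
rewrite -subr_eq0 -opprD oppr_eq0 -mulr2n -scaler_nat scaler_eq0 pnatr_eq0 /=.
by rewrite (negbTE (sph_neq0 x)).
Qed.

Lemma sheet_antipode x : sheet (anti x) = sheet x + 1.
Proof.
rewrite /sheet (orbit_proj_antipode (@SinftyN R)).
case: (repr_proj x) => ->; first by rewrite eqxx eq_sym (negbTE (anti_neq x)) add0r.
by rewrite eqxx (negbTE (anti_neq x)) F2_addxx.
Qed.

Lemma transition_coboundary :
  local_coboundary (fun x y => transition (pr x) (pr y)) sheet.
Proof.
(* Two points at squared distance less than 1/4 from [x] are at squared distance less than 1 from
   each other and, by the parallelogram identity, more than 3 from each other's antipodes; the
   threshold 2 in [transition] separates the cases. *)
move=> x; exists [set y | sqn (sph y - sph x) < 4^-1].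
  by apply: nbhs_sph_ball; rewrite invr_gt0.
move=> a b /= ax bx.
have ab : sqn (sph a - sph b) < 1.
  rewrite (le_lt_trans (sqn_triangle _ (sph x) _))//.
  by rewrite -[sqn (sph x - sph b)]sqnN opprB; lra.
have abN : 3 < sqn (sph a + sph b).
  by have := sqn_parallelogram (sph a) (sph b); rewrite !sqn_sph; lra.
rewrite /transition /sheet.
case: (repr_proj a) => ->; case: (repr_proj b) => ->;
  rewrite ?eqxx ?(negbTE (anti_neq _)) ?sph_antipode ?opprK.
- by rewrite ltNge (ltW (lt_trans ab _)) ?ltr1n// addr0.
- by rewrite (lt_trans _ abN) ?add0r// ltr_nat.
- by rewrite -opprD sqnN (lt_trans _ abN) ?addr0// ltr_nat.
- by rewrite addrC -opprB sqnN ltNge (ltW (lt_trans ab _)) ?ltr1n// F2_addxx.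
Qed.

Lemma local_cocycle_orbit (w : RP -> RP -> 'F_2) :
  local_cocycle (fun x y => w (pr x) (pr y)) -> local_cocycle w.
Proof.
move=> cw p; have [x ->] := orbit_proj_surj p; have [U xU UP] := cw x.
exists (pr @` U); first exact: (orbit_proj_open (@SinftyN R) (@Rinfty_oppr_continuous R)).
by move=> _ _ _ [a Ua <-] [b Ub <-] [c Uc <-]; exact: UP.
Qed.

Lemma local_coboundary_orbit (w : RP -> RP -> 'F_2) (chi : RP -> 'F_2) :
  local_coboundary (fun x y => w (pr x) (pr y)) (chi \o pr) -> local_coboundary w chi.
Proof.
move=> cw p; have [x ->] := orbit_proj_surj p; have [U xU UP] := cw x.
exists (pr @` U); first exact: (orbit_proj_open (@SinftyN R) (@Rinfty_oppr_continuous R)).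
by move=> _ _ [a Ua <-] [b Ub <-]; exact: UP.
Qed.

Lemma local_coboundary_lift (w : RP -> RP -> 'F_2) (chi : RP -> 'F_2) :
  local_coboundary w chi -> local_coboundary (fun x y => w (pr x) (pr y)) (chi \o pr).
Proof.
move=> cw x; have [U xU UP] := cw (pr x).
by exists (pr @^-1` U); [exact: orbit_proj_continuous|move=> a b; exact: UP].
Qed.

Lemma local_cocycle_lift (w : RP -> RP -> 'F_2) :
  local_cocycle w -> local_cocycle (fun x y => w (pr x) (pr y)).
Proof.
move=> cw x; have [U xU UP] := cw (pr x).
by exists (pr @^-1` U); [exact: orbit_proj_continuous|move=> a b c; exact: UP].
Qed.

Lemma coboundary_cocycle (X : topologicalType) (w : X -> X -> 'F_2) chi :
  local_coboundary w chi -> local_cocycle w.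
Proof.
move=> cw x; have [U xU UP] := cw x; exists U => // a b c Ua Ub Uc.
by rewrite !UP//; move: (chi a) (chi b) (chi c); clear; f2.
Qed.

(** The difference of two primitives is locally constant and the sphere is connected. *)
Lemma coboundary_diff (w : S -> S -> 'F_2) chi chi' :
  local_coboundary w chi -> local_coboundary w chi' ->
  exists a : 'F_2, forall x, chi x = chi' x + a.
Proof.
move=> c c'; exists (chi sph1 + chi' sph1) => x.
have /(_ x sph1) : forall x y, chi x + chi' x = chi y + chi' y.
  apply: (@Sinfty_connected _ (fun x => chi x + chi' x)) => z.
  have [U zU UP] := c z; have [U' zU' U'P] := c' z.
  exists (U `&` U') => [|a [Ua U'a]]; first exact: filterI.
  have := UP a z Ua (nbhs_singleton zU); rewrite (U'P a z U'a (nbhs_singleton zU')).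
  by move: (chi a) (chi' a) (chi z) (chi' z); clear; f2.
by move: (chi x) (chi' x) (chi sph1) (chi' sph1); clear; f2.
Qed.

Lemma omega0_cocycle : is_cocycle omega0.
Proof.
apply/is_cocycleP/local_cocycle_orbit; rewrite cochain2_omega0.
exact: coboundary_cocycle transition_coboundary.
Qed.

Lemma odd_not_even (chi : RP -> 'F_2) (eps : S -> 'F_2) (a : 'F_2) :
  (forall x, eps (anti x) = eps x + 1) -> ~ (forall x, eps x = chi (pr x) + a).
Proof.
move=> epsN e; have := epsN sph1; rewrite !e (orbit_proj_antipode (@SinftyN R)).
by move: (chi (pr sph1)); move: a {e}; clear; f2.
Qed.

(** A primitive on projective space would lift to an even function differing from [sheet] by a
    constant, which is impossible. For a cocycle [phi], the lift has a primitive [psi], which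
    changes by some constant [a] under the antipode; [psi + a * sheet] is even and descends. *)
Lemma omega0_generator : H1_generator omega0.
Proof.
split; first exact: omega0_cocycle.
  move=> /null_class1P[chi]; rewrite cochain2_omega0 => /local_coboundary_lift c.
  have [a e] := coboundary_diff transition_coboundary c.
  exact: odd_not_even sheet_antipode e.
move=> phi /is_cocycleP cphi.
have [psi psiP] := Sinfty_cocycle (local_cocycle_lift cphi).
have [a psiN] : exists a, forall x, psi (anti x) = psi x + a.
  apply: (@coboundary_diff (fun x y => cochain2 phi (pr x) (pr y)) (psi \o anti) psi) => //.
  move=> x; have [U xU UP] := psiP (anti x).
  exists (anti @^-1` U); last first.
    move=> b c Ub Uc; rewrite -(UP (anti b) (anti c))//.
    by rewrite !(orbit_proj_antipode (@SinftyN R)).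
  move/nbhs_sph: xU => [V [oV Vx VU]]; apply/nbhs_sph; exists (-%R @^-1` V).
  split=> //; last by move=> y Vy; exact: VU.
  by apply: open_comp => // y _; exact: Rinfty_oppr_continuous.
exists a; apply/null_class1P.
exists (fun p => psi (repr p) + a * sheet (repr p)).
rewrite (_ : cochain2 _ = fun p q => cochain2 phi p q - a * transition p q); last first.
  by rewrite -cochain2_omega0; apply/funext => p; apply/funext.
apply: local_coboundary_orbit => x.
have [U xU UP] := psiP x; have [V xV VP] := transition_coboundary x.
exists (U `&` V) => [|b c [Ub Vb] [Uc Vc]]; first exact: filterI.
have e y : psi (repr (pr y)) + a * sheet (repr (pr y)) = psi y + a * sheet y.
  case: (repr_proj y) => -> //; rewrite psiN sheet_antipode.
  by move: (psi y) (sheet y); move: a {psiN}; clear; f2.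
rewrite /= !e UP// VP//.
by move: (psi b) (psi c) (sheet b) (sheet c); move: a {psiN e}; clear; f2.
Qed.

(** [omega0] is [a * omega] up to a coboundary, and [a] is nonzero because [omega0] is not a
    coboundary. The odd primitive is [sheet] corrected by an even function. *)
Lemma generator_sheet omega : H1_generator omega -> exists eps : S -> 'F_2,
  (forall x, eps (anti x) = eps x + 1) /\
  local_coboundary (fun x y => cochain2 omega (pr x) (pr y)) eps.
Proof.
case=> [_ _ /(_ _ omega0_cocycle)[a /null_class1P[chi]]].
rewrite (_ : cochain2 _ = fun p q => transition p q - a * cochain2 omega p q); last first.
  by rewrite -cochain2_omega0; apply/funext => p; apply/funext.
move=> /local_coboundary_lift c.
have [a0|a1] := F2_case a.
  have [|b] := @coboundary_diff _ _ (chi \o pr) transition_coboundary.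
    by move: c; rewrite a0; congr local_coboundary; apply/funext => x;
      apply/funext => y; rewrite mul0r subr0.
  by move=> /(odd_not_even sheet_antipode).
exists (fun x => sheet x + chi (pr x)); split=> [x|x].
  rewrite sheet_antipode (orbit_proj_antipode (@SinftyN R)).
  by move: (sheet x) (chi (pr x)); clear; f2.
have [U xU UP] := c x; have [V xV VP] := transition_coboundary x.
exists (U `&` V) => [|d e [Ud Vd] [Ue Ve]]; first exact: filterI.
have := UP d e Ud Ue; rewrite VP//= a1 mul1r.
move: (sheet d) (sheet e) (chi (pr d)) (chi (pr e)) (cochain2 omega (pr d) (pr e)).
by clear; f2.
Qed.

End generator.

(** * Bounds for the cohomological index *)

Lemma cup_prod_map (X Y : Type) (h : X -> Y) (w : Y -> Y -> 'F_2) s :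
  cup_prod w (map h s) = cup_prod (fun x y => w (h x) (h y)) s.
Proof.
elim: s => // x [//|y t] ih; rewrite [LHS]/= [RHS]/=.
by congr (_ * _); exact: ih.
Qed.

(** On [U] the i-th twist cancels [w], and one vanishing factor kills the product. *)
Lemma twisted_prod0 (X : Type) (w : X -> X -> 'F_2) (U : X -> Prop) l i s :
  List.Forall U s -> (i.+1 < size s)%N ->
  (forall x y, U x -> U y -> w x y = nth (fun=> 0) l i x + nth (fun=> 0) l i y) ->
  twisted_prod w l s = 0.
Proof.
elim: i l s => [|i ih] l [//|x [//|y t]] Us si wE; rewrite twisted_prodS.
  have Ux : U x by inversion Us.
  have Uy : U y by inversion Us as [|? ? ? Us']; inversion Us'.
  rewrite /twist wE//.
  rewrite (_ : head _ l = nth (fun=> 0) l 0); last by case: l {wE}.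
  by rewrite F2_addxx mul0r.
rewrite (ih (behead l)) ?mulr0//; first by inversion Us.
by rewrite nth_behead.
Qed.

Section fr_index_theory.
Context {R : realType} {W : normedModType R}.
Local Notation S := (Sinfty R).
Local Notation RP := (RPinfty R).
Local Notation pr := (@orbit_proj (Rinfty R) S).
Implicit Types M : set W.

Lemma oppr_cont : continuous (-%R : W -> W).
Proof. by move=> x; exact: opp_continuous. Qed.

Lemma classifying_of_odd M (MN : symmetric_set M) (lift : M -> S) :
  continuous lift ->
  (forall u v : M, \val v = - \val u -> \val (lift v) = - \val (lift u)) ->
  classifying_map (fun q : orbit_space M => pr (lift (repr q))) /\
  forall u : M, pr (lift (repr (orbit_proj u))) = pr (lift u).
Proof.
move=> cl oddl.
have E (u : M) : pr (lift (repr (orbit_proj u))) = pr (lift u).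
  have [->//|->] : repr (orbit_proj u) = u \/ repr (orbit_proj u) = antipode MN u.
    by apply: (orbit_proj_fiber MN); rewrite /orbit_proj reprK.
  by apply/orbit_projP; right; exact: oddl.
split; last exact: E; split; last by exists lift.
apply/quotient_continuous.
rewrite (_ : _ \o _ = pr \o lift); last by apply/funext => u; exact: E.
move=> u; apply: continuous_comp; first exact: cl.
exact: orbit_proj_continuous.
Qed.

Lemma null_class0 (X : topologicalType) (x : X) :
  ~ null_class ((fun=> 1) : cochain X 0).
Proof.
move=> /(_ x)[U xU U0]; apply: F2_neq01.
by rewrite -(U0 (fun=> x))// => _; exact: nbhs_singleton xU.
Qed.

Lemma fr_index_ge1 M : M !=set0 -> (1%:R%:E <= fr_index M)%E.
Proof.
move=> [u Mu]; rewrite /fr_index; case: asboolP => [M0|_].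
  by move: Mu; rewrite M0.
apply: ereal_sup_ubound; exists 1%N => //=; split=> // theta omega _ _.
exact: (null_class0 (orbit_proj (exist _ u (mem_set Mu) : M))).
Qed.

Lemma fr_index0 : fr_index (set0 : set W) = 0%E.
Proof. by rewrite /fr_index; case: asboolP. Qed.

Lemma set_type_cvg (T : Type) (E : topologicalType) (A : set E)
    (F : set_system T) (f : T -> A) (a : A) : Filter F ->
  \val (f x) @[x --> F] --> \val a -> f x @[x --> F] --> a.
Proof.
move=> FF fa N; rewrite nbhsE => -[D [[D' oD' DE] Da] DN].
have D'a : nbhs (\val a) D'.
  by apply: open_nbhs_nbhs; split => //; move: Da; rewrite -DE.
have FD : F [set x | D' (\val (f x))] := fa _ D'a.
by apply: (@filterS _ F FF _ _ _ FD) => x D'x; apply: DN; rewrite -DE.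
Qed.

Lemma sigL_cvg (E T : topologicalType) (A : set E) (f : E -> T) (u : A) :
  {within A, continuous f} -> f (\val v) @[v --> u] --> f (\val u).
Proof. by move=> /subspace_sigL_continuousP /(_ u). Qed.

(** Composition with the map induced by [g] on orbits turns classifying maps of [M'] into
    classifying maps of [M], and pullbacks of null classes are null. *)
Lemma fr_index_mono M M' (g : W -> W) :
  symmetric_set M -> symmetric_set M' -> {within M, continuous g} ->
  (forall u, M u -> M' (g u)) -> (forall u, M u -> g (- u) = - g u) ->
  (fr_index M <= fr_index M')%E.
Proof.
move=> MN M'N cg gM gN.
have [M0|/set0P[u0 Mu0]] := eqVneq M set0.
  rewrite M0 fr_index0.
  have [->|/set0P M'0] := eqVneq M' set0; first by rewrite fr_index0.
  by apply: le_trans (fr_index_ge1 M'0); rewrite lee_fin.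
rewrite /fr_index; case: asboolP => [M0|_]; first by move: Mu0; rewrite M0.
case: asboolP => [M'0|_]; first by have := gM _ Mu0; rewrite M'0.
apply: le_ereal_sup => _ [m [m1 mP] <-]; exists m => //; split => // theta omega.
case=> ctheta [lift [clift liftN liftP]] gomega nullo.
pose gb (u : M) : M' := exist _ (g (\val u)) (mem_set (gM _ (set_val_mem u))).
have cgb : continuous gb.
  by move=> u; apply: (@set_type_cvg _ _ _ (nbhs u)); exact: (@sigL_cvg _ _ _ _ u cg).
pose gq (q : orbit_space M) : orbit_space M' := orbit_proj (gb (repr q)).
have gqE u : gq (orbit_proj u) = orbit_proj (gb u).
  rewrite /gq; have [->//|->] : repr (orbit_proj u) = u \/ repr (orbit_proj u) = antipode MN u.
    by apply: (orbit_proj_fiber MN); rewrite /orbit_proj reprK.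
  by apply/orbit_projP; right; rewrite /= gN//; exact: set_val_mem.
have cgq : continuous gq.
  apply/quotient_continuous.
  rewrite (_ : _ \o _ = @orbit_proj W M' \o gb); last by apply/funext => u; exact: gqE.
  by move=> u; apply: continuous_comp; [exact: cgb|exact: orbit_proj_continuous].
apply: (mP (theta \o gq) omega) => //.
  split; first by move=> q; apply: continuous_comp; [exact: cgq|exact: ctheta].
  exists (lift \o gb); split.
  - by move=> u; apply: continuous_comp; [exact: cgb|exact: clift].
  - by move=> u v uv; apply: liftN; rewrite /= uv gN//; exact: set_val_mem.
  - by move=> u; rewrite /= gqE liftP.
exact: (null_class_pullback cgq nullo).
Qed.

(** The sets where the i-th coordinate of [p] is nonzero, i < m, cover [M], and on each of them the
    sign of that coordinate trivializes the double cover. If the i-th factor is twisted accordingly,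
    a product of at least m factors vanishes locally everywhere. *)
Lemma fr_index_le M m (p : W -> 'rV[R]_m) :
  symmetric_set M -> {within M, continuous p} ->
  (forall u, M u -> p (- u) = - p u) -> (forall u, M u -> p u != 0) ->
  (fr_index M <= m%:R%:E)%E.
Proof.
move=> MN cp pN p0; rewrite /fr_index; case: asboolP => [_|M0].
  by rewrite lee_fin ler0n.
apply: ge_ereal_sup => _ [m' [m'1 m'P] <-]; rewrite lee_fin ler_nat leqNgt.
apply/negP => mm'.
have rp0 (u : M) : rVpoly (p (\val u)) != 0.
  apply: contra (p0 _ (set_val_mem u)) => /eqP e.
  by rewrite -(rVpolyK (p (\val u))) e linear0.
pose lift (u : M) : S := sph_normalize (rVpoly (p (\val u))).
have clift : continuous lift.
  by move=> u; apply: (@sph_normalize_cvg R _ (nbhs u)) => //; exact: (@sigL_cvg _ _ _ _ u cp).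
have liftN (u v : M) : \val v = - \val u -> \val (lift v) = - \val (lift u).
  move=> vu; rewrite -!/(sph _) !sph_normalizeE// vu pN; last exact: set_val_mem.
  by rewrite linearN sqnN scalerN.
have [cth thE] := classifying_of_odd MN clift liftN.
apply: (m'P _ _ cth (@omega0_generator R)).
case: m' m'1 mm' {m'P} => [//|n] _; rewrite ltnS => mn /=.
pose th (q : orbit_space M) : RP := pr (lift (repr q)).
pose w q q' : 'F_2 := transition (th q) (th q').
pose neg i (x : S) : 'F_2 := if (sph x)`_i < 0 then 1 else 0.
(* Both summands change under the antipode, so where the i-th coordinate is nonzero the value does
   not depend on the representative of the orbit. *)
pose chi (i : nat) (q : orbit_space M) : 'F_2 :=
  sheet (lift (repr q)) + neg i (lift (repr q)).
have chiE i (u : M) : (sph (lift u))`_i != 0 ->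
    chi i (orbit_proj u) = sheet (lift u) + neg i (lift u).
  move=> ui; rewrite /chi.
  have [->//|->] : repr (orbit_proj u) = u \/ repr (orbit_proj u) = antipode MN u.
    by apply: (orbit_proj_fiber MN); rewrite /orbit_proj reprK.
  have -> : lift (antipode MN u) = antipode (@SinftyN R) (lift u).
    by apply: sph_inj; exact: (liftN u).
  rewrite sheet_antipode /neg sph_antipode coefN oppr_lt0.
  have [l|l|e] := ltgtP (sph (lift u))`_i 0; last by rewrite e eqxx in ui.
    by rewrite addr0.
  by rewrite -addrA F2_addxx.
pose l := mkseq chi m.
have [psi psi0 psiP] := cup_prod_cohom w l n.
(* Degree 0, where [null_class] has a different form, does not occur: a nonempty [M] has no
   nonvanishing map into R^0. *)
have n0 : (0 < n)%N.
  have [u Mu] : M !=set0 by apply/set0P/eqP.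
  apply: leq_trans mn; case: m p cp pN p0 rp0 {lift clift liftN cth thE th w chi chiE l psi psi0 psiP}.
    by move=> p _ _ /(_ _ Mu); rewrite thinmx0 eqxx.
  by [].
have E (y : 'I_n.+1 -> orbit_space M) :
    pullback th (cup_pow (@omega0 R) n) y = cup_prod w (codom y).
  rewrite /pullback cup_powE cochain2_omega0 (_ : codom _ = map th (codom y)).
    exact: cup_prod_map.
  by rewrite !codomE -map_comp.
case: n n0 mn psiP E => [//|n] _ mn psiP E.
exists (fun y => psi (codom y)); apply: (locally_zero_orbit MN oppr_cont) => u.
have [i im ui] : exists2 i, (i < m)%N & (sph (lift u))`_i != 0.
  have c0 : (Num.sqrt (sqn (rVpoly (p (\val u)))))^-1 != 0.
    by rewrite invr_eq0 sqrtr_eq0 -ltNge sqn_gt0.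
  have : lead_coef (rVpoly (p (\val u))) != 0 by rewrite lead_coef_eq0.
  move=> lc0; exists (size (rVpoly (p (\val u)))).-1.
    by rewrite prednK ?size_poly_gt0// size_poly.
  by rewrite /lift sph_normalizeE// coefZ mulf_neq0.
have [U xU UP] := @transition_coboundary R (lift u).
have xV := nbhs_sph_coef ui.
exists (lift @^-1` (U `&` [set y | (sph y)`_i != 0 /\
  ((sph y)`_i < 0) = ((sph (lift u))`_i < 0)])).
  by apply: clift; exact: filterI.
move=> y yN; rewrite coboundary_codom -/th E.
pose Q q := exists2 v : M, q = orbit_proj v & U (lift v) /\ ((sph (lift v))`_i != 0 /\
  ((sph (lift v))`_i < 0) = ((sph (lift u))`_i < 0)).
have Qy : List.Forall Q (codom (@orbit_proj W M \o y)).
  rewrite codomE; elim: (enum _) => [|j s ih]; first by constructor.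
  by constructor; [exists (y j) => //; exact: yN|exact: ih].
have wP v v' : U (lift v) -> U (lift v') ->
    w (orbit_proj v) (orbit_proj v') = sheet (lift v) + sheet (lift v').
  by move=> Uv Uv'; rewrite /w /th !thE; exact: UP.
rewrite (psiP Q) ?size_codom ?card_ord//; last first.
  move=> _ _ _ [a -> [Ua _]] [b -> [Ub _]] [c -> [Uc _]]; rewrite !wP//.
  by move: (sheet _) (sheet _) (sheet _); clear; f2.
rewrite (@twisted_prod0 _ _ Q _ i) ?add0r ?subrr//.
  by rewrite size_codom card_ord ltnS (leq_trans im).
move=> _ _ [a -> [Ua [ai ae]]] [b -> [Ub [bi be]]].
rewrite wP// nth_mkseq// !chiE// /neg ae be.
by move: (sheet _) (sheet _) (if _ then _ else _ : 'F_2); clear; f2.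
Qed.

End fr_index_theory.

(** * The cross-polytope and the Borsuk-Ulam bound *)

Section cross_polytope.
Context {R : realType} {k : nat}.
Local Notation V := 'rV[R]_k.+1.
Implicit Types v : V.

(** The l1 norm makes cones flat: a segment from a point of the sphere with vanishing j-th
    coordinate to the j-th pole stays on the sphere, so no normalization enters. *)
Definition l1 v : R := \sum_i `|v 0 i|.

Definition l1_sphere : set V := [set v | l1 v = 1].

Lemma l1N v : l1 (- v) = l1 v.
Proof. by apply: eq_bigr => i _; rewrite mxE normrN. Qed.

Lemma norm_le_l1 v : `|v| <= l1 v.
Proof.
rewrite -[`|v|]/(mx_norm v) mx_normrE; apply: bigmax_le => [|[i j] _ /=].
  by apply: sumr_ge0.
by rewrite ord1 /l1 (bigD1 j)//= lerDl sumr_ge0.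
Qed.

Lemma l1_delta i : l1 (delta_mx 0 i) = 1.
Proof.
rewrite /l1 (bigD1 i)//= mxE !eqxx normr1 big1 ?addr0// => j ji.
by rewrite mxE eqxx (negbTE ji) normr0.
Qed.

Lemma l1_sphere_compact : compact l1_sphere.
Proof.
apply: bounded_closed_compact.
  exists 1; split => // M M1 v v1.
  by apply: le_trans (norm_le_l1 v) _; rewrite v1 ltW.
rewrite (_ : l1_sphere = l1 @^-1` [set 1])//.
apply: closed_comp => [v _|]; last exact: closed_eq.
apply: continuous_sum_fun => i.
exact: cvg_norm (@coord_continuous _ _ _ 0 i v).
Qed.

Definition l1_face (j : nat) v :=
  l1 v = 1 /\ forall i : 'I_k.+1, (j < i)%N -> v 0 i = 0.

Definition pole (j : nat) : V := delta_mx 0 (inord j).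

Lemma l1_face0 : l1_face 0 (pole 0).
Proof.
split=> [|i i0]; first exact: l1_delta.
by rewrite mxE eqxx /= -val_eqE /= inordK// gtn_eqF.
Qed.

Lemma l1_faceN j v : l1_face j v -> l1_face j (- v).
Proof. by move=> [v1 v0]; split=> [|i /v0]; rewrite ?l1N// mxE => ->; rewrite oppr0. Qed.

Lemma l1_faceS j v (t : R) : (j < k)%N -> l1_face j v -> 0 <= t <= 1 ->
  l1_face j.+1 ((1 - t) *: v + t *: pole j.+1).
Proof.
move=> jk [v1 v0] /andP[t0 t1].
have vj : v 0 (inord j.+1) = 0 by apply: v0; rewrite inordK.
have E i : ((1 - t) *: v + t *: pole j.+1) 0 i =
    (1 - t) * v 0 i + t * (i == inord j.+1)%:R by rewrite !mxE eqxx.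
split=> [|i ji].
  rewrite /l1 (bigD1 (inord j.+1))//= E eqxx vj mulr0 add0r mulr1 ger0_norm//.
  rewrite (eq_bigr (fun i => (1 - t) * `|v 0 i|)); last first.
    move=> i ij; rewrite E (negbTE ij) mulr0 addr0 normrM ger0_norm//.
    by rewrite subr_ge0.
  rewrite -mulr_sumr; move: v1; rewrite /l1 (bigD1 (inord j.+1))//= vj normr0 add0r => ->.
  by rewrite mulr1 addrC subrK.
rewrite E v0; last exact: ltn_trans ji.
by rewrite -val_eqE /= inordK// gtn_eqF// !mulr0 addr0.
Qed.

End cross_polytope.
Arguments l1_sphere R k : clear implicits.

Section fr_index_lower_bound.
Context {R : realType} {W : normedModType R}.
Local Notation S := (Sinfty R).
Local Notation RP := (RPinfty R).
Local Notation pr := (@orbit_proj (Rinfty R) S).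

(* The Borsuk-Ulam theorem for the cohomological index. *)
Lemma fr_index_ge (M : set W) k (h : 'rV[R]_k.+1 -> W) :
  symmetric_set M -> {within l1_sphere R k, continuous h} ->
  (forall v, l1_sphere R k v -> M (h v)) ->
  (forall v, l1_sphere R k v -> h (- v) = - h v) ->
  (k.+1%:R%:E <= fr_index M)%E.
Proof.
move=> MN ch hM hN.
have Kpole : l1_sphere R k (delta_mx 0 ord0) by exact: l1_delta.
pose m0 : M := exist _ (h (delta_mx 0 ord0)) (mem_set (hM _ Kpole)).
rewrite /fr_index; case: asboolP => [M0|_]; first by have := hM _ Kpole; rewrite M0.
apply: ereal_sup_ubound; exists k.+1 => //=; split=> // theta omega.
case=> ctheta [lift [clift liftN liftP]] gomega.
case: k h ch hM hN Kpole m0 => [|k] h ch hM hN Kpole m0.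
  by apply: null_class0; exact: orbit_proj m0.
move=> [psi psi0].
have [eps [epsN epsP]] := generator_sheet gomega.
(* Total extension of [h]; the default [m0] is taken off the sphere, where the values do not
   matter. *)
pose mu v : M := if pselect (l1_sphere R k.+1 v) is left Kv
  then exist _ (h v) (mem_set (hM v Kv)) else m0.
have muE v : l1_sphere R k.+1 v -> \val (mu v) = h v.
  by rewrite /mu; case: pselect.
have muN v : l1_sphere R k.+1 v -> mu (- v) = antipode MN (mu v).
  move=> Kv; apply: antipode_val; rewrite muE ?muE ?hN//.
  by rewrite /l1_sphere /= l1N.
pose et v : 'F_2 := eps (lift (mu v)).
have etN v : l1_sphere R k.+1 v -> et (- v) = et v + 1.
  move=> Kv; rewrite /et muN// -epsN; congr eps.
  by apply: (antipode_val (@SinftyN R)); exact: liftN.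
pose w q q' := cochain2 omega (theta q) (theta q').
(* On a good set the lifted cocycle has the primitive [et] and its power is the coboundary of [psi].
   By compactness the cover by good sets has a Lebesgue number [d]. *)
pose good (G : set 'rV[R]_k.+2) :=
  (forall a b, G a -> G b -> w (orbit_proj (mu a)) (orbit_proj (mu b)) = et a + et b) /\
  (forall y : 'I_k.+2 -> 'rV[R]_k.+2, (forall i, G (y i)) ->
     pullback theta (cup_pow omega k.+1) (fun i => orbit_proj (mu (y i))) =
     coboundary psi (fun i => orbit_proj (mu (y i)))).
have [d d0 dP] : exists2 d : R, 0 < d & forall v, l1_sphere R k.+1 v ->
    exists2 G, good G & forall u, l1_sphere R k.+1 u -> `|v - u| < d -> G u.
  pose Q (d : R) v := exists2 G, good G &
    forall u, l1_sphere R k.+1 u -> `|v - u| < d -> G u.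
  suff : \forall d \near 0^'+, l1_sphere R k.+1 `<=` Q d.
    move=> [e /= e0 eQ]; exists (e / 2); first by rewrite divr_gt0.
    apply: eQ; last by rewrite divr_gt0.
    by rewrite /ball_ /= sub0r normrN gtr0_norm ?divr_gt0// ltr_pdivrMr// ltr_pMr// ltr1n.
  have /compact_near_coveringP ncov := @l1_sphere_compact R k.+1.
  apply: (ncov _ (0^'+) Q) => v Kv.
  have [U vU UP] := psi0 (orbit_proj (mu v)).
  have [U' vU' U'P] := epsP (lift (mu v)).
  have vN : nbhs (mu v) ((@orbit_proj W M @^-1` U) `&` (lift @^-1` U')).
    by apply: filterI; [exact: orbit_proj_continuous|exact: clift].
  move: vN; rewrite nbhsE => -[D [[D' oD' DE] Dv] DN].
  have D'v : nbhs (h v) D'.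
    by apply: open_nbhs_nbhs; split=> //; rewrite -(muE v Kv); move: Dv; rewrite -DE.
  have /nbhs_normP[e e0 eP] : nbhs v [set u | l1_sphere R k.+1 u -> D' (h u)].
    exact: (subspace_continuousP _ _).1 ch v Kv D' D'v.
  pose G : set 'rV[R]_k.+2 := [set u | l1_sphere R k.+1 u /\ D' (h u)].
  have gG : good G.
    have GD u : G u -> D (mu u) by move=> [Ku Du]; rewrite -DE -[_ (mu u)]/(D' (\val (mu u))) muE.
    split=> [a b /GD/DN[_ Ua] /GD/DN[_ Ub]|y yG].
      by rewrite /w !liftP; exact: U'P.
    apply/eqP; rewrite -subr_eq0; apply/eqP.
    by apply: (UP (fun i => orbit_proj (mu (y i)))) => i; exact: (DN _ (GD _ (yG i))).1.
  exists (ball v (e / 2), [set d : R | d < e / 2]) => /=.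
    split; first by apply: nbhsx_ballx; rewrite divr_gt0.
    by apply: nbhs_right_lt; rewrite divr_gt0.
  move=> [u d] /= [vu de]; exists G => // u' Ku' uu'; split=> //.
  apply: eP => //; rewrite -ball_normE /= in vu.
  by rewrite /ball_ /= -(subrKA u) (le_lt_trans (ler_normD _ _))//; lra.
(* So many levels that the mesh (k + 1) 2/N of the chain is below the Lebesgue number. *)
pose N := (Num.truncn (k.+1%:R * 2 / d)).+1.
have N0 : (0 < N)%N by [].
have Nd : k.+1%:R * (2 / N%:R) < d.
  have := truncnS_gt (k.+1%:R * 2 / d); rewrite -/N ltr_pdivrMr// => Nd.
  by rewrite mulrA ltr_pdivrMr ?ltr0n// [d * _]mulrC.
pose e : nat -> 'rV[R]_k.+2 := pole.
have chain_sub j s v : (j <= k.+1)%N -> s \in sphere_chain e N j -> v \in s ->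
    l1_sphere R k.+1 v.
  move=> jk sj vs.
  by have [] := sphere_chain_sub N0 l1_face0 l1_faceN l1_faceS jk sj vs.
have chain_mesh s x y : s \in sphere_chain e N k.+1 -> x \in s -> y \in s ->
    `|x - y| < d.
  move=> sj xs ys; apply: le_lt_trans Nd.
  apply: (sphere_chain_mesh N0 l1_face0 l1_faceN l1_faceS _ _ _ sj xs ys) => //.
    by move=> j v [v1 _]; rewrite -v1 norm_le_l1.
  by move=> j; apply: le_trans (norm_le_l1 _) _; rewrite l1_delta.
(* Being defined through orbits, this cochain is antipodally invariant on the chain, as the pairing
   argument requires. *)
pose psi' s := seq_cochain psi (map (fun v => orbit_proj (mu v)) s).
apply: (@cup_prod_neq_bd _ _ e N N0 k.+1 l1_face l1_face0 l1_faceN l1_faceS et _ k psi' (ltnSn k)).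
- by move=> j v [v1 _]; exact: etN.
- move=> s sj; rewrite /psi' -map_comp; congr seq_cochain.
  apply/eq_in_map => v vs /=; rewrite muN; last exact: chain_sub sj vs.
  exact: orbit_proj_antipode.
move=> s sj; have [y ys] : exists y : 'I_k.+2 -> 'rV[R]_k.+2, s = codom y.
  exact/seq_codom/sphere_chain_size/sj.
have ysE i : y i \in s by rewrite ys codom_f.
have [G [G1 G2] GP] := dP (y ord0) (chain_sub _ _ _ (leqnn _) sj (ysE _)).
have Gy i : G (y i).
  by apply: GP; [exact: chain_sub sj (ysE _)|exact: chain_mesh sj (ysE _) (ysE _)].
have Gs v : v \in s -> G v by rewrite ys => /codomP[i ->].
rewrite /psi' bd_map ys.
have -> : map (fun v => orbit_proj (mu v)) (codom y) =
          codom (fun i => orbit_proj (mu (y i))) by rewrite !codomE -map_comp.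
rewrite -coboundaryE -G2// /pullback cup_powE.
have -> : codom (theta \o (fun i => orbit_proj (mu (y i)))) =
          map (fun v => theta (orbit_proj (mu v))) s.
  by rewrite ys !codomE -map_comp.
rewrite cup_prod_map -ys; elim: s Gs {sj ys ysE} => // a [//|b t] ih Gs.
rewrite [LHS]/= [RHS]/=; congr (_ * _).
  by rewrite -G1//; apply: Gs; rewrite !inE eqxx ?orbT.
by apply: ih => v vt; apply: Gs; rewrite inE vt orbT.
Qed.
End fr_index_lower_bound.

(** * Duality and weak compactness *)

Section hahn_banach.
Context {R : realType} {W : lmodType R}.
Implicit Types (p q : W -> R) (x y : W) (t : R).

Definition sublinear p :=
  (forall x y, p (x + y) <= p x + p y) /\
  (forall t x, 0 <= t -> p (t *: x) = t * p x).

Lemma sublinear0 p : sublinear p -> p 0 = 0.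
Proof. by move=> [_ pZ]; rewrite -(scale0r 0) pZ// mul0r. Qed.

Lemma sublinearN p x : sublinear p -> - p (- x) <= p x.
Proof. by move=> sp; have := sp.1 x (- x); rewrite subrr sublinear0//; lra. Qed.

(* The largest sublinear functional below [p] that is additive on the ray
   through [y]. *)
Definition shift p y x := inf [set p (x + t *: y) - t * p y | t in [set t | 0 <= t]].

Lemma shift_has_inf p y x : sublinear p ->
  has_inf [set p (x + t *: y) - t * p y | t in [set t | 0 <= t]].
Proof.
move=> sp; split; first by exists (p (x + 0 *: y) - 0 * p y), 0 => /=.
exists (- p (- x)) => _ [t /= t0 <-]; have := sp.1 (x + t *: y) (- x).
by rewrite addrAC subrr add0r sp.2//; lra.
Qed.

Lemma shift_le p y x t : sublinear p -> 0 <= t ->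
  shift p y x <= p (x + t *: y) - t * p y.
Proof.
by move=> sp t0; apply: (ge_inf (shift_has_inf _ _ sp).2); exists t.
Qed.

Lemma shift_le_id p y x : sublinear p -> shift p y x <= p x.
Proof.
by move=> sp; have := shift_le y x sp (lexx 0); rewrite scale0r addr0 mul0r subr0.
Qed.

Lemma shiftN p y : sublinear p -> shift p y (- y) <= - p y.
Proof.
move=> sp; have := shift_le y (- y) sp ler01.
by rewrite scale1r addNr sublinear0// mul1r sub0r.
Qed.

Lemma sublinear_shift p y : sublinear p -> sublinear (shift p y).
Proof.
move=> sp; split=> [x z|t x t0].
  rewrite leNgt; apply/negP => lt.
  pose e := shift p y (x + z) - (shift p y x + shift p y z).
  have e0 : 0 < e / 2 by rewrite divr_gt0// subr_gt0.
  have [_ [t /= t0 <-] ht] := inf_adherent e0 (shift_has_inf y x sp).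
  have [_ [u /= u0 <-] hu] := inf_adherent e0 (shift_has_inf y z sp).
  have := shift_le y (x + z) sp (addr_ge0 t0 u0).
  rewrite scalerDl addrACA; have := sp.1 (x + t *: y) (z + u *: y).
  move: ht hu; rewrite -/(shift p y x) -/(shift p y z).
  by rewrite {}/e in e0 *; lra.
have [->|tneq0] := eqVneq t 0.
  rewrite mul0r scale0r; apply/eqP; rewrite eq_le; apply/andP; split.
    by have := shift_le_id y 0 sp; rewrite (sublinear0 sp).
  apply: lb_le_inf; first exact: (shift_has_inf y 0 sp).1.
  by move=> _ [u /= u0 <-]; rewrite add0r sp.2// subrr.
have t_gt0 : 0 < t by rewrite lt0r tneq0.
apply/eqP; rewrite eq_le; apply/andP; split.
  rewrite mulrC -ler_pdivrMr//; apply: lb_le_inf; first exact: (shift_has_inf y x sp).1.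
  move=> _ [u /= u0 <-]; rewrite ler_pdivrMr// mulrBl -[p _ * t]mulrC -sp.2//.
  rewrite scalerDr scalerA -mulrA [p y * t]mulrC mulrA [u * t]mulrC.
  exact/shift_le/mulr_ge0.
apply: lb_le_inf; first exact: (shift_has_inf y (t *: x) sp).1.
move=> _ [u /= u0 <-].
have -> : t *: x + u *: y = t *: (x + (t^-1 * u) *: y).
  by rewrite scalerDr scalerA mulrA divff// mul1r.
rewrite sp.2// (_ : u * p y = t * ((t^-1 * u) * p y)); last first.
  by rewrite !mulrA divff// mul1r.
rewrite -mulrBr ler_wpM2l//; apply: shift_le => //.
by rewrite mulr_ge0// invr_ge0.
Qed.

(** Zorn's lemma for the reversed pointwise order. The bound of a chain is its pointwise infimum,
    which is finite since every sublinear functional below [p] is at least - p(- x) at x. *)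
Lemma minimal_sublinear p : sublinear p -> exists q,
  [/\ sublinear q, forall x, q x <= p x &
      forall q', sublinear q' -> (forall x, q' x <= q x) -> q' = q].
Proof.
move=> sp; pose T := {q : W -> R | sublinear q /\ forall x, q x <= p x}.
pose rl (a b : T) := `[< forall x, sval b x <= sval a x >].
have [||||a amin] := @Zorn T rl.
- by move=> a; apply/asboolP.
- by move=> a b c /asboolP ab /asboolP bc; apply/asboolP => x; exact: le_trans (bc x) (ab x).
- move=> [a Ha] [b Hb] /asboolP ab /asboolP ba; apply: eq_exist.
  by apply/funext => x; apply/eqP; rewrite eq_le ab ba.
- move=> A tA; have [A0|/existsNP[a0 /contrapT Aa0]] := pselect (forall a, ~ A a).
    have pp : sublinear p /\ forall x, p x <= p x by [].
    by exists (exist _ p pp : T) => a /A0.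
  pose E x := [set sval a x | a in A].
  have infE x : has_inf (E x).
    split; first by exists (sval a0 x), a0.
    exists (- p (- x)) => _ [a Aa <-]; have [sa ap] := svalP a.
    by apply: le_trans (sublinearN x sa); rewrite lerN2.
  have infle a x : A a -> inf (E x) <= sval a x.
    by move=> Aa; apply: (ge_inf (infE x).2); exists a.
  have sm : sublinear (fun x => inf (E x)).
    split=> [x y|].
      rewrite leNgt; apply/negP => lt.
      pose e := inf (E (x + y)) - (inf (E x) + inf (E y)).
      have e0 : 0 < e / 2 by rewrite divr_gt0// subr_gt0.
      have [_ [a Aa <-] ha] := inf_adherent e0 (infE x).
      have [_ [b Ab <-] hb] := inf_adherent e0 (infE y).
      have [/asboolP ab|/asboolP ba] := tA _ _ Aa Ab.
        have := infle b (x + y) Ab; have := (svalP b).1.1 x y; have := ab x.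
        by rewrite {}/e in e0 ha hb; lra.
      have := infle a (x + y) Aa; have := (svalP a).1.1 x y; have := ba y.
      by rewrite {}/e in e0 ha hb; lra.
    have half t x : 0 < t -> inf (E (t *: x)) <= t * inf (E x).
      move=> t0; rewrite mulrC -ler_pdivrMr//; apply: lb_le_inf; first exact: (infE x).1.
      move=> _ [a Aa <-]; rewrite ler_pdivrMr// mulrC -((svalP a).1.2 _ _ (ltW t0)).
      exact: infle.
    move=> t x t0; have [->|tneq0] := eqVneq t 0.
      rewrite mul0r scale0r; apply/eqP; rewrite eq_le; apply/andP; split.
        by rewrite -(sublinear0 (svalP a0).1) infle.
      apply: lb_le_inf; first exact: (infE 0).1.
      by move=> _ [a Aa <-]; rewrite sublinear0//; exact: (svalP a).1.
    have {}t0 : 0 < t by rewrite lt0r tneq0.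
    apply/eqP; rewrite eq_le half//= mulrC -ler_pdivlMr// mulrC.
    rewrite -{1}(scale1r x) -(mulVf tneq0) -scalerA.
    by apply: half; rewrite invr_gt0.
  have mp : sublinear (fun x => inf (E x)) /\ forall x, inf (E x) <= p x.
    by split=> // x; exact: le_trans (infle a0 x Aa0) ((svalP a0).2 x).
  by exists (exist _ (fun x => inf (E x)) mp : T) => a Aa; apply/asboolP => x; exact: infle.
exists (sval a); split; [exact: (svalP a).1|exact: (svalP a).2|].
move=> q' sq' q'a.
have q'p : sublinear q' /\ forall x, q' x <= p x.
  by split=> // x; exact: le_trans (q'a x) ((svalP a).2 x).
have /(f_equal sval) : exist _ q' q'p = a by apply: amin; apply/asboolP.
by [].
Qed.

(** Minimality identifies [q] with [shift q x], whose value at [- x] is at most [- q x]. *)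
Lemma minimal_sublinear_odd q x : sublinear q ->
  (forall q', sublinear q' -> (forall x, q' x <= q x) -> q' = q) ->
  q (- x) = - q x.
Proof.
move=> sq qmin; apply/eqP; rewrite eq_le; apply/andP; split; last first.
  by have := sublinearN x sq; lra.
rewrite -{1}(qmin _ (sublinear_shift x sq)); first exact: shiftN.
by move=> y; exact: shift_le_id.
Qed.

Lemma hahn_banach p x0 : sublinear p -> exists q : W -> R,
  [/\ linear (q : W -> R^o), forall x, q x <= p x & q x0 = p x0].
Proof.
(* Starting below [shift p x0] instead of [p] forces equality at [x0], because
   [shift p x0 (- x0) <= - p x0]. An odd sublinear functional is linear. *)
move=> sp; have [q [sq qle qmin]] := minimal_sublinear (sublinear_shift x0 sp).
have qN x : q (- x) = - q x by exact: minimal_sublinear_odd.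
have qp x : q x <= p x by exact: le_trans (qle x) (shift_le_id _ _ sp).
exists q; split => //; last first.
  apply/eqP; rewrite eq_le qp /= -lerN2 -qN.
  exact: le_trans (qle _) (shiftN _ sp).
have qD x y : q (x + y) = q x + q y.
  apply/eqP; rewrite eq_le sq.1 /=.
  by have := sq.1 (x + y) (- y); rewrite addrK qN; lra.
have qZ a x : q (a *: x) = a * q x.
  have [a0|a0] := leP 0 a; first by rewrite sq.2.
  by rewrite -{1}[a]opprK scaleNr qN sq.2 ?oppr_ge0 ?ltW// mulNr opprK.
by move=> a x y; rewrite qD qZ.
Qed.

End hahn_banach.

Section dual_theory.
Context {R : realType} {W : normedModType R}.
Implicit Types (f : dual W) (u v x : W).

Lemma dual_le f v : `|f v| <= `|f| * `|v|.
Proof.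
have [->|v0] := eqVneq v 0.
  by rewrite -(scale0r 0) dual_scale mul0r !normr0 scale0r normr0 mulr0.
have nv : 0 < `|v| by rewrite normr_gt0.
have -> : f v = `|v| * f (`|v|^-1 *: v).
  by rewrite dual_scale mulrA divff ?mul1r// gt_eqF.
rewrite normrM normr_id mulrC ler_wpM2r//.
by apply: dual_norm_ub; rewrite normrZ normfV normr_id mulVf// gt_eqF.
Qed.

Lemma dualD f u v : f (u + v) = f u + f v.
Proof. by have := dual_linear f 1 u v; rewrite !scale1r. Qed.

Lemma dual0 f : f 0 = 0.
Proof. by rewrite -(scale0r 0) dual_scale mul0r. Qed.

Lemma dualN f v : f (- v) = - f v.
Proof. by rewrite -scaleN1r dual_scale mulN1r. Qed.

Lemma dualB f u v : f (u - v) = f u - f v.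
Proof. by rewrite dualD dualN. Qed.

Lemma dual_oppE f v : (- f) v = - f v. Proof. by []. Qed.

Lemma dual_subE f g v : (f - g) v = f v - g v. Proof. by []. Qed.

Lemma bounded_dual (h : W -> R^o) (C : R) : linear h ->
  (forall v, `|h v| <= C * `|v|) -> exists f, forall v, f v = h v.
Proof.
move=> lh hC; pose lf : {linear W -> R^o} := HB.pack h (GRing.isLinear.Build _ _ _ _ h lh).
have ch : continuous h.
  apply: (@bounded_linear_continuous _ _ _ lf); apply/linear_boundedP.
  exists C; split=> [|r Cr x]; first exact: num_real.
  by apply: (le_trans (hC x)); rewrite ler_wpM2r// ltW.
have hP : h \in @dual_pred R W by apply/asboolP.
by exists (Dual hP).
Qed.

Lemma dual_of_sublinear (p : W -> R) x : sublinear p -> (forall v, p v <= `|v|) ->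
  exists f, [/\ forall v, f v <= p v & f x = p x].
Proof.
move=> sp p1; have [q [lq qp qx]] := hahn_banach x sp.
have [v|f fq] := @bounded_dual q 1 lq; last first.
  by exists f; split=> [v|]; rewrite fq.
have qN : q (- v) = - q v.
  by have := lq (-1) v 0; rewrite !scaleN1r addr0 => ->;
    have := lq (-1) 0 0; rewrite scaler0 addr0 !scaleN1r addNr => ->; rewrite addr0.
rewrite mul1r ler_norml lerNl -qN -{1}normrN.
by rewrite !(le_trans (qp _)).
Qed.

Lemma dual_norming x : exists f, (forall v, `|f v| <= `|v|) /\ f x = `|x|.
Proof.
have [||f [f1 fx]] := @dual_of_sublinear (fun v => `|v|) x => //.
  by split=> [u v|t v t0]; [exact: ler_normD|rewrite normrZ ger0_norm].
by exists f; split=> // v; rewrite ler_norml lerNl -dualN f1 -normrN f1.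
Qed.

(** Hahn-Banach for the distance to the subspace [Y]: a sublinear functional below the norm, zero on
    [Y] and at least [d] at [x]. *)
Lemma dual_separation (Y : set W) x (d : R) : 0 < d ->
  Y 0 -> (forall u v, Y u -> Y v -> Y (u + v)) -> (forall a u, Y u -> Y (a *: u)) ->
  (forall y, Y y -> d <= `|x - y|) ->
  exists f, (forall y, Y y -> f y = 0) /\ f x != 0.
Proof.
move=> d0 Y0 YD YZ Yd.
pose p v := inf [set `|v - y| | y in Y].
have infp v : has_inf [set `|v - y| | y in Y].
  by split; [exists `|v - 0|, 0|exists 0 => _ [y _ <-]].
have ple v y : Y y -> p v <= `|v - y|.
  by move=> Yy; apply: (ge_inf (infp v).2); exists y.
have p_ge0 v : 0 <= p v by apply: lb_le_inf; [exact: (infp v).1|move=> _ [y _ <-]].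
have pY v : Y v -> p v = 0.
  by move=> Yv; apply/eqP; rewrite eq_le p_ge0 andbT -(normr0 W) -(subrr v) ple.
have half t v : 0 < t -> p (t *: v) <= t * p v.
  move=> t0; rewrite mulrC -ler_pdivrMr//; apply: lb_le_inf; first exact: (infp v).1.
  move=> _ [y Yy <-]; rewrite ler_pdivrMr// mulrC.
  by rewrite -{2}(gtr0_norm t0) -normrZ scalerBr ple//; exact: YZ.
have sp : sublinear p.
  split=> [u v|t v t0].
    rewrite leNgt; apply/negP => lt; pose e := p (u + v) - (p u + p v).
    have e0 : 0 < e / 2 by rewrite divr_gt0// subr_gt0.
    have [_ [a Ya <-] ha] := inf_adherent e0 (infp u).
    have [_ [b Yb <-] hb] := inf_adherent e0 (infp v).
    have := ple (u + v) _ (YD _ _ Ya Yb); rewrite opprD addrACA.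
    have := ler_normD (u - a) (v - b); move: ha hb; rewrite -/(p u) -/(p v).
    by rewrite {}/e in e0 *; lra.
  have [->|tneq0] := eqVneq t 0; first by rewrite mul0r scale0r pY.
  have {}t0 : 0 < t by rewrite lt0r tneq0.
  apply/eqP; rewrite eq_le half//= mulrC -ler_pdivlMr// mulrC.
  rewrite -{1}(scale1r v) -(mulVf tneq0) -scalerA.
  by apply: half; rewrite invr_gt0.
have [|f [fp fx]] := dual_of_sublinear x sp.
  by move=> v; rewrite -{2}(subr0 v) ple.
exists f; split=> [y Yy|].
  apply/eqP; rewrite eq_le; apply/andP; split; first by rewrite -(pY _ Yy).
  rewrite -oppr_le0 -dualN -(pY (- y)) ?fp// -scaleN1r; exact: YZ.
rewrite fx gt_eqF// (lt_le_trans d0)//; apply: lb_le_inf; first exact: (infp x).1.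
by move=> _ [y Yy <-]; exact: Yd.
Qed.

Lemma dual_cvg0 (T : Type) (F : set_system T) (p : T -> dual W) (a : dual W)
    (u : T -> W) (C : R) : Filter F -> p t @[t --> F] --> a ->
  (\forall t \near F, `|u t| <= C) -> (p t (u t) - a (u t)) @[t --> F] --> (0 : R).
Proof.
move=> FF pa uC; apply/cvgrPdist_lt => e e0.
pose C' := Num.max C 1.
have C'0 : 0 < C' by rewrite lt_max ltr01 orbT.
have /cvgrPdist_lt/(_ (e / C')) := pa; rewrite divr_gt0// => /(_ isT) pa'.
near=> t; rewrite sub0r normrN -dual_subE (le_lt_trans (dual_le _ _))//.
have h1 : `|a - p t| < e / C' by near: t.
have h2 : `|u t| <= C by near: t.
rewrite distrC in h1.
apply: le_lt_trans (_ : `|p t - a| * C' < e); last by rewrite -ltr_pdivlMr.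
by rewrite ler_wpM2l// (le_trans h2)// le_max lexx.
Unshelve. all: by end_near. Qed.

End dual_theory.

Section weak_sequential_compactness.
Context {R : realType} {W : normedModType R}.
Hypothesis W_refl : reflexive_space W.
Implicit Types (f : dual W) (w : W).

(** Along an ultrafilter bounded scalar sequences converge, so the limits of [f (u j)] form a
    bounded functional on the dual, represented by a point thanks to reflexivity. *)
Lemma ultra_weak_limit (u : nat -> W) (C : R) (U : set_system nat) :
  (forall j, `|u j| <= C) -> UltraFilter U ->
  exists w, forall f, f (u j) @[j --> U] --> f w.
Proof.
move=> uC UU; have PU : ProperFilter U by exact: ultra_proper.
have flim f : exists l : R, f (u j) @[j --> U] --> l.
  pose F : set_system R := fmap (fun j => f (u j)) U.
  have FA : F `[- (`|f| * C), `|f| * C]%classic.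
    apply: (@filterS _ U _ setT); last exact: filterT.
    move=> j _ /=; rewrite in_itv /= -ler_norml (le_trans (dual_le _ _))//.
    by rewrite ler_wpM2l.
  have PF : ProperFilter F by exact: fmap_proper_filter.
  have [l [_ Fl]] := @segment_compact R (- (`|f| * C)) (`|f| * C) F PF FA.
  exists l => N lN.
  have [//|UN] := in_ultra_setVsetC ((fun j => f (u j)) @^-1` N) UU.
  by have [x [/= Nx']] := Fl (~` N) N UN lN.
have /choice[phi phiP] := flim.
have C0 : 0 <= C by exact: le_trans (normr_ge0 _) (uC 0%N).
have phiE f l : f (u j) @[j --> U] --> l -> phi f = l.
  by move=> fl; apply: (cvg_unique _ (phiP f) fl).
have lphi : linear (phi : dual W -> R^o).
  move=> a f g; apply: phiE; apply: (@cvgD _ R^o); last exact: phiP.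
  by apply: (@cvgZl_tmp _ R^o); exact: phiP.
have [|Phi PhiE] := @bounded_dual _ (dual W) phi C lphi.
  move=> f; have : `|f (u j)| @[j --> U] --> `|phi f| by exact: cvg_norm (phiP f).
  move=> /cvgr_to_le; apply; apply: (@filterS _ U _ setT); last exact: filterT.
  by move=> j _; rewrite mulrC (le_trans (dual_le _ _))// ler_wpM2l.
have [w wP] := W_refl Phi; exists w => f.
by rewrite -wP PhiE; exact: phiP.
Qed.

Lemma ultra_extends (F : set_system nat) : ProperFilter F ->
  exists2 U : set_system nat, UltraFilter U & F `<=` U.
Proof. by move=> FF; have [U [UU FU]] := ultraFilterLemma FF; exists U. Qed.

(** Polynomials encode finitely supported coefficient sequences; those with rational coefficients
    are countable and can be enumerated through [unpickle]. *)
Definition combination (u : nat -> W) (P : {poly R}) : W :=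
  \sum_(i < size P) P`_i *: u i.

Lemma combinationE u n (P : {poly R}) : (size P <= n)%N ->
  combination u P = \sum_(i < n) P`_i *: u i.
Proof.
move=> Pn; rewrite /combination (big_ord_widen _ (fun i => P`_i *: u i) Pn) big_mkcond /=.
by apply: eq_bigr => i _; case: ltnP => // Pi; rewrite nth_default// scale0r.
Qed.

Lemma combinationD u (P Q : {poly R}) :
  combination u (P + Q) = combination u P + combination u Q.
Proof.
pose n := maxn (size P) (size Q).
rewrite !(@combinationE u n) ?leq_maxl ?leq_maxr ?size_polyD// -big_split.
by apply: eq_bigr => i _; rewrite coefD scalerDl.
Qed.

Lemma combinationZ u a (P : {poly R}) : combination u (a *: P) = a *: combination u P.
Proof.
rewrite (@combinationE u (size P)) ?size_scale_leq// scaler_sumr.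
by apply: eq_bigr => i _; rewrite coefZ scalerA.
Qed.

Lemma combinationB u (P Q : {poly R}) :
  combination u (P - Q) = combination u P - combination u Q.
Proof. by rewrite combinationD -(scaleN1r Q) combinationZ scaleN1r. Qed.

Lemma combinationX u i : combination u 'X^i = u i.
Proof.
rewrite /combination size_polyXn (bigD1 ord_max)//= coefXn eqxx scale1r big1 ?addr0// => j.
by rewrite -val_eqE /= coefXn => /negbTE ->; rewrite scale0r.
Qed.

Definition rat_combination (u : nat -> W) (Q : {poly rat}) : W :=
  combination u (map_poly ratr Q).

Lemma rat_combination_dense u (C : R) (P : {poly R}) (e : R) :
  (forall j, `|u j| <= C) -> 0 < e ->
  exists Q, `|combination u P - rat_combination u Q| < e.
Proof.
move=> uC e0; pose n := size P; pose C' := Num.max C 1.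
have C'0 : 0 < C' by rewrite lt_max ltr01 orbT.
pose d := e / (n.+1%:R * C').
have d0 : 0 < d by rewrite divr_gt0// mulr_gt0// ltr0n.
have /choice[r rP] (i : nat) : exists r : rat, `|P`_i - ratr r| < d.
  have [|r] := @rat_in_itvoo R (P`_i - d) (P`_i + d); first by lra.
  by rewrite in_itv /= => /andP[r1 r2]; exists r; rewrite ltr_norml; apply/andP; split; lra.
exists (\poly_(i < n) r i).
rewrite /rat_combination (@combinationE u n)// (@combinationE u n); last first.
  by rewrite (leq_trans (size_poly _ _))// (leq_trans _ (size_poly n r)) ?size_map_poly//.
rewrite -sumrB (le_lt_trans (ler_norm_sum _ _ _))//.
apply: (@le_lt_trans _ _ (\sum_(i < n) (d * C'))).
  apply: ler_sum => i _; rewrite -scalerBl normrZ ler_pM//; last first.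
    by rewrite (le_trans (uC i))// le_max lexx.
  by rewrite coef_map coef_poly ltn_ord ltW.
rewrite sumr_const card_ord -mulr_natr /d invfM !mulrA mulfVK ?gt_eqF//.
rewrite -mulrA gtr_pMr//  mulrC ltr_pdivrMr ?ltr0n// mul1r ltr_nat ltnS.
by [].
Qed.

Lemma subrACA (V : zmodType) (x y z t : V) :
  (x - y) - (z - t) = (x - z) - (y - t).
Proof. by rewrite !opprB addrACA [RHS]addrACA [- y - z]addrC. Qed.

(** A weak limit lies in the norm closure of the span, since otherwise a functional vanishing on the
    span would separate it. *)
Lemma ultra_limit_closure (u v : nat -> W) (U : set_system nat) w (d : R) :
  ProperFilter U -> (forall f, f (v j) @[j --> U] --> f w) ->
  (forall j, exists i, v j = u i) -> 0 < d ->
  exists P, `|w - combination u P| < d.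
Proof.
move=> PU wP vu d0; apply: contrapT => /forallNP nP.
have [||||f [fY fw]] := @dual_separation _ _ (range (combination u)) w d d0.
- by exists 0 => //; rewrite -(scale0r 0) combinationZ scale0r.
- by move=> _ _ [P _ <-] [Q _ <-]; exists (P + Q); rewrite ?combinationD.
- by move=> a _ [P _ <-]; exists (a *: P); rewrite ?combinationZ.
- by move=> _ [P _ <-]; rewrite leNgt; apply/negP/nP.
move/eqP: fw; apply; apply: (cvg_unique _ (wP f)) => //.
rewrite (_ : (fun j => f (v j)) = fun=> 0); first exact: cvg_cst.
apply/funext => j; have [i ->] := vu j; apply: fY.
by exists 'X^i => //; exact: combinationX.
Qed.

(* A subsequence along which countably many functionals, norming for the closed
   span of the sequence, converge has a single weak cluster point. *)
Lemma weak_subsequence (u : nat -> W) (C : R) : (forall j, `|u j| <= C) ->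
  exists n : nat -> nat, {homo n : i j / (i < j)%N} /\
    exists w, weak_cvg (u \o n) w.
Proof.
move=> uC; have [U UU ooU] := @ultra_extends \oo _.
have PU : ProperFilter U by exact: ultra_proper.
have [w wP] := ultra_weak_limit uC UU.
pose D k := rat_combination u (odflt 0 (unpickle k)).
have /choice[g gP] (k : nat) : exists f, (forall v, `|f v| <= `|v|) /\ f (D k) = `|D k|.
  exact: dual_norming.
(* Diagonal choice: the j-th index exceeds the preceding one and brings the first j norming
   functionals within 1/(j + 1) of their values at [w]. *)
have pick (j N : nat) : exists i, (N < i)%N /\
    forall k, (k < j)%N -> `|g k w - g k (u i)| < j.+1%:R^-1.
  suff : U [set i | (N < i)%N /\ forall k, (k < j)%N -> `|g k w - g k (u i)| < j.+1%:R^-1].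
    by move=> /filter_ex[i iP]; exists i.
  apply: filterI; first by apply: ooU; exact: nbhs_infty_gt.
  have : forall k : 'I_j, U [set i | `|g k w - g k (u i)| < j.+1%:R^-1].
    by move=> k; have /cvgrPdist_lt := wP (g k); apply; rewrite invr_gt0 ltr0n.
  move=> /(@filter_forall _ _ _ U _); apply: (@filterS _ U) => i iP k kj.
  exact: (iP (Ordinal kj)).
have /choice[pk pkP] (jN : nat * nat) := pick jN.1 jN.2.
pose n := fix n j := if j is j'.+1 then pk (j, n j') else pk (0, 0)%N.
have nS j : (n j < n j.+1)%N by exact: (pkP (j.+1, n j)).1.
have nP j k : (k < j)%N -> `|g k w - g k (u (n j))| < j.+1%:R^-1.
  by case: j => // j kj; exact: (pkP (j.+1, n j)).2.
have n_homo : {homo n : i j / (i < j)%N} by exact: homo_ltn ltn_trans _.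
exists n; split => //; exists w => f; apply: contrapT => nf.
(* If [f] fails to converge, an ultrafilter on the bad indices gives a second limit [w'], which [f]
   distinguishes from [w] but no [g k] does. *)
have [e e0 eP] : exists2 e : R, 0 < e &
    forall N, exists2 j, (N <= j)%N & e <= `|f w - f (u (n j))|.
  apply: contrapT => nE; apply: nf; apply/cvgrPdist_lt => e e0.
  have [N NP] : exists N, forall j, (N <= j)%N -> `|f w - f (u (n j))| < e.
    apply: contrapT => nN; apply: nE; exists e => // N; apply: contrapT => nj.
    apply: nN; exists N => j Nj; rewrite ltNge; apply/negP => ej.
    by apply: nj; exists j.
  by exists N.
pose E := [set j | e <= `|f w - f (u (n j))|].
pose F := within E \oo.
have PF : ProperFilter F.
  have FF : Filter F by exact: within_filter.
  apply: Build_ProperFilter_ex.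
  by move=> P [N _ NP]; have [j Nj jE] := eP N; exists j; exact: NP.
have [V UV FV] := ultra_extends PF.
have ooV : \oo `<=` V.
  by move=> A [N _ NA]; apply: FV; exists N => // j /NA Aj _.
have PV : ProperFilter V by exact: ultra_proper.
have [w' w'P] := @ultra_weak_limit (u \o n) C V (fun j => uC (n j)) UV.
have fw' : e <= `|f w - f w'|.
  have h : `|f w - f (u (n j))| @[j --> V] --> `|f w - f w'|.
    by apply: cvg_norm; apply: (@cvgB _ R^o); [exact: cvg_cst|exact: w'P].
  apply: (cvgr_to_ge h); apply: FV.
  by exists 0%N => // j _; exact.
have gw k : g k w' = g k w.
  have h : (g k (u (n j)) : R^o) @[j --> \oo] --> (g k w : R^o).
    apply/cvgrPdist_lt => d d0.
    pose N := maxn k.+1 (Num.truncn d^-1).+1.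
    exists N => // j /= Nj; rewrite (lt_le_trans (nP j k _))//.
      by rewrite (leq_trans _ Nj)// leq_maxl.
    rewrite invf_ple ?posrE ?ltr0n// (le_trans (ltW (truncnS_gt _)))// ler_nat.
    by rewrite (leq_trans _ (leqnSn j))// (leq_trans _ Nj)// leq_maxr.
  by apply: (cvg_unique _ (w'P (g k))) => // A /h; exact: ooV.
(* The difference lies in the closed span, hence near some [D k], whose norm is seen by [g k]. Three
   errors d/6 place it within d/2 of [D k], and this bound is used twice. *)
have : w - w' = 0.
  apply/eqP; rewrite -normr_le0; apply/ler_addgt0Pr => d d0; rewrite add0r.
  have d60 : 0 < d / 6 by rewrite divr_gt0.
  have [P1 hP1] := @ultra_limit_closure u u U w (d / 6) PU wP (fun j => ex_intro _ j erefl) d60.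
  have [P2 hP2] := @ultra_limit_closure u (u \o n) V w' (d / 6) PV w'P
    (fun j => ex_intro _ (n j) erefl) d60.
  have [Q hQ] := @rat_combination_dense u C (P1 - P2) (d / 6) uC d60.
  pose k := pickle Q; have Dk : D k = rat_combination u Q by rewrite /D pickleK.
  have hD : `|D k - (w - w')| <= d / 2.
    rewrite distrC Dk; set q := rat_combination u Q in hQ *.
    have -> : w - w' - q = (w - combination u P1) - (w' - combination u P2) +
        (combination u (P1 - P2) - q).
      by rewrite combinationB subrACA addrA subrK.
    rewrite (le_trans (ler_normD _ _))// (le_trans (lerD (ler_normB _ _) (lexx _)))//.
    by lra.
  have Dle : `|D k| <= d / 2.
    have gz : g k (w - w') = 0 by rewrite dualB gw subrr.
    rewrite -(gP k).2 -[g k (D k)]subr0 -gz -dualB.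
    by apply: le_trans hD; apply: le_trans (ler_norm _) ((gP k).1 _).
  rewrite -[w - w'](subKr (D k)) (le_trans (ler_normB _ _))//.
  by lra.
move=> /eqP; rewrite subr_eq0 => /eqP ww'.
by move: fw'; rewrite ww' subrr normr0 leNgt e0.
Qed.

End weak_sequential_compactness.

Lemma homo_ltn_ge (n : nat -> nat) j : {homo n : i j / (i < j)%N} -> (j <= n j)%N.
Proof.
by move=> nh; elim: j => // j ih; exact: leq_ltn_trans ih (nh _ _ (ltnSn j)).
Qed.

Lemma cvg_subseq (T : Type) (F : set_system T) (u : nat -> T) (n : nat -> nat) :
  {homo n : i j / (i < j)%N} -> u j @[j --> \oo] `=>` F ->
  u (n j) @[j --> \oo] `=>` F.
Proof.
move=> nh uF A /uF[N _ NA]; exists N => // j Nj; apply: NA => /=.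
exact: leq_trans Nj (homo_ltn_ge _ nh).
Qed.

(** * Potentials *)

Section potentials.
Context {R : realType} {W : normedModType R}.
Implicit Types (p : W -> dual W) (u v w : W) (t : R).

Lemma dual_cvg (T : Type) (F : set_system T) (q : T -> dual W) (a : dual W)
    (u : T -> W) v : Filter F -> q t @[t --> F] --> a -> u t @[t --> F] --> v ->
  (q t (u t) : R^o) @[t --> F] --> (a v : R^o).
Proof.
move=> FF qa uv.
have h1 : (q t (u t) - a (u t) : R^o) @[t --> F] --> (0 : R^o).
  apply: (@dual_cvg0 _ _ _ F q a u (`|v| + 1)) => //.
  by apply: cvgr_norm_le uv _ _; rewrite ltrDl.
have h2 : (a (u t) : R^o) @[t --> F] --> (a v : R^o).
  exact: (cvg_comp _ _ uv (@dual_continuous _ _ a v)).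
rewrite -[a v](@add0r R^o).
rewrite (_ : (fun x => _) = fun x => (q x (u x) - a (u x)) + a (u x)); last first.
  by apply/funext => x; rewrite subrK.
exact: cvgD h1 h2.
Qed.

Lemma is_diff_line (P : W -> R^o) p u v t :
  (forall w, is_diff w P (p w : W -> R^o)) ->
  is_derive t (1 : R) (fun s : R => P (u + s *: v)) (p (u + t *: v) v).
Proof.
move=> dP.
have dl : is_diff t (fun s : R => u + s *: v) (fun s : R => s *: v).
  have h := is_diffD (is_diff_cst u t) (is_diff_scalel t v).
  by apply: is_diff_eq h _; exact: add0r.
have dc := @is_diff_comp _ _ _ _ _ _ _ _ t dl (dP _).
have [df dE] := dc.
split; first by apply/derivable1_diffP; exact: df.
by rewrite (deriveE _ df) dE /= scale1r.
Qed.

Lemma potential_primitive p (P : W -> R^o) : continuous p ->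
  (forall w, is_diff w P (p w : W -> R^o)) -> forall u, potential p u = P u - P 0.
Proof.
move=> cp dP u.
have dPl t : is_derive t (1 : R) (fun s : R => P (s *: u)) (p (t *: u) u).
  have := is_diff_line 0 u t dP.
  rewrite add0r (_ : (fun s => P (0 + s *: u)) = fun s => P (s *: u))//.
  by apply/funext => s; rewrite add0r.
have cF t : {for t, continuous (fun s : R => P (s *: u))}.
  by apply: differentiable_continuous; apply/derivable1_diffP; have [] := dPl t.
rewrite /potential /Rintegral.
rewrite (@continuous_FTC2 R _ (fun t : R => P (t *: u)) 0 1)//.
- by rewrite /= scale1r scale0r.
- apply: continuous_subspaceT => t.
  apply: (@dual_cvg _ (nbhs t) (fun s : R => p (s *: u)) _ (fun=> u)); last exact: cvg_cst.
  have h : s *: u @[s --> t] --> t *: u by apply: cvgZr_tmp; exact: cvg_id.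
  exact: cvg_comp h (cp _).
- split=> [t _||]; first by have [] := dPl t.
    by apply: cvg_at_right_filter; exact: cF.
  by apply: cvg_at_left_filter; exact: cF.
- by move=> t _; rewrite derive1E; have [_ ->] := dPl t.
Qed.

Section one_potential.
Variable p : W -> dual W.
Hypothesis pp : potential_operator p.

Lemma potential_is_diff u : is_diff u (potential p : W -> R^o) (p u : W -> R^o).
Proof.
have [cp [P dP]] := pp.
have -> : (potential p : W -> R^o) = P - cst (P 0).
  by apply/funext => v; rewrite (potential_primitive cp dP).
by apply: is_diff_eq; exact: subr0.
Qed.

Lemma potential_derive u v t :
  is_derive t (1 : R) (fun s : R => potential p (u + s *: v)) (p (u + t *: v) v).
Proof. by apply: is_diff_line => w; exact: potential_is_diff. Qed.

Lemma potential_continuous : continuous (potential p : W -> R^o).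
Proof.
by move=> u; apply: differentiable_continuous; have [] := potential_is_diff u.
Qed.

Lemma potential0 : potential p 0 = 0.
Proof.
by have [cp [P dP]] := pp; rewrite (potential_primitive cp dP) subrr.
Qed.

Lemma potential_mvt u v : exists2 t : R, 0 < t < 1 &
  potential p (u + v) - potential p u = p (u + t *: v) v.
Proof.
have [||t] := @MVT R (fun s => potential p (u + s *: v)) (fun s => p (u + s *: v) v) 0 1 ltr01.
- by move=> t _; exact: potential_derive.
- apply: derivable_within_continuous => t _.
  by have [] := potential_derive u v t.
by rewrite in_itv /= => t01; rewrite scale1r scale0r addr0 subr0 mulr1; exists t.
Qed.

Lemma potential_scale u : exists2 t : R, 0 < t < 1 & potential p u = p (t *: u) u.
Proof.
have [t t01] := potential_mvt 0 u.
by rewrite !add0r potential0 subr0; exists t.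
Qed.

Lemma potential_gt0 : (forall u, u != 0 -> 0 < p u u) ->
  forall u, u != 0 -> 0 < potential p u.
Proof.
move=> p0 u u0; have [t /andP[t0 t1] ->] := potential_scale u.
have := p0 (t *: u); rewrite scaler_eq0 (gt_eqF t0) (negbTE u0) => /(_ isT).
by rewrite dual_scale pmulr_rgt0.
Qed.

Lemma potentialN : odd_operator p -> forall u, potential p (- u) = potential p u.
Proof.
move=> op u; rewrite /potential; congr (fine _); apply: eq_integral => t _.
by rewrite scalerN op dual_oppE dualN opprK.
Qed.

Lemma potential_homogeneous s sc a : is_scaling s sc -> homogeneous sc a p ->
  forall u t, 0 <= t -> potential p (sc u t) = t `^ a * potential p u.
Proof.
move=> S hp u t t0; rewrite /potential -RintegralZl//.
  apply: eq_Rintegral => x; rewrite inE /= in_itv /= => /andP[x0 _].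
  by rewrite -(scalingZ S)// hp.
apply: continuous_compact_integrable; first exact: segment_compact.
apply: continuous_subspaceT => x.
apply: (@dual_cvg _ (nbhs x) (fun s : R => p (s *: u)) _ (fun=> u)); last exact: cvg_cst.
have h : s *: u @[s --> x] --> x *: u by apply: cvgZr_tmp; exact: cvg_id.
exact: cvg_comp h (pp.1 _).
Qed.

Lemma weak_segment (u : nat -> W) w (th : nat -> R) : (forall j, 0 < th j < 1) ->
  weak_cvg u w -> weak_cvg (fun j => w + th j *: (u j - w)) w.
Proof.
move=> th01 uw f; apply/cvgrPdist_lt => e e0.
have /cvgrPdist_lt /(_ e e0) := uw f; apply: filterS => j.
rewrite dualD dual_scale dualB opprD addrA subrr sub0r normrN normrM distrC => h.
have /andP[t0 t1] := th01 j.
by rewrite (le_lt_trans _ h)// ler_piMl// ger0_norm ltW.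
Qed.

(** By the mean value theorem the increment is [p] at a point of the segment from [w] to [u j],
    applied to [u j - w]. These points still converge weakly to [w], so [p] converges in norm along
    them. *)
Lemma potential_weak_continuous : weak_to_strong p ->
  forall (u : nat -> W) w (C : R), (forall j, `|u j| <= C) -> weak_cvg u w ->
  potential p (u j) @[j --> \oo] --> potential p w.
Proof.
move=> wp u w C uC uw.
have /choice[th thP] j : exists t, 0 < t < 1 /\
    potential p (u j) = potential p w + p (w + t *: (u j - w)) (u j - w).
  have [t t01 h] := potential_mvt w (u j - w); exists t; split => //.
  by rewrite -h addrC subrK addrC subrK.
have th01 j : 0 < th j < 1 by have [] := thP j.
have pc := wp _ _ (weak_segment th01 uw).
have h1 : (p (w + th j *: (u j - w)) (u j - w) - p w (u j - w) : R^o) @[j --> \oo] --> (0 : R^o).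
  apply: (@dual_cvg0 _ _ _ \oo _ _ _ (C + `|w|) _ pc).
  by apply: nearW => j; rewrite (le_trans (ler_normB _ _))// lerD2r.
have h2 : (p w (u j - w) : R^o) @[j --> \oo] --> (0 : R^o).
  rewrite (_ : (fun j => _) = fun j => p w (u j) - p w w); last first.
    by apply/funext => j; rewrite dualB.
  have h : (p w (u j) - p w w : R^o) @[j --> \oo] --> (p w w - p w w : R^o).
    by apply: cvgB; [exact: uw|exact: cvg_cst].
  by rewrite subrr in h.
rewrite -[potential p w](@addr0 R^o) -[X in _ + X](@addr0 R^o).
rewrite (_ : (fun j => _) = fun j => potential p w +
  ((p (w + th j *: (u j - w)) (u j - w) - p w (u j - w)) + p w (u j - w))).
  by apply: cvgD; [exact: cvg_cst|exact: cvgD h1 h2].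
by apply/funext => j; rewrite subrK; exact: (thP j).2.
Qed.

End one_potential.
End potentials.

(** * Continuous selection and deformation *)

Section selection.
Context {R : realType} {W : normedModType R}.
Variables (X : set W) (rho : W -> R) (dir : W -> W).
Hypothesis rho_gt0 : forall a, X a -> 0 < rho a.
Hypothesis dir1 : forall a, X a -> `|dir a| <= 1.
Hypothesis X_open : open X.
Implicit Types (x y z a : W) (n : nat).

(** [al x] is the least centre, for a well-ordering of the space, whose ball contains [x]. If [x]
    and [y] each lay in the ball assigned to the other, both centres would be least and hence
    equal. *)
Lemma least_index : exists al : W -> W, forall x, X x ->
  [/\ X (al x), `|x - al x| < rho (al x) &
      forall y, X y -> al x <> al y ->
        rho (al x) <= `|y - al x| \/ rho (al y) <= `|x - al y|].
Proof.
have [le leP] := @wochoice.well_ordering_principle W.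
pose C x := [set a | X a /\ `|x - a| < rho a].
have minP x : exists a, X x -> C x a /\ forall b, C x b -> le a b.
  have [Xx|nX] := pselect (X x); last by exists x.
  have [|a [[aC amin] _]] := leP (mem (C x)).
    by exists x; apply/mem_set; split=> //; rewrite subrr normr0; exact: rho_gt0.
  exists a => _; split; first exact: set_mem.
  by move=> b /mem_set /amin.
have /choice[al alP] := minP; exists al => x Xx.
have [[Xa xa] amin] := alP x Xx; split=> // y Xy ne.
have [[Xb yb] bmin] := alP y Xy.
apply: contrapT => /not_orP[/negP h1 /negP h2]; rewrite -!ltNge in h1 h2.
have ab : le (al x) (al y) by exact: amin.
have ba : le (al y) (al x) by exact: bmin.
have aa : le (al x) (al x) by exact: amin.
have bb : le (al y) (al y) by exact: bmin.
have [|z [_ zu]] := leP (pred2 (al x) (al y)); first by exists (al x); rewrite inE /= eqxx.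
apply: ne; rewrite -(zu (al x)); last first.
  by split=> [|c]; rewrite ?inE ?eqxx// => /orP[]/eqP ->.
rewrite -(zu (al y))//.
by split=> [|c]; rewrite ?inE ?eqxx ?orbT// => /orP[]/eqP ->.
Qed.

Definition delta n : R := n.+1%:R^-1.

Lemma delta_gt0 n : 0 < delta n.
Proof. by rewrite invr_gt0 ltr0n. Qed.

Let al := projT1 (cid least_index).

Let alP x : X x -> [/\ X (al x), `|x - al x| < rho (al x) &
      forall y, X y -> al x <> al y ->
        rho (al x) <= `|y - al x| \/ rho (al y) <= `|x - al y|].
Proof. exact: (projT2 (cid least_index)). Qed.

(** Points inside their assigned ball with margin [3 * delta n]. The factor 3 keeps the
    [delta n]-neighbourhoods of cores with different centres at distance at least [delta n]. *)
Definition core n : set W :=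
  [set z | X z /\ `|z - al z| + 3 * delta n <= rho (al z)].

Lemma core_separated n z z' : core n z -> core n z' ->
  `|z - z'| < 3 * delta n -> al z = al z'.
Proof.
move=> [Xz hz] [Xz' hz'] zz'; apply: contrapT => ne.
have [_ _ /(_ z' Xz' ne)[h|h]] := alP Xz.
  have := ler_normD (z - al z) (z' - z); rewrite addrC subrKA [`|z' - z|]distrC.
  by lra.
have := ler_normD (z' - al z') (z - z'); rewrite addrC subrKA; lra.
Qed.

Definition bump n x : R :=
  sup [set r | r = 0 \/ exists2 z, core n z & r = delta n - `|x - z|].

Let bumpset n x : set R :=
  [set r | r = 0 \/ exists2 z, core n z & r = delta n - `|x - z|].

Lemma bump_has_sup n x : has_sup (bumpset n x).
Proof.
split; first by exists 0; left.
exists (delta n) => _ [->|[z _ ->]]; first exact/ltW/delta_gt0.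
by rewrite gerBl.
Qed.

Lemma bump_ge0 n x : 0 <= bump n x.
Proof. by apply: (ub_le_sup (bump_has_sup n x).2); left. Qed.

Lemma bump_ge n x z : core n z -> delta n - `|x - z| <= bump n x.
Proof. by move=> cz; apply: (ub_le_sup (bump_has_sup n x).2); right; exists z. Qed.

Lemma bump_le_delta n x : bump n x <= delta n.
Proof.
apply: ge_sup; first exact: (bump_has_sup n x).1.
move=> _ [->|[z _ ->]]; first exact/ltW/delta_gt0.
by rewrite gerBl.
Qed.

Lemma bump_gt0 n x : 0 < bump n x -> exists2 z, core n z & `|x - z| < delta n.
Proof.
move=> b0; have [r [->|[z cz ->]]] := sup_adherent b0 (bump_has_sup n x).
  by rewrite -/(bump n x) subrr ltxx.
by rewrite -/(bump n x) subrr subr_gt0; exists z.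
Qed.

Lemma bump_lipschitz n x y : `|bump n x - bump n y| <= `|x - y|.
Proof.
have half u w : bump n u <= bump n w + `|u - w|.
  apply: ge_sup; first exact: (bump_has_sup n u).1.
  move=> _ [->|[z cz ->]]; first by rewrite addr_ge0 ?bump_ge0.
  have := bump_ge w cz; have := ler_normD (w - u) (u - z).
  by rewrite subrKA [`|w - u|]distrC; lra.
have h1 := half x y; have h2 := half y x; rewrite distrC in h2.
by rewrite ler_norml; apply/andP; split; lra.
Qed.

Lemma bump_continuous n : continuous (bump n).
Proof.
move=> x; apply/cvgrPdist_lt => e e0.
have : \forall y \near x, `|x - y| < e.
  exact: (@cvgr_dist_lt _ _ _ _ _ id x cvg_id).
by apply: filterS => y; exact: le_lt_trans (bump_lipschitz n x y).
Qed.

Let base n x : W := xget 0 [set z | core n z /\ `|x - z| < delta n].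

Let baseP n x : 0 < bump n x -> core n (base n x) /\ `|x - base n x| < delta n.
Proof.
move=> /bump_gt0[z cz xz]; apply: (xgetPex 0 (P := [set z | core n z /\ `|x - z| < delta n])).
by exists z.
Qed.

Definition local_dir n x := dir (al (base n x)).

Lemma local_dir_const n x y : 0 < bump n x -> 0 < bump n y ->
  `|x - y| < delta n -> local_dir n x = local_dir n y.
Proof.
move=> /baseP[cx xd] /baseP[cy yd] xy; congr dir; apply: core_separated cx cy _.
have := ler_normD (base n x - x) (x - y); rewrite subrKA.
have := ler_normD (base n x - y) (y - base n y); rewrite subrKA.
by rewrite [`|base n x - x|]distrC; lra.
Qed.

Lemma local_dirP n x : 0 < bump n x -> exists2 a, X a /\ `|x - a| < rho a &
  local_dir n x = dir a.
Proof.
move=> /baseP[[Xb hb] xb]; have [Xa _ _] := alP Xb.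
exists (al (base n x)) => //; split=> //.
have := ler_normD (x - base n x) (base n x - al (base n x)); rewrite subrKA.
by have := delta_gt0 n; lra.
Qed.

Lemma bump_cover x : X x -> exists n, 0 < bump n x.
Proof.
move=> Xx; have [Xa xa _] := alP Xx.
pose d := (rho (al x) - `|x - al x|) / 3.
have d0 : 0 < d by rewrite divr_gt0// subr_gt0.
exists (Num.truncn d^-1); have hd : delta (Num.truncn d^-1) <= d.
  by rewrite /delta invf_ple ?posrE// ltW// truncnS_gt.
have cx : core (Num.truncn d^-1) x by split => //; rewrite /d in hd; lra.
by apply: lt_le_trans (bump_ge x cx); rewrite subrr normr0 subr0 delta_gt0.
Qed.

(* Cutting [bump n] off where the earlier bumps are not small makes the family
   locally finite. *)
Definition weight n x : R :=
  Num.max 0 (bump n x - n%:R * \sum_(m < n) bump m x).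

Lemma weight_ge0 n x : 0 <= weight n x.
Proof. by rewrite le_max lexx. Qed.

Lemma weight_le n x : weight n x <= bump n x.
Proof.
rewrite ge_max bump_ge0 gerBl mulr_ge0// sumr_ge0// => m _; exact: bump_ge0.
Qed.

Lemma weight_continuous n : continuous (weight n).
Proof.
move=> x; have c : bump n y - n%:R * \sum_(m < n) bump m y @[y --> x] -->
    bump n x - n%:R * \sum_(m < n) bump m x.
  apply: cvgB; first exact: bump_continuous.
  apply: cvgM; first exact: cvg_cst.
  by apply: continuous_sum_fun => m; exact: bump_continuous.
rewrite /weight; apply: (@continuous_max _ _ (fun=> 0) _ x) => //; exact: cvg_cst.
Qed.

(** Near [x] some bump of index m exceeds c > 0. For n > m with n >= 1/c the amount cut off is at
    least n c >= 1, which is more than [bump n] can reach. *)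
Lemma weight_locally_finite x : X x -> exists N, \forall y \near x,
  forall n, (N <= n)%N -> weight n y = 0.
Proof.
move=> /bump_cover[m bm]; pose c := bump m x / 2.
have c0 : 0 < c by rewrite divr_gt0.
exists (maxn m.+1 (Num.truncn c^-1).+1).
have : \forall y \near x, c < bump m y.
  by apply: cvgr_gt (@bump_continuous m x) _ _; rewrite /c ltr_pdivrMr// ltr_pMr// ltr1n.
apply: filterS => y cy n; rewrite geq_max => /andP[mn Nn].
apply/eqP; rewrite /weight eq_sym -[_ == _]/(0 == Num.max _ _).
apply/eqP; symmetry; apply/max_idPl; rewrite subr_le0.
apply: (le_trans (bump_le_delta n y)).
have d1 : delta n <= 1 by rewrite invf_le1 ?ltr0n// ler1n.
apply: (le_trans d1); apply: (@le_trans _ _ (n%:R * c)).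
  rewrite -ler_pdivrMr// mul1r (le_trans (ltW (truncnS_gt _)))// ler_nat//.
rewrite ler_wpM2l// (le_trans (ltW cy))// (bigD1 (Ordinal mn))//= lerDl.
by apply: sumr_ge0 => i _; exact: bump_ge0.
Qed.

(** At the least index with a positive bump nothing is cut off. *)
Lemma weight_cover x : X x -> exists n, 0 < weight n x.
Proof.
move=> /bump_cover ex; have [n bn nmin] := ex_minnP ex; exists n.
rewrite /weight big1 ?mulr0 ?subr0; first by rewrite lt_max bn orbT.
move=> m _; apply/eqP; rewrite eq_le bump_ge0 andbT leNgt; apply/negP => bm.
by have := nmin _ bm; rewrite leqNgt ltn_ord.
Qed.

Lemma weighted_dir_continuous n x : {for x, continuous (fun y => weight n y *: local_dir n y)}.
Proof.
have wc := @weight_continuous n x.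
have [b0|b0] := ltP 0 (bump n x).
  have h : (weight n y *: local_dir n x) @[y --> x] --> weight n x *: local_dir n x.
    by apply: cvgZr_tmp.
  rewrite /continuous_at; move: h; apply: cvg_trans; apply: near_eq_cvg.
  near=> y; have [by0|by0] := ltP 0 (bump n y).
    congr (_ *: _); apply: local_dir_const => //.
    by near: y; apply: cvgr_dist_lt => //; exact: delta_gt0.
  have -> : weight n y = 0.
    by apply/eqP; rewrite eq_le weight_ge0 andbT (le_trans (weight_le n y)).
  by rewrite !scale0r.
have w0 : weight n x = 0.
  by apply/eqP; rewrite eq_le weight_ge0 andbT (le_trans (weight_le n x)).
have {}wc : weight n y @[y --> x] --> (0 : R) by rewrite -w0.
rewrite /prop_for /continuous_at w0 scale0r.
apply/cvgr0Pnorm_lt => e e0; near=> y.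
have wy : weight n y < e by near: y; apply: cvgr_lt wc _ _.
have [by0|by0] := ltP 0 (bump n y); last first.
  have -> : weight n y = 0.
    by apply/eqP; rewrite eq_le weight_ge0 andbT (le_trans (weight_le n y)).
  by rewrite scale0r normr0.
have [a [Xa _] ->] := local_dirP by0.
rewrite normrZ ger0_norm ?weight_ge0// (le_lt_trans _ wy)// ler_piMr ?weight_ge0//.
exact: dir1.
Unshelve. all: by end_near. Qed.

(** The field is a weighted mean of the directions [dir a] over centres whose balls contain [x]. The
    last clause expresses this convexity: linear inequalities satisfied by these directions pass to
    the mean. *)
Lemma continuous_selection : exists V : W -> W,
  [/\ forall x, X x -> {for x, continuous V},
      forall x, X x -> `|V x| <= 1 &
      forall x (f : dual W) (b : R), X x ->
        (forall a, X a -> `|x - a| < rho a -> f (dir a) <= b) -> f (V x) <= b].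
Proof.
have /choice[N NP] x : exists N, X x -> \forall y \near x,
    forall n, (N <= n)%N -> weight n y = 0.
  have [/weight_locally_finite[N NP]|nX] := pselect (X x); first by exists N.
  by exists 0%N.
pose tot N x := \sum_(n < N) weight n x.
pose vec N x := \sum_(n < N) weight n x *: local_dir n x.
(* The number of summands depends on [x], but near each point a fixed number gives the same value,
   whence continuity. *)
pose V x := (tot (N x) x)^-1 *: vec (N x) x.
have VE x y M : X x -> X y -> (forall n, (M <= n)%N -> weight n y = 0) ->
    V y = (tot M y)^-1 *: vec M y.
  move=> Xx Xy M0; have N0 := nbhs_singleton (NP y Xy).
  have E K L : (forall n, (K <= n)%N -> weight n y = 0) ->
      tot K y = tot (maxn K L) y /\ vec K y = vec (maxn K L) y.
    move=> K0; split.
      rewrite /tot (big_ord_widen _ (fun n => weight n y) (leq_maxl K L)) big_mkcond /=.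
      by apply: eq_bigr => i _; case: ltnP => // /K0 ->.
    rewrite /vec (big_ord_widen _ (fun n => weight n y *: local_dir n y) (leq_maxl K L)).
    rewrite big_mkcond /=.
    by apply: eq_bigr => i _; case: ltnP => // /K0 ->; rewrite scale0r.
  have [t1 v1] := E (N y) M N0; have [t2 v2] := E M (N y) M0.
  by rewrite /V t1 v1 t2 v2 maxnC.
have tot_gt0 x : X x -> 0 < tot (N x) x.
  move=> Xx; have [n wn] := weight_cover Xx.
  have nN : (n < N x)%N.
    by rewrite ltnNge; apply/negP => /(nbhs_singleton (NP x Xx)) w0; rewrite w0 ltxx in wn.
  rewrite /tot (bigD1 (Ordinal nN))//= ltr_pwDl// sumr_ge0// => m _; exact: weight_ge0.
exists V; split=> [x Xx|x Xx|x f b Xx fb].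
- have h : ((tot (N x) y)^-1 *: vec (N x) y) @[y --> x] --> V x.
    apply: cvgZ.
      apply: cvgV; first by rewrite gt_eqF// tot_gt0.
      by apply: continuous_sum_fun => n; exact: weight_continuous.
    by apply: continuous_sum_fun => n; exact: weighted_dir_continuous.
  have Vx : (tot (N x) y)^-1 *: vec (N x) y @[y --> x] --> V x := h.
  rewrite /prop_for /continuous_at; move: Vx; apply: cvg_trans; apply: near_eq_cvg.
  have Xn : \forall y \near x, X y by exact: open_nbhs_nbhs.
  by move: (NP x Xx) Xn; apply: filterS2 => y h0 Xy; rewrite (VE x y (N x)).
- rewrite /V normrZ normfV gtr0_norm ?tot_gt0// mulrC ler_pdivrMr ?tot_gt0// mul1r.
  rewrite (le_trans (ler_norm_sum _ _ _))// ler_sum// => n _.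
  rewrite normrZ ger0_norm ?weight_ge0//.
  have [b0|b0] := ltP 0 (bump n x); last first.
    have -> : weight n x = 0.
      by apply/eqP; rewrite eq_le weight_ge0 andbT (le_trans (weight_le n x)).
    by rewrite mul0r.
  have [a [Xa _] ->] := local_dirP b0.
  by rewrite ler_piMr ?weight_ge0//; exact: dir1.
rewrite /V dual_scale mulrC ler_pdivrMr ?tot_gt0//.
have -> : f (vec (N x) x) = \sum_(n < N x) weight n x * f (local_dir n x).
  rewrite /vec; elim: (N x) => [|M ih]; first by rewrite !big_ord0 dual0.
  by rewrite !big_ord_recr /= dualD ih dual_scale.
rewrite mulr_sumr ler_sum// => n _.
have [b0|b0] := ltP 0 (bump n x); last first.
  have -> : weight n x = 0.
    by apply/eqP; rewrite eq_le weight_ge0 andbT (le_trans (weight_le n x)).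
  by rewrite mul0r mulr0.
have [a [Xa xa] ->] := local_dirP b0.
by rewrite mulrC ler_wpM2r ?weight_ge0//; exact: fb.
Qed.

End selection.

Section good_radius.
Context {R : realType} {W : normedModType R}.
Variable Q : W -> R -> Prop.
Hypothesis Q_antitone : forall z a b, 0 < a <= b -> Q z b -> Q z a.
Implicit Types (x y z : W) (a b : R).

Definition good_radii x : set R :=
  [set a | 0 <= a <= 1 /\ forall z, `|x - z| < a -> Q z a].

(** For antitone [Q] this supremum is 1-Lipschitz in [x]: a continuous choice of step length out of
    a merely local condition. *)
Definition good_radius x := sup (good_radii x).

Lemma good_radii_has_sup x : has_sup (good_radii x).
Proof.
split; last by exists 1 => a [/andP[]].
by exists 0; split; [rewrite lexx ler01|move=> z; rewrite ltNge normr_ge0].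
Qed.

Lemma good_radius_ge0 x : 0 <= good_radius x.
Proof.
apply: (ub_le_sup (good_radii_has_sup x).2).
by split; [rewrite lexx ler01|move=> z; rewrite ltNge normr_ge0].
Qed.

Lemma good_radius_lt x a : 0 < a < good_radius x ->
  forall z, `|x - z| < a -> Q z a.
Proof.
move=> /andP[a0 ax] z xz.
have d0 : 0 < good_radius x - a by rewrite subr_gt0.
have [b [/andP[b0 b1] bQ]] := sup_adherent d0 (good_radii_has_sup x).
rewrite -/(good_radius x) => hb; have ab : a < b by lra.
by apply: (@Q_antitone z a b); [rewrite a0 ltW|apply: bQ; exact: lt_trans ab].
Qed.

Lemma good_radius_half x : 0 < good_radius x -> Q x (good_radius x / 2).
Proof.
move=> r0; apply: (@good_radius_lt x); last by rewrite subrr normr0; lra.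
by apply/andP; split; lra.
Qed.

Lemma good_radius_gt0 x b : 0 < b -> (forall z, `|x - z| < b -> Q z b) ->
  0 < good_radius x.
Proof.
move=> b0 bQ; apply: (@lt_le_trans _ _ (Num.min b 1)); first by rewrite lt_min b0 ltr01.
apply: (ub_le_sup (good_radii_has_sup x).2); split.
  by rewrite le_min (ltW b0) ler01 ge_min lexx orbT.
move=> z xz; apply: (@Q_antitone z _ b); first by rewrite lt_min b0 ltr01 ge_min lexx.
by apply: bQ; rewrite (lt_le_trans xz)// ge_min lexx.
Qed.

Lemma good_radius_lipschitz x y : `|good_radius x - good_radius y| <= `|x - y|.
Proof.
have half u v : good_radius u <= good_radius v + `|u - v|.
  apply: ge_sup; first exact: (good_radii_has_sup u).1.
  move=> a [/andP[a0 a1] aQ]; have [uv|uv] := leP a `|u - v|.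
    by rewrite (le_trans uv)// lerDr good_radius_ge0.
  rewrite -lerBlDr; apply: (ub_le_sup (good_radii_has_sup v).2); split.
    by have := normr_ge0 (u - v) => ?; apply/andP; split; lra.
  move=> z vz; apply: (@Q_antitone z _ a).
    have := normr_ge0 (u - v); have := normr_ge0 (v - z) => ? ?.
    by apply/andP; split; lra.
  by apply: aQ; have := ler_normD (u - v) (v - z); rewrite subrKA; lra.
have h1 := half x y; have h2 := half y x; rewrite distrC in h2.
by rewrite ler_norml; apply/andP; split; lra.
Qed.

Lemma good_radius_continuous : continuous good_radius.
Proof.
move=> x; apply/cvgrPdist_lt => e e0.
have : \forall y \near x, `|x - y| < e.
  exact: (@cvgr_dist_lt _ _ _ _ _ id x cvg_id).
by apply: filterS => y; exact: le_lt_trans (good_radius_lipschitz x y).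
Qed.

Lemma good_radiusN x : (forall z a, Q z a -> Q (- z) a) ->
  good_radius (- x) = good_radius x.
Proof.
move=> QN; congr sup; apply/seteqP; split => a [a01 aQ]; split=> // z xz.
  by rewrite -[z]opprK; apply/QN/aQ; rewrite -normrN opprD !opprK.
by rewrite -[z]opprK; apply/QN/aQ; rewrite -normrN opprD opprK.
Qed.

End good_radius.

(** [Q x a] says that [x] lies in some [U n] with n a <= 1. The inverse of half the good radius is
    therefore a continuous bound for such an index; the symmetry of the sets makes it even. *)
Lemma even_upper_bound {R : realType} {W : normedModType R} (U : nat -> set W) :
  (forall n, open (U n)) -> (forall n x, U n x -> U n (- x)) ->
  exists s : W -> R, [/\ forall n x, U n x -> {for x, continuous s},
    forall x, s (- x) = s x &
    forall n x, U n x -> exists2 m, m%:R <= s x & U m x].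
Proof.
move=> oU symU; pose Q x (a : R) := exists2 n, n%:R * a <= 1 & U n x.
have Qanti z a b : 0 < a <= b -> Q z b -> Q z a.
  move=> /andP[a0 ab] [n nb Un]; exists n => //.
  by rewrite (le_trans _ nb)// ler_wpM2l.
have pos n x : U n x -> 0 < good_radius Q x.
  move=> Ux; have : nbhs x (U n) by apply: open_nbhs_nbhs.
  move=> /nbhs_normP[e /= e0 eU]; apply: (@good_radius_gt0 _ _ _ Qanti x (Num.min e n.+1%:R^-1)).
    by rewrite lt_min e0 invr_gt0 ltr0n.
  move=> z xz; exists n; last by apply: eU; rewrite /= (lt_le_trans xz)// ge_min lexx.
  apply: (@le_trans _ _ (n%:R * n.+1%:R^-1)); first by rewrite ler_wpM2l// ge_min lexx orbT.
  by rewrite ler_pdivrMr ?ltr0n// mul1r ler_nat.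
exists (fun x => (good_radius Q x / 2)^-1); split.
- move=> n x /pos r0; apply: cvgV; first by rewrite gt_eqF// divr_gt0.
  by apply: cvgM; [exact: good_radius_continuous|exact: cvg_cst].
- by move=> x; rewrite good_radiusN// => z a [n na /symU Un]; exists n.
- move=> n x /pos r0; have [m mr Um] := good_radius_half Qanti r0.
  by exists m => //; rewrite -[leRHS]mul1r ler_pdivlMr// divr_gt0.
Qed.

Section deformation.
Context {R : realType} {W : completeNormedModType R}.
Variables (Y : set W) (m : W -> R) (D : W -> dual W) (a b sigma : R).
Hypothesis Y_open : open Y.
Hypothesis Y_sym : symmetric_set Y.
Hypothesis m_continuous : forall x, Y x -> {for x, continuous m}.
Hypothesis mN : forall x, m (- x) = m x.
Hypothesis D_continuous : forall x, Y x -> {for x, continuous D}.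
Hypothesis DN : forall x, D (- x) = - D x.
(* Only the upper bound: a pointwise maximum of C^1 functions inherits it without
   being known to be differentiable. *)
Hypothesis mD : forall x (e : R), Y x -> 0 < e -> exists2 d : R, 0 < d &
  forall z v (t : R), `|x - z| < d -> `|v| <= 1 -> 0 <= t <= d ->
    m (z + t *: v) <= m z + t * (D x v + e).
Hypothesis sigma_gt0 : 0 < sigma.
Hypothesis D_steep : forall x, Y x -> a < m x < b ->
  exists2 v, `|v| <= 1 & D x v <= - (4 * sigma).
Implicit Types (x y z v : W) (t : R).

Let X : set W := [set x | Y x /\ a < m x < b].

Let X_open : open X.
Proof.
rewrite openE => x [Yx /andP[ax xb]]; rewrite /interior /=.
have h1 : \forall y \near x, Y y by exact: open_nbhs_nbhs.
have h2 : \forall y \near x, a < m y by apply: cvgr_gt (m_continuous Yx) _ _.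
have h3 : \forall y \near x, m y < b by apply: cvgr_lt (m_continuous Yx) _ _.
near=> y; split; first by near: y.
by apply/andP; split; near: y.
Unshelve. all: by end_near. Qed.

(** Of the slope [4 * sigma] one [sigma] is spent on the variation of [D] over the balls of the
    partition. Antisymmetrization makes the field odd and preserves the estimate since [D] is
    odd. *)
Lemma descent_field : exists V : W -> W,
  [/\ forall x, X x -> {for x, continuous V}, forall x, X x -> `|V x| <= 1,
      forall x, V (- x) = - V x &
      forall x, X x -> D x (V x) <= - (3 * sigma)].
Proof.
have XN x : X x -> X (- x) by move=> [Yx mx]; split; [exact: Y_sym|rewrite mN].
have /choice[dir dirP] x : exists v, X x -> `|v| <= 1 /\ D x v <= - (4 * sigma).
  have [[Yx mx]|nX] := pselect (X x); last by exists 0.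
  by have [v v1 Dv] := D_steep Yx mx; exists v.
have /choice[rho rhoP] x : exists d : R, X x -> 0 < d /\
    forall y, `|y - x| < d -> `|D x - D y| < sigma.
  have [[Yx _]|nX] := pselect (X x); last by exists 0.
  have : \forall y \near x, `|D x - D y| < sigma.
    by apply: cvgr_dist_lt (D_continuous Yx) _ _.
  move=> /nbhs_normP[d /= d0 dP]; exists d => _; split => // y yx.
  by apply: dP; rewrite /= distrC.
have rho0 x : X x -> 0 < rho x by move=> /rhoP[].
have dir1 x : X x -> `|dir x| <= 1 by move=> /dirP[].
have [V [cV V1 hV]] := continuous_selection rho0 dir1 X_open.
have DV x : X x -> D x (V x) <= - (3 * sigma).
  move=> Xx; apply: hV => // y Xy xy; have [v1 Dv] := dirP y Xy.
  have [_ /(_ x xy) Dxy] := rhoP y Xy.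
  have := dual_le (D y - D x) (dir y); rewrite dual_subE => h.
  have : `|D y - D x| * `|dir y| <= sigma.
    by rewrite (le_trans _ (ltW Dxy))// ler_piMr.
  by move: h; rewrite ler_norml => /andP[? ?] ?; lra.
exists (fun x => 2^-1 *: (V x - V (- x))); split.
- move=> x Xx.
  have h : V (- y) @[y --> x] --> V (- x).
    exact: (cvg_comp _ _ (@oppr_cont _ _ x) (cV _ (XN _ Xx))).
  have h2 : V y - V (- y) @[y --> x] --> V x - V (- x) by exact: cvgB (cV _ Xx) h.
  exact: cvgZl_tmp h2.
- move=> x Xx; rewrite normrZ ger0_norm// mulrC ler_pdivrMr// mul1r.
  by rewrite (le_trans (ler_normB _ _))// -[2]/(1 + 1) lerD// V1//; exact: XN.
- by move=> x; rewrite opprK -scalerN opprB.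
- move=> x Xx; rewrite dual_scale dualB.
  have := DV _ Xx; have := DV _ (XN _ Xx); rewrite DN dual_oppE; lra.
Qed.

(* Euler steps along the descent field, of length given by the size of the ball
   on which they decrease [m]. *)
Lemma descent_step : exists U : W -> W,
  [/\ continuous U, forall x, U (- x) = - U x,
      forall x t, 0 <= t <= 1 -> (Y x -> Y (x + t *: U x)) /\
        m (x + t *: U x) <= m x - t * sigma * `|U x| &
      forall x, X x -> U x != 0].
Proof.
have [V [cV V1 VN DV]] := descent_field.
pose Q x (r : R) := X x /\ forall t, 0 <= t <= r ->
  Y (x + t *: V x) /\ m (x + t *: V x) <= m x - t * sigma.
have Qanti x r r' : 0 < r <= r' -> Q x r' -> Q x r.
  move=> /andP[r0 rr'] [Xx h]; split => // t /andP[t0 tr]; apply: h.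
  by rewrite t0 (le_trans tr).
have Qpos x : X x -> 0 < good_radius Q x.
  move=> Xx; have [d d0 dP] := mD Xx.1 sigma_gt0.
  have : nbhs x X by exact: open_nbhs_nbhs.
  move=> /nbhs_normP[e /= e0 eX].
  have h : \forall y \near x, `|D x| * `|V x - V y| < sigma.
    have h1 : V x - V y @[y --> x] --> V x - V x.
      by apply: cvgB; [exact: cvg_cst|exact: cV].
    have h2 : `|D x| * `|V x - V y| @[y --> x] --> `|D x| * `|V x - V x|.
      by apply: cvgM; [exact: cvg_cst|exact: cvg_norm h1].
    by apply: cvgr_lt h2 _ _; rewrite subrr normr0 mulr0.
  move: h => /nbhs_normP[e' /= e'0 e'V].
  (* Of the slope [3 * sigma] one [sigma] pays for the error in [mD] and one for the variation of
     [V]. Half of [e] leaves room for the step itself inside the ball contained in [X]. *)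
  pose r := Num.min d (Num.min (e / 2) e').
  have rd : r <= d by rewrite ge_min lexx.
  have re2 : r <= e / 2 by rewrite !ge_min lexx orbT.
  have re : r <= e by rewrite (le_trans re2)// ler_pdivrMr// ler_peMr ?(ltW e0)// ler1n.
  have re' : r <= e' by rewrite !ge_min lexx !orbT.
  apply: (@good_radius_gt0 _ _ _ Qanti x r); first by rewrite !lt_min d0 divr_gt0.
  move=> z xz; have Xz : X z by apply: eX; exact: lt_le_trans re.
  split=> // t /andP[t0 tr]; split.
    apply: (eX _ _).1; rewrite /=; have := ler_normB (x - z) (t *: V z).
    rewrite opprD addrA => /le_lt_trans -> //; rewrite normrZ ger0_norm//.
    have : t * `|V z| <= t by rewrite ler_piMr// V1.
    by move: xz re2; rewrite -/r; lra.
  apply: (le_trans (@dP z (V z) t _ _ _)).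
  - exact: lt_le_trans rd.
  - exact: V1.
  - by rewrite t0 (le_trans tr).
  rewrite lerD2l -mulrN ler_wpM2l//.
  have /= := e'V z (lt_le_trans xz re'); have := DV x Xx.
  have := dual_le (D x) (V x - V z); rewrite dualB ler_norml => /andP[? _] ? ?.
  by lra.
pose tau x := good_radius Q x / 2.
have tau0 x : 0 <= tau x by rewrite divr_ge0// good_radius_ge0.
have tauX x : 0 < tau x -> Q x (tau x).
  by rewrite /tau pmulr_lgt0// => /(good_radius_half Qanti).
have tauc : continuous tau.
  move=> x; apply: cvgM; last exact: cvg_cst.
  exact: good_radius_continuous.
have Ule x : `|tau x *: V x| <= tau x.
  rewrite normrZ ger0_norm//; have [t0|t0] := ltP 0 (tau x).
    by rewrite ler_piMr//; apply: V1; exact: (tauX x t0).1.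
  have -> : tau x = 0 by apply/eqP; rewrite eq_le tau0 t0.
  by rewrite mul0r.
exists (fun x => tau x *: V x); split.
- move=> x; have [t0|t0] := ltP 0 (tau x).
    by apply: cvgZ; [exact: tauc|apply: cV; exact: (tauX x t0).1].
  have t00 : tau x = 0 by apply/eqP; rewrite eq_le tau0 t0.
  rewrite /continuous_at t00 scale0r; apply/cvgr0Pnorm_lt => e e0.
  have : \forall y \near x, tau y < e by apply: cvgr_lt (tauc x) _ _; rewrite t00.
  by apply: filterS => y; exact: le_lt_trans.
- move=> x; rewrite VN scalerN /tau good_radiusN// => z r [[Yz mz] h]; split.
    by split; [exact: Y_sym|rewrite mN].
  move=> t tr; rewrite VN scalerN -opprD !mN; have [Yt mt] := h t tr.
    by split=> //; exact: Y_sym.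
- move=> x t /andP[t0 t1]; have [p0|p0] := ltP 0 (tau x); last first.
    have -> : tau x = 0 by apply/eqP; rewrite eq_le tau0 p0.
    by rewrite scale0r scaler0 addr0 normr0 mulr0 subr0.
  have [Xx h] := tauX x p0; rewrite scalerA.
  have /h[Yt mt] : 0 <= t * tau x <= tau x by rewrite mulr_ge0//= ler_piMl.
  split=> //; rewrite (le_trans mt)// lerD2l lerN2 mulrAC.
  by rewrite ler_wpM2r ?(ltW sigma_gt0)// ler_wpM2l.
- move=> x Xx; rewrite scaler_eq0 negb_or gt_eqF ?divr_gt0 ?Qpos//=.
  apply/eqP => V0; have := DV x Xx; rewrite V0 dual0; have := sigma_gt0; lra.
Qed.

(** If the iterates of a point never went below [c], their total length would be at most
    [(b - a) / sigma] and they would converge within [Y] to a point of the band where the field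
    vanishes. So finitely many steps suffice at each point, and a continuous even bound for their
    number allows one continuous odd map. *)
Lemma deformation (M : set W) (c : R) : a < c -> c <= b ->
  (forall x, M x -> m x < b) ->
  (forall x y, M x -> `|x - y| <= (b - a) / sigma -> Y y) ->
  exists eta : W -> W, [/\ {within M, continuous eta},
    forall x, M x -> eta (- x) = - eta x &
    forall x, M x -> Y (eta x) /\ m (eta x) < c].
Proof.
move=> ac cb Mb MY; have [U [cU UN Udec UX]] := descent_step.
pose T x := x + U x.
have TS x : (Y x -> Y (T x)) /\ m (T x) <= m x - sigma * `|U x|.
  have := Udec x 1; rewrite scale1r mul1r; apply; exact/andP.
have cT : continuous T by move=> x; apply: cvgD; [exact: cvg_id|exact: cU].
have TN x : T (- x) = - T x by rewrite /T UN opprD.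
have cTn n : continuous (iter n T).
  elim: n => [|n ih] x; first exact: cvg_id.
  exact: (cvg_comp _ _ (ih x) (cT _)).
have YT n x : Y x -> Y (iter n T x).
  by move=> Yx; elim: n => // n ih; apply: (TS _).1.
have TnN n x : iter n T (- x) = - iter n T x.
  by elim: n => //= n ->; exact: TN.
pose G n : set W := [set x | Y (iter n T x) /\ m (iter n T x) < c].
have oG n : open (G n).
  rewrite openE => x [Yx mx]; rewrite /interior /=.
  have h1 : \forall y \near iter n T x, Y y by exact: open_nbhs_nbhs.
  have h2 : \forall y \near iter n T x, m y < c by apply: cvgr_lt (m_continuous Yx) _ _.
  have h3 : \forall y \near iter n T x, Y y /\ m y < c by apply: filterS2 h1 h2 => y.
  exact: (cTn n x _ h3).
have GN n x : G n x -> G n (- x).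
  by move=> [Yx mx]; split; rewrite TnN ?mN//; exact: Y_sym.
have MY0 x : M x -> Y x.
  move=> Mx; apply: (MY x x Mx); rewrite subrr normr0 divr_ge0 ?(ltW sigma_gt0)//.
  by have := ac; have := cb; lra.
have MG x : M x -> exists n, G n x.
  move=> Mx; apply: contrapT => /forallNP nG; have Yx := MY0 x Mx.
  pose u n := U (iter n T x).
  have uc n : c <= m (iter n T x).
    by rewrite leNgt; apply/negP => h; apply: (nG n); split=> //; exact: YT.
  have itE n : iter n T x = x + series u n.
    elim: n => [|n ih]; first by rewrite seriesEnat /= big_geq ?addr0.
    by rewrite iterS /T seriesSr addrA -ih.
  have len n : sigma * series (fun k => `|u k|) n <= m x - m (iter n T x).
    elim: n => [|n ih]; first by rewrite seriesEnat /= big_geq// mulr0 subrr.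
    by rewrite seriesSr mulrDr /=; have := (TS (iter n T x)).2; rewrite -/(u n); lra.
  have lenL n : series (fun k => `|u k|) n <= (b - a) / sigma.
    rewrite ler_pdivlMr// mulrC (le_trans (len n))//.
    by have := uc n; have := Mb x Mx; have := ac; lra.
  have cu : cvgn (series u).
    apply: normed_cvg; apply: nondecreasing_is_cvgn.
      by apply: nondecreasing_series => k _ _; exact: normr_ge0.
    by exists ((b - a) / sigma) => _ [n _ <-]; exact: lenL.
  have u0 := cvg_series_cvg_0 cu.
  pose y := x + limn (series u).
  have Ty : iter n T x @[n --> \oo] --> y.
    rewrite (_ : (fun n => _) = fun n => x + series u n).
      by apply: cvgD; [exact: cvg_cst|exact: cu].
    by apply/funext => n; rewrite itE.
  have xy : `|x - y| <= (b - a) / sigma.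
    rewrite distrC /y addrAC subrr add0r.
    apply: (cvgr_to_le (cvg_norm cu)); apply: nearW => n; apply: le_trans (lenL n).
    by rewrite !seriesEnat /=; exact: ler_norm_sum.
  have Yy := MY x y Mx xy.
  have my : m (iter n T x) @[n --> \oo] --> m y by exact: (cvg_comp _ _ Ty (m_continuous Yy)).
  have cy : c <= m y by apply: (cvgr_to_ge my); apply: nearW.
  have ym : m y <= m x.
    apply: (cvgr_to_le my); apply: nearW => n.
    have := len n; have : 0 <= sigma * series (fun k => `|u k|) n.
      by rewrite mulr_ge0 ?(ltW sigma_gt0)// seriesEnat /= sumr_ge0.
    by move: (series _ n) => ?; lra.
  have /UX/eqP : X y.
    by split=> //; apply/andP; split; [exact: lt_le_trans cy|exact: le_lt_trans (Mb x Mx)].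
  have Uy : u n @[n --> \oo] --> U y by exact: (cvg_comp _ _ Ty (cU y)).
  by apply; exact: (cvg_unique _ Uy u0).
have [s [cs sN sG]] := even_upper_bound oG GN.
pose clip (r : R) := Num.min 1 (Num.max 0 r).
(* Step j is carried out in the proportion [clip (s x - j)]: fully as long as j + 1 <= s x, then at
   most once in part, then no more. *)
pose P := fix P k x := if k is j.+1 then P j x + clip (s x - j%:R) *: U (P j x) else x.
have clip01 r : 0 <= clip r <= 1.
  by rewrite /clip le_min ler01 le_max lexx ge_min lexx.
have clip1 r : 1 <= r -> clip r = 1.
  by move=> r1; apply/min_idPl; rewrite le_max r1 orbT.
have clip0 r : r <= 0 -> clip r = 0.
  by move=> r0; rewrite /clip (max_idPl _)// (min_idPr _)// ler01.
have cclip (r : R) : {for r, continuous clip}.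
  apply: (@continuous_min _ _ (fun=> 1) _ r); first exact: cvg_cst.
  by apply: (@continuous_max _ _ (fun=> 0) _ r); [exact: cvg_cst|exact: cvg_id].
have PN k x : P k (- x) = - P k x.
  by elim: k => //= k ->; rewrite sN UN scalerN opprD.
have PY k x : Y x -> Y (P k x).
  by move=> Yx; elim: k => //= k ih; apply: (Udec _ _ (clip01 _)).1.
have Pm k j x : (k <= j)%N -> m (P j x) <= m (P k x).
  elim: j => [|j ih]; first by rewrite leqn0 => /eqP ->.
  rewrite leq_eqVlt => /orP[/eqP -> //|]; rewrite ltnS => /ih; apply: le_trans.
  rewrite /= (le_trans (Udec _ _ (clip01 _)).2)// gerBl !mulr_ge0 ?(ltW sigma_gt0)//.
  by have /andP[] := clip01 (s x - j%:R).
have PT k x : k%:R <= s x -> P k x = iter k T x.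
  elim: k => //= k ih ks; rewrite ih ?(le_trans _ ks) ?ler_nat//.
  by rewrite clip1 ?scale1r// lerBrDl natr1.
have Pstop k j x : (k <= j)%N -> s x <= k%:R -> P j x = P k x.
  move=> + sk; elim: j => [|j ih]; first by rewrite leqn0 => /eqP ->.
  rewrite leq_eqVlt => /orP[/eqP -> //|]; rewrite ltnS => kj /=.
  by rewrite clip0 ?scale0r ?addr0 ?ih// subr_le0 (le_trans sk)// ler_nat.
have cP k n x : G n x -> {for x, continuous (P k)}.
  move=> Gx; elim: k => [|k ih]; first exact: cvg_id.
  have h1 : s y - k%:R @[y --> x] --> s x - k%:R by apply: cvgB; [exact: (cs n)|exact: cvg_cst].
  have h2 := cvg_comp _ _ h1 (cclip _).
  have h3 := cvg_comp _ _ ih (cU _).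
  by apply: (cvgD ih); exact: (cvgZ h2 h3).
have strunc x : s x <= (Num.truncn (s x)).+1%:R by exact/ltW/truncnS_gt.
exists (fun x => P (Num.truncn (s x)).+1 x); split.
- apply/subspace_continuousP => x Mx; apply: cvg_within_filter.
  have [n Gx] := MG x Mx; pose K := (Num.truncn (s x)).+1.
  have : {for x, continuous (P K)} by exact: cP Gx.
  apply: cvg_trans; apply: near_eq_cvg.
  have : \forall y \near x, s y < K%:R.
    by apply: cvgr_lt (cs n x Gx) _ _; exact: truncnS_gt.
  apply: filterS => y syK; pose K' := (Num.truncn (s y)).+1.
  (* Any number of steps beyond [s y] gives the same endpoint, so near [x] the fixed number [K] can
     be used. *)
  rewrite -(@Pstop K (maxn K K')) ?leq_maxl ?(ltW syK)//.
  rewrite -[RHS]/(P K' y) -(@Pstop K' (maxn K K')) ?leq_maxr//.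
- by move=> x _; rewrite sN PN.
- move=> x Mx; split; first exact/PY/MY0.
  have [n /sG[k ks Gk]] := MG x Mx.
  apply: (@le_lt_trans _ _ (m (P k x))); last by rewrite PT// Gk.2.
  apply: Pm; rewrite -(ler_nat R); exact: le_trans ks (strunc x).
Qed.

End deformation.

(** * The functional along fibres *)

Section fibre.
Context {R : realType}.
Variables (q s r : R).
Hypotheses (q_gt0 : 0 < q) (q_lt_s : q < s) (s_lt_r : s < r).
Implicit Types (c i x y t : R).

(* Up to the factor [J u], [height] is [lambda_c (u_t)] as a function of [t], with
   [i = I u], [x = F u], [y = G u]; its derivative has the sign of [slope]. *)
Definition height c i x y t : R :=
  i - t `^ (q - s) * x - t `^ (r - s) * y - c * t `^ (- s).

Definition slope c x y t : R :=
  (s - q) * x * t `^ q - (r - s) * y * t `^ r + c * s.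

Lemma height_is_derive c i x y t : 0 < t ->
  is_derive t (1 : R) (height c i x y : R -> R^o) (t `^ (- s - 1) * slope c x y t).
Proof.
move=> t0; have h e : is_derive t (1 : R) ((fun u => u `^ e) : R -> R^o) (e * t `^ (e - 1)).
  exact: is_derive1_powR.
have h1 := is_deriveZ x (h (q - s)).
have h2 := is_deriveZ y (h (r - s)).
have h3 := is_deriveZ c (h (- s)).
have h4 := is_deriveB (is_deriveB (is_deriveB (is_derive_cst (i : R^o) t (1 : R)) h1) h2) h3.
have -> : height c i x y =
    (cst (i : R^o) - (x \*: (fun u => u `^ (q - s)))
     - (y \*: (fun u => u `^ (r - s))) - (c \*: (fun u => u `^ (- s)))).
  apply/funext => u; rewrite /height [u `^ (q - s) * x]mulrC.
  by rewrite [u `^ (r - s) * y]mulrC.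
apply: is_derive_eq h4 _.
have tE e : t `^ (e - s - 1) = t `^ e * t `^ (- s - 1).
  by rewrite -addrA powRD// (gt_eqF t0) implybT.
rewrite -[x *: _]/(x * _) -[y *: _]/(y * _) -[c *: _]/(c * _) !tE /slope.
set u := t `^ _; set v := t `^ _; set w := t `^ _; ring.
Qed.

Lemma slope_decreasing c x y t t' : x < 0 -> 0 < y -> 0 < t -> t < t' ->
  slope c x y t' < slope c x y t.
Proof.
move=> x0 y0 t0 tt'; have t'0 := lt_trans t0 tt'.
have hp e : 0 < e -> t `^ e < t' `^ e.
  by move=> e0; apply: gt0_ltr_powR => //; rewrite nnegrE ltW.
have hq := hp q q_gt0; have hr : t `^ r < t' `^ r.
  by apply: hp; rewrite (lt_trans q_gt0)// (lt_trans q_lt_s).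
have h1 : (s - q) * x * t' `^ q < (s - q) * x * t `^ q.
  by rewrite ltr_nM2l// pmulr_rlt0// subr_gt0.
have h2 : (r - s) * y * t `^ r < (r - s) * y * t' `^ r.
  by rewrite ltr_pM2l// mulr_gt0// subr_gt0.
by rewrite /slope; lra.
Qed.

Lemma slope_continuous c x y t : 0 < t -> {for t, continuous (slope c x y)}.
Proof.
move=> t0; have h e : {for t, continuous ((fun u => u `^ e) : R -> R)}.
  apply: differentiable_continuous; apply/derivable1_diffP.
  by have [] := is_derive1_powR e t0.
apply: cvgD; last exact: cvg_cst.
exact: (cvgB (cvgMl_tmp (h q)) (cvgMl_tmp (h r))).
Qed.

(** Intermediate values: [t1 <= 1] is so small that both powers together take at most half of the
    constant term [c * s], and [t2] so large that the r-th power alone outweighs it. *)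
Lemma slope_root c x y : 0 < c -> x < 0 -> 0 < y ->
  exists2 t, 0 < t & slope c x y t = 0.
Proof.
move=> c0 x0 y0; have s0 := lt_trans q_gt0 q_lt_s; have r0 := lt_trans s0 s_lt_r.
have cs0 : 0 < c * s by rewrite mulr_gt0.
pose A := (s - q) * - x; pose B := (r - s) * y.
have A0 : 0 < A by rewrite mulr_gt0 ?subr_gt0 ?oppr_gt0.
have B0 : 0 < B by rewrite mulr_gt0 ?subr_gt0.
have slopeE t : slope c x y t = c * s - A * t `^ q - B * t `^ r.
  by rewrite /slope /A /B; ring.
have powK (e z : R) : 0 < e -> 0 < z -> (z `^ e^-1) `^ e = z.
  by move=> e0 z0; rewrite -powRrM mulVf ?gt_eqF// powRr1// ltW.
pose z := c * s / (2 * (A + B)).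
have z0 : 0 < z by rewrite divr_gt0// mulr_gt0// addr_gt0.
pose t1 := Num.min 1 (z `^ q^-1).
have t10 : 0 < t1 by rewrite lt_min ltr01 powR_gt0.
have t11 : t1 <= 1 by rewrite ge_min lexx.
have t1q : t1 `^ q <= z.
  rewrite -[leRHS](powK q z)//; apply: (ge0_ler_powR (ltW q_gt0)); rewrite ?nnegrE ?powR_ge0 ?(ltW t10)//.
  by rewrite ge_min lexx orbT.
have t1r : t1 `^ r <= t1 `^ q.
  by apply: ger_powR; rewrite ?t10// ltW// (lt_trans q_lt_s).
have p1 : 0 < slope c x y t1.
  have h1 : A * t1 `^ q <= A * z by rewrite ler_pM2l.
  have h2 : B * t1 `^ r <= B * z by rewrite ler_pM2l// (le_trans t1r).
  have h3 : (A + B) * z = c * s / 2 by rewrite /z; field; rewrite gt_eqF// addr_gt0.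
  by rewrite slopeE; rewrite mulrDl in h3; lra.
pose z2 := Num.max 1 ((c * s + 1) / B).
have z20 : 0 < z2 by rewrite lt_max ltr01.
pose t2 := z2 `^ r^-1.
have t20 : 0 < t2 by rewrite powR_gt0.
have p2 : slope c x y t2 < 0.
  have h1 : c * s + 1 <= B * t2 `^ r.
    by rewrite powK// [B * _]mulrC -ler_pdivrMr// le_max lexx orbT.
  have h2 : 0 <= A * t2 `^ q by rewrite mulr_ge0 ?powR_ge0 ?ltW.
  by rewrite slopeE; lra.
have t12 : t1 <= t2.
  rewrite (le_trans t11)// /t2 -[leLHS](_ : 1 `^ r^-1 = 1); last by rewrite powR1.
  have r10 : 0 <= r^-1 by rewrite invr_ge0 ltW.
  apply: (ge0_ler_powR r10); rewrite ?nnegrE ?ler01 ?(ltW z20)//.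
  by rewrite le_max lexx.
have [||t] := @IVT R (slope c x y) t1 t2 0 t12.
- apply: continuous_in_subspaceT => t; rewrite inE /= in_itv /= => /andP[t1t _].
  by apply: slope_continuous; exact: lt_le_trans t1t.
- by rewrite ge_min le_max (ltW p2) (ltW p1) orbT.
- rewrite in_itv /= => /andP[t1t _] st; exists t => //; exact: lt_le_trans t1t.
Qed.

(** The unique positive zero of the slope under the sign conditions below; 1 is a mere default when
    there is none. *)
Definition peak c x y : R := xget 1 [set t | 0 < t /\ slope c x y t = 0].

Lemma peakP c x y : 0 < c -> x < 0 -> 0 < y ->
  0 < peak c x y /\ slope c x y (peak c x y) = 0.
Proof.
move=> c0 x0 y0; have [t t0 ht] := slope_root c0 x0 y0.
by apply: (xgetPex 1 (P := [set t | 0 < t /\ slope c x y t = 0])); exists t.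
Qed.

(** The peak is located by the sign of the slope at test times. Its continuity and its bounds follow
    from this, in place of the implicit function theorem. *)
Lemma lt_peak c x y t : 0 < c -> x < 0 -> 0 < y -> 0 < t ->
  (t < peak c x y) = (0 < slope c x y t).
Proof.
move=> c0 x0 y0 t0; have [T0 TE] := peakP c0 x0 y0.
have [tT|tT|->] := ltgtP t (peak c x y).
- by rewrite -TE slope_decreasing.
- by apply/esym/negbTE; rewrite -leNgt -TE ltW// slope_decreasing.
- by rewrite TE ltxx.
Qed.

Lemma gt_peak c x y t : 0 < c -> x < 0 -> 0 < y -> 0 < t ->
  (peak c x y < t) = (slope c x y t < 0).
Proof.
move=> c0 x0 y0 t0; have [T0 TE] := peakP c0 x0 y0.
have [tT|tT|->] := ltgtP t (peak c x y).
- by apply/esym/negbTE; rewrite -leNgt -TE ltW// slope_decreasing.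
- by rewrite -TE slope_decreasing.
- by rewrite TE ltxx.
Qed.

Lemma peak_unique c x y t : 0 < c -> x < 0 -> 0 < y -> 0 < t ->
  slope c x y t = 0 -> peak c x y = t.
Proof.
move=> c0 x0 y0 t0 ht; apply/eqP; rewrite eq_le !leNgt lt_peak// gt_peak// ht ltxx//.
Qed.

Lemma height_le_peak c i x y t : 0 < c -> x < 0 -> 0 < y -> 0 < t ->
  height c i x y t <= height c i x y (peak c x y).
Proof.
move=> c0 x0 y0 t0; have [T0 TE] := peakP c0 x0 y0.
set T := peak c x y in T0 TE *.
have cH (a b : R) : 0 < a -> {within `[a, b], continuous (height c i x y : R -> R^o)}.
  move=> a0; apply: derivable_within_continuous => u; rewrite in_itv /= => /andP[au _].
  by have [] := @height_is_derive c i x y u (lt_le_trans a0 au).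
have dH (a b u : R) : 0 < a -> u \in `]a, b[%R ->
    is_derive u (1 : R) (height c i x y : R -> R^o) (u `^ (- s - 1) * slope c x y u).
  by move=> a0; rewrite in_itv /= => /andP[au _]; apply: height_is_derive; exact: lt_trans au.
have [tT|tT|->//] := ltgtP t T.
  have [u] := @MVT R _ _ t T tT (fun u => @dH t T u t0) (cH t T t0).
  rewrite in_itv /= => /andP[tu uT] E; rewrite -subr_ge0 E.
  rewrite mulr_ge0 ?subr_ge0 ?(ltW tT)// mulr_ge0 ?powR_ge0//.
  by rewrite ltW// -lt_peak// (lt_trans t0).
have [u] := @MVT R _ _ T t tT (fun u => @dH T t u T0) (cH T t T0).
rewrite in_itv /= => /andP[Tu ut] E; rewrite -subr_le0 E.
rewrite mulr_le0_ge0 ?subr_ge0 ?(ltW tT)// mulr_ge0_le0 ?powR_ge0//.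
by rewrite ltW// -gt_peak// (lt_trans T0).
Qed.

Lemma peak_cvg (S : Type) (F : set_system S) (FF : Filter F) c
    (x y : S -> R) (x0 y0 : R) : 0 < c ->
  (forall k, x k < 0 /\ 0 < y k) -> x0 < 0 -> 0 < y0 ->
  x k @[k --> F] --> x0 -> y k @[k --> F] --> y0 ->
  peak c (x k) (y k) @[k --> F] --> peak c x0 y0.
Proof.
move=> c0 xy x00 y00 xc yc; have [T0 TE] := peakP c0 x00 y00.
set T := peak c x0 y0 in T0 TE *.
have sc t : slope c (x k) (y k) t @[k --> F] --> slope c x0 y0 t.
  apply: cvgD; last exact: cvg_cst.
  exact: (cvgB (cvgMr_tmp (cvgMl_tmp xc)) (cvgMr_tmp (cvgMl_tmp yc))).
apply/cvgrPdist_lt => e e0; pose d := Num.min e (T / 2).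
have d0 : 0 < d by rewrite lt_min e0 divr_gt0.
have de : d <= e by rewrite ge_min lexx.
have dT : d <= T / 2 by rewrite ge_min lexx orbT.
have t1 : 0 < T - d by lra.
have t2 : 0 < T + d by lra.
have h1 : 0 < slope c x0 y0 (T - d) by rewrite -lt_peak// -/T; lra.
have h2 : slope c x0 y0 (T + d) < 0 by rewrite -gt_peak// -/T; lra.
have n1 : \forall k \near F, 0 < slope c (x k) (y k) (T - d) by apply: cvgr_gt (sc _) _ _.
have n2 : \forall k \near F, slope c (x k) (y k) (T + d) < 0 by apply: cvgr_lt (sc _) _ _.
apply: filterS2 n1 n2 => k; have [xk yk] := xy k.
rewrite -lt_peak// -gt_peak// => ? ?; rewrite ltr_distlC; apply/andP; split; lra.
Qed.

End fibre.

(** * The reduced functional and its differential *)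

Lemma powR_cvg {R : realType} (T : Type) (H : set_system T) (FH : Filter H)
    (e : R) (a : T -> R) (t : R) :
  0 < t -> a k @[k --> H] --> t -> a k `^ e @[k --> H] --> t `^ e.
Proof.
move=> t0 at_; have h : {for t, continuous ((fun u => u `^ e) : R -> R)}.
  apply: differentiable_continuous; apply/derivable1_diffP.
  by have [] := is_derive1_powR e t0.
exact: (cvg_comp _ _ at_ h).
Qed.

Lemma seq_bounded_above {R : realType} (T : Type) (S : set T) (phi : T -> R) :
  (forall u : nat -> T, (forall j, S (u j)) -> exists2 n, {homo n : i j / (i < j)%N} &
    exists l : R, phi (u (n j)) @[j --> \oo] --> l) ->
  exists2 C : R, 0 < C & forall p, S p -> phi p <= C.
Proof.
move=> Sseq; apply: contrapT => /forall2NP nC.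
have /choice[u uP] (j : nat) : exists p, S p /\ j.+1%:R < phi p.
  have [/negP|] := nC j.+1%:R; first by rewrite ltr0n.
  by move=> /existsNP[p /not_implyP[Sp /negP]]; rewrite -ltNge => h; exists p.
have [|n nh [l hl]] := Sseq u; first by move=> j; have [] := uP j.
have h1 : \forall j \near \oo, phi (u (n j)) < l + 1 by apply: cvgr_lt hl _ _; rewrite ltrDl.
have h2 : \forall j \near \oo, l + 1 < j%:R :> R.
  have := @cvgr_idn R => /cvgryPgt; exact.
have [j [hj1 hj2]] : exists j, phi (u (n j)) < l + 1 /\ l + 1 < j%:R.
  by apply: (@filter_ex _ \oo); move: h1 h2; apply: filterS2 => j.
have := lt_trans (lt_trans (uP (n j)).2 hj1) hj2.
by rewrite ltr_nat ltnNge (leq_trans (homo_ltn_ge j nh)) ?leqnSn.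
Qed.

Section reduced.
Context {R : realType} {W : completeNormedModType R}.
Variables (sc : W -> R -> W) (q s r : R) (As Bs f g : W -> dual W).
Hypotheses (q_gt0 : 0 < q) (q_lt_s : q < s) (s_lt_r : s < r).
Hypothesis scP : is_scaling s sc.
Hypotheses (As_scaled : scaled_operator s sc As) (Bs_scaled : scaled_operator s sc Bs).
Hypotheses (f_odd : odd_operator f) (f_potential : potential_operator f).
Hypotheses (g_odd : odd_operator g) (g_potential : potential_operator g).
Hypothesis A6 : forall u, u != 0 -> 0 < As u u.
Hypothesis A8 : forall u, u != 0 -> 0 < Bs u u.
Hypotheses (H1f : homogeneous sc q f) (H1g : homogeneous sc r g).
Hypothesis F_lt0 : forall u, u != 0 -> potential f u < 0.
Hypothesis G_gt0 : forall u, u != 0 -> 0 < potential g u.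
Implicit Types (u v w x y z : W) (c t : R).

Local Notation I := (potential As).
Local Notation J := (potential Bs).
Local Notation F := (potential f).
Local Notation G := (potential g).
Local Notation Ap := (scaled_potential As_scaled).
Local Notation Bp := (scaled_potential Bs_scaled).

Let s_gt0 : 0 < s. Proof. exact: lt_trans q_lt_s. Qed.

Lemma energy_gt0 u : u != 0 -> 0 < I u. Proof. exact: (potential_gt0 Ap A6). Qed.
Lemma weight_gt0 u : u != 0 -> 0 < J u. Proof. exact: (potential_gt0 Bp A8). Qed.

Lemma energy_neq0 u : 0 < I u -> u != 0.
Proof. by move=> h; apply/eqP => u0; rewrite u0 (potential0 Ap) ltxx in h. Qed.

Lemma scaling_neq0 u t : 0 < t -> u != 0 -> sc u t != 0.
Proof.
move=> t0; apply: contra_neq => h; have ti : 0 < t^-1 by rewrite invr_gt0.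
rewrite -(scaling1 scP u) -(mulfV (lt0r_neq0 t0)) -(scalingM scP) ?ltW// h.
by have := scalingZ scP 0 0 (ltW ti); rewrite !scale0r.
Qed.

Lemma scalingN u t : 0 <= t -> sc (- u) t = - sc u t.
Proof. by move=> t0; have := scalingZ scP u (-1) t0; rewrite !scaleN1r. Qed.

Lemma energy_scale u t : 0 <= t -> I (sc u t) = t `^ s * I u.
Proof. by move=> t0; rewrite (potential_homogeneous Ap scP (scaled_homogeneous As_scaled)). Qed.
Lemma weight_scale u t : 0 <= t -> J (sc u t) = t `^ s * J u.
Proof. by move=> t0; rewrite (potential_homogeneous Bp scP (scaled_homogeneous Bs_scaled)). Qed.
Lemma F_scale u t : 0 <= t -> F (sc u t) = t `^ q * F u.
Proof. by move=> t0; rewrite (potential_homogeneous f_potential scP H1f). Qed.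
Lemma G_scale u t : 0 <= t -> G (sc u t) = t `^ r * G u.
Proof. by move=> t0; rewrite (potential_homogeneous g_potential scP H1g). Qed.

Definition fibre_value c t u := height q s r c (I u) (F u) (G u) t / J u.

Definition nehari_time c u := peak q s r c (F u) (G u).

Definition fibre_max c u := fibre_value c (nehari_time c u) u.

Lemma lambda_fun_scale c u t : 0 < t -> u != 0 ->
  lambda_fun As Bs f g c (sc u t) = fibre_value c t u.
Proof.
move=> t0 u0; rewrite /lambda_fun energy_scale ?weight_scale ?F_scale ?G_scale ?ltW//.
have t1 : t != 0 by rewrite gt_eqF.
rewrite /fibre_value /height !powRB ?t1 ?implybT// powRN.
have := weight_gt0 u0; have : 0 < t `^ s by rewrite powR_gt0.
by move=> /lt0r_neq0 ? /lt0r_neq0 ?; field; apply/andP.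
Qed.

Lemma nehari_time_gt0 c u : 0 < c -> u != 0 -> 0 < nehari_time c u.
Proof. by move=> c0 u0; have [] := peakP q_gt0 q_lt_s s_lt_r c0 (F_lt0 u0) (G_gt0 u0). Qed.

Lemma fibre_value_le c t u : 0 < c -> 0 < t -> u != 0 ->
  fibre_value c t u <= fibre_max c u.
Proof.
move=> c0 t0 u0; rewrite ler_pM2r ?invr_gt0 ?weight_gt0//.
exact: height_le_peak (F_lt0 u0) (G_gt0 u0) t0.
Qed.

(** By homogeneity the slope of u at time t is that of u_t at time 1. Conversely [w] is u_t for its
    normalization u, with t^s = I(w). *)
Lemma nehariE c w : nehari sc As Bs f g c w <->
  w != 0 /\ slope q s r c (F w) (G w) 1 = 0.
Proof.
have slopeE u t : 0 < t -> slope q s r c (F (sc u t)) (G (sc u t)) 1 =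
    slope q s r c (F u) (G u) t.
  by move=> t0; rewrite /slope F_scale ?G_scale ?ltW// !powR1; ring.
have dE u t : 0 < t -> u != 0 ->
    is_derive t (1 : R) (fun t : R => lambda_fun As Bs f g c (sc u t) : R^o)
      (t `^ (- s - 1) * slope q s r c (F u) (G u) t / J u).
  move=> t0 u0.
  have h := is_deriveZ (J u)^-1 (height_is_derive q s r c (I u) (F u) (G u) t0).
  apply: (@near_eq_is_derive R R^o R^o _ _ _ _ _ _ (is_derive_eq h (mulrC _ _))).
  have : \forall t' \near t, 0 < t' by exact: lt_nbhsr.
  apply: filterS => t' t'0; rewrite lambda_fun_scale// /fibre_value mulrC//.
split=> [[u [t [Iu t0 d0 ->]]]|[w0 w1]].
  have u0 : u != 0 by apply: energy_neq0; rewrite Iu ltr01.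
  split; first exact: scaling_neq0.
  rewrite slopeE//; have [_ e1] := dE u t t0 u0; have [_ e2] := d0.
  move: e2; rewrite e1 => /eqP; rewrite !mulf_eq0 invr_eq0 (gt_eqF (weight_gt0 u0)).
  by rewrite (gt_eqF (powR_gt0 _ t0)) /= orbF => /eqP.
pose t := I w `^ s^-1; have t0 : 0 < t by rewrite powR_gt0// energy_gt0.
have ts : t `^ s = I w by rewrite -powRrM mulVf ?gt_eqF// powRr1// ltW// energy_gt0.
have ti : 0 < t^-1 by rewrite invr_gt0.
have u0 : sc w t^-1 != 0 by exact: scaling_neq0.
exists (sc w t^-1), t.
have wE : sc (sc w t^-1) t = w by rewrite (scalingM scP) ?ltW// mulVf ?gt_eqF// (scaling1 scP).
split=> //.
  rewrite /Ms /= energy_scale ?ltW// -powR_inv1 ?(ltW t0)// powRAC ts.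
  by rewrite powR_inv1 ?mulVf ?gt_eqF ?(ltW (energy_gt0 w0))//; exact: energy_gt0.
apply: is_derive_eq (dE _ _ t0 u0) _.
by rewrite -slopeE// wE w1 mulr0 mul0r.
Qed.

Lemma nehari_time_nehari c w : 0 < c -> nehari sc As Bs f g c w -> nehari_time c w = 1.
Proof.
by move=> c0 /nehariE[w0 w1]; apply: peak_unique => //; [exact: F_lt0|exact: G_gt0].
Qed.

Lemma nehari_project c u : 0 < c -> u != 0 ->
  nehari sc As Bs f g c (sc u (nehari_time c u)).
Proof.
move=> c0 u0; have T0 := nehari_time_gt0 c0 u0.
apply/nehariE; split; first exact: scaling_neq0.
have [_ h] := peakP q_gt0 q_lt_s s_lt_r c0 (F_lt0 u0) (G_gt0 u0).
rewrite -[RHS]h -/(nehari_time c u) /slope F_scale ?G_scale ?ltW// !powR1; ring.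
Qed.

Lemma fibre_max_project c u : 0 < c -> u != 0 ->
  lambda_fun As Bs f g c (sc u (nehari_time c u)) = fibre_max c u.
Proof. by move=> c0 u0; rewrite lambda_fun_scale// nehari_time_gt0. Qed.

Lemma fibre_max_nehari c w : 0 < c -> nehari sc As Bs f g c w ->
  lambda_fun As Bs f g c w = fibre_max c w.
Proof.
move=> c0 nw; rewrite -fibre_max_project//; last by have /nehariE[] := nw.
by rewrite nehari_time_nehari// (scaling1 scP).
Qed.

(** Both points have the same fibre: the inequality for a factor [t] applies to [t^-1] as well. *)
Lemma fibre_max_scale c u t : 0 < c -> 0 < t -> u != 0 ->
  fibre_max c (sc u t) = fibre_max c u.
Proof.
have half v t' : 0 < c -> 0 < t' -> v != 0 -> fibre_max c (sc v t') <= fibre_max c v.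
  move=> c0 t'0 v0; have v'0 := scaling_neq0 t'0 v0; have T0 := nehari_time_gt0 c0 v'0.
  rewrite -[leLHS]fibre_max_project// (scalingM scP _ (ltW t'0) (ltW T0)).
  by rewrite lambda_fun_scale ?mulr_gt0// fibre_value_le// mulr_gt0.
move=> c0 t0 u0; apply/eqP; rewrite eq_le half//=.
have ti : 0 < t^-1 by rewrite invr_gt0.
have := half (sc u t) t^-1 c0 ti (scaling_neq0 t0 u0).
by rewrite (scalingM scP _ (ltW t0) (ltW ti)) mulfV ?gt_eqF// (scaling1 scP).
Qed.

Lemma nehari_timeN c u : nehari_time c (- u) = nehari_time c u.
Proof. by rewrite /nehari_time !potentialN. Qed.

Lemma fibre_maxN c u : fibre_max c (- u) = fibre_max c u.
Proof.
rewrite /fibre_max nehari_timeN /fibre_value !potentialN//.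
  exact: scaled_odd Bs_scaled.
exact: scaled_odd As_scaled.
Qed.

Lemma nehari_time_cvg (T : Type) (H : set_system T) (FH : Filter H) c
    (a b : T -> R) u : 0 < c -> (forall k, a k < 0 /\ 0 < b k) -> u != 0 ->
  a k @[k --> H] --> F u -> b k @[k --> H] --> G u ->
  peak q s r c (a k) (b k) @[k --> H] --> nehari_time c u.
Proof. by move=> c0 ab u0; apply: peak_cvg => //; [exact: F_lt0|exact: G_gt0]. Qed.

Lemma near_neq0 x : x != 0 -> \forall y \near x, y != 0.
Proof.
move=> x0; apply/nbhs_normP; exists `|x|; first by rewrite /= normr_gt0.
by move=> y /=; apply: contraTneq => ->; rewrite subr0 ltxx.
Qed.

(* [peak] is junk at [0], so its arguments are altered there to use
   [nehari_time_cvg]. *)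
Lemma nehari_time_continuous c x : 0 < c -> x != 0 ->
  {for x, continuous (nehari_time c)}.
Proof.
move=> c0 x0; pose alt y := if y == 0 then x else y.
have alt0 y : alt y != 0 by rewrite /alt; case: (eqVneq y 0).
have ax : alt x = x by rewrite /alt (negbTE x0).
have near_alt : \forall y \near x, y = alt y.
  by move: (near_neq0 x0); apply: filterS => y /negbTE y0; rewrite /alt y0.
have ca : alt y @[y --> x] --> x.
  by apply: (@cvg_trans _ (id y @[y --> x])); [exact: near_eq_cvg|exact: cvg_id].
have h : nehari_time c (alt y) @[y --> x] --> nehari_time c x.
  apply: nehari_time_cvg => //.
  - by move=> y; split; [exact: F_lt0|exact: G_gt0].
  - have h := cvg_comp _ _ ca (@potential_continuous _ _ _ f_potential x); exact: h.
  - have h := cvg_comp _ _ ca (@potential_continuous _ _ _ g_potential x); exact: h.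
apply: cvg_trans h; apply: near_eq_cvg.
by move: near_alt; apply: filterS => y <-.
Qed.

Lemma fibre_value_cvg (T : Type) (H : set_system T) (FH : Filter H) c
    (i j a b t : T -> R) (i0 j0 a0 b0 t0 : R) : 0 < t0 -> j0 != 0 ->
  i k @[k --> H] --> i0 -> j k @[k --> H] --> j0 -> a k @[k --> H] --> a0 ->
  b k @[k --> H] --> b0 -> t k @[k --> H] --> t0 ->
  height q s r c (i k) (a k) (b k) (t k) / j k @[k --> H] -->
  height q s r c i0 a0 b0 t0 / j0.
Proof.
move=> t00 j00 ic jc ac bc tc; have tp e := @powR_cvg _ _ _ FH e _ _ t00 tc.
apply: (cvgM _ (cvgV j00 jc)).
apply: (cvgB (cvgB (cvgB ic _) _)).
- exact: cvgM (tp _) ac.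
- exact: cvgM (tp _) bc.
- exact: cvgMl_tmp (tp _).
Qed.

Lemma fibre_max_continuous c x : 0 < c -> x != 0 -> {for x, continuous (fibre_max c)}.
Proof.
move=> c0 x0; apply: fibre_value_cvg.
- exact: nehari_time_gt0.
- by rewrite gt_eqF// weight_gt0.
- exact: (potential_continuous Ap).
- exact: (potential_continuous Bp).
- exact: (potential_continuous f_potential).
- exact: (potential_continuous g_potential).
- exact: nehari_time_continuous.
Qed.

(** The differential of [fibre_value c t] with [t] frozen at the maximizing time, whose variation
    has no effect at first order. *)
Definition fibre_diff c u : dual W := (J u)^-1 *:
  (As u - nehari_time c u `^ (q - s) *: f u - nehari_time c u `^ (r - s) *: g u -
   fibre_max c u *: Bs u).

Lemma fibre_diff_cvg (T : Type) (H : set_system T) (FH : Filter H) c x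
    (j t m : T -> R) (a b df dg : T -> dual W) : 0 < c -> x != 0 ->
  j k @[k --> H] --> J x -> t k @[k --> H] --> nehari_time c x ->
  m k @[k --> H] --> fibre_max c x ->
  a k @[k --> H] --> As x -> b k @[k --> H] --> Bs x ->
  df k @[k --> H] --> f x -> dg k @[k --> H] --> g x ->
  (j k)^-1 *: (a k - t k `^ (q - s) *: df k - t k `^ (r - s) *: dg k - m k *: b k)
    @[k --> H] --> fibre_diff c x.
Proof.
move=> c0 x0 jc tc mc ac bc fc gc.
have tp e := @powR_cvg _ _ _ FH e _ _ (nehari_time_gt0 c0 x0) tc.
have J0 : J x != 0 by rewrite gt_eqF// weight_gt0.
apply: (cvgZ (cvgV J0 jc)).
exact: (cvgB (cvgB (cvgB ac (cvgZ (tp _) fc)) (cvgZ (tp _) gc)) (cvgZ mc bc)).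
Qed.

Lemma fibre_diff_continuous c x : 0 < c -> x != 0 -> {for x, continuous (fibre_diff c)}.
Proof.
move=> c0 x0; apply: fibre_diff_cvg => //.
- exact: (potential_continuous Bp).
- exact: nehari_time_continuous.
- exact: fibre_max_continuous.
- exact: Ap.1.
- exact: Bp.1.
- exact: f_potential.1.
- exact: g_potential.1.
Qed.

Lemma fibre_diffN c u : fibre_diff c (- u) = - fibre_diff c u.
Proof.
rewrite /fibre_diff nehari_timeN fibre_maxN (potentialN (scaled_odd Bs_scaled)).
rewrite (scaled_odd As_scaled) (scaled_odd Bs_scaled) f_odd g_odd !scalerN.
by rewrite -[RHS]scalerN !opprD.
Qed.

Lemma fibre_diffE c u v : fibre_diff c u v = (J u)^-1 *
  (As u v - nehari_time c u `^ (q - s) * f u v - nehari_time c u `^ (r - s) * g u v -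
   fibre_max c u * Bs u v).
Proof. by rewrite /fibre_diff dual_scaleE !dual_subE !dual_scaleE. Qed.

(* The maximum defining [fibre_max] is attained at [nehari_time], so an increment
   of [fibre_max] is bounded by the increment at the time of the later point. *)
Lemma fibre_max_increment c z v t : 0 < c -> z != 0 -> z + t *: v != 0 ->
  exists a b df dg : W, (forall y, y \in [:: a; b; df; dg] -> `|z - y| <= `|t *: v|) /\
  fibre_max c (z + t *: v) <= fibre_max c z + t * ((J z)^-1 *
   (As a v - nehari_time c (z + t *: v) `^ (q - s) * f df v
    - nehari_time c (z + t *: v) `^ (r - s) * g dg v
    - fibre_max c (z + t *: v) * Bs b v)).
Proof.
move=> c0 z0 y0; set y := z + t *: v in y0 *.
have mvt p : potential_operator p -> exists2 a, `|z - a| <= `|t *: v| &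
    potential p y = potential p z + t * p a v.
  move=> pp; have [th /andP[th0 th1] E] := potential_mvt pp z (t *: v).
  exists (z + th *: (t *: v)).
    by rewrite opprD addrA subrr sub0r normrN normrZ gtr0_norm// ler_piMl// ltW.
  by rewrite -dual_scale -E addrC subrK.
have [a ha Ea] := mvt _ Ap; have [b hb Eb] := mvt _ Bp.
have [df hf Ef] := mvt _ f_potential; have [dg hg Eg] := mvt _ g_potential.
exists a, b, df, dg; split.
  by move=> w; rewrite !inE => /or4P[]/eqP ->.
have T0 := nehari_time_gt0 c0 y0; set tau := nehari_time c y in T0 *.
have h := fibre_value_le c0 T0 z0.
have Jy := weight_gt0 y0; have Jz := weight_gt0 z0.
have E : fibre_max c y * J y = height q s r c (I y) (F y) (G y) tau.
  by rewrite /fibre_max /fibre_value divfK// gt_eqF.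
apply: (le_trans _ (lerD h (lexx _))).
rewrite /fibre_value -(ler_pM2r Jz) mulrDl divfK ?gt_eqF//.
rewrite [X in _ <= _ + X](_ : _ = t * (As a v - tau `^ (q - s) * f df v
    - tau `^ (r - s) * g dg v - fibre_max c y * Bs b v)); last first.
  by rewrite -mulrA [(J z)^-1 * _]mulrC divfK// gt_eqF.
move: E; rewrite /height Ea Eb Ef Eg => E.
rewrite le_eqVlt; apply/orP; left; apply/eqP.
move: E; set P := tau `^ _; set Q := tau `^ _; set S := tau `^ _; lra.
Qed.

(** Along a sequence of counterexamples with shrinking steps, the four intermediate points of the
    increment estimate tend to [x]. The functionals bounding the difference quotients then tend to
    [fibre_diff c x] in norm, hence uniformly over unit vectors. *)
Lemma fibre_max_diff c x (e : R) : 0 < c -> x != 0 -> 0 < e ->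
  exists2 d : R, 0 < d & forall z v t, `|x - z| < d -> `|v| <= 1 -> 0 <= t <= d ->
    fibre_max c (z + t *: v) <= fibre_max c z + t * (fibre_diff c x v + e).
Proof.
move=> c0 x0 e0; apply: contrapT => /forall2NP nd.
have /choice[p pP] (n : nat) : exists p : W * W * R,
    [/\ `|x - p.1.1| < n.+1%:R^-1, `|p.1.2| <= 1, 0 <= p.2 <= n.+1%:R^-1 &
     fibre_max c p.1.1 + p.2 * (fibre_diff c x p.1.2 + e) <
     fibre_max c (p.1.1 + p.2 *: p.1.2)].
  have [|] := nd n.+1%:R^-1; first by rewrite invr_gt0 ltr0n.
  move=> /existsNP[z] /existsNP[v] /existsNP[t] /not_implyP[h1] /not_implyP[h2].
  move=> /not_implyP[h3 /negP]; rewrite -ltNge => h4.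
  by exists (z, v, t).
pose z n := (p n).1.1; pose v n := (p n).1.2; pose t n := (p n).2.
have z_cvg (u : nat -> W) : (forall n, `|z n - u n| <= n.+1%:R^-1) ->
    u n @[n --> \oo] --> x.
  move=> zu; apply/cvgrPdist_lt => d d0.
  have h : \forall n \near \oo, n.+1%:R^-1 < d / 2.
    have := @cvg_harmonic R; move=> /cvgr_lt; apply; exact: divr_gt0.
  move: h; apply: filterS => n hn; have [h1 _ _ _] := pP n.
  have := ler_normD (x - z n) (z n - u n); rewrite subrKA.
  have h2 : `|x - z n| < n.+1%:R^-1 := h1; have := zu n; move: hn h2; set o := _^-1; lra.
have tv n : `|t n *: v n| <= n.+1%:R^-1.
  have [_ h2 /andP[h3 h4] _] := pP n.
  by rewrite normrZ ger0_norm// (le_trans _ h4)// ler_piMr.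
have zx : z n @[n --> \oo] --> x.
  by apply: z_cvg => n; rewrite subrr normr0 invr_ge0 ler0n.
have yx : z n + t n *: v n @[n --> \oo] --> x.
  by apply: z_cvg => n; rewrite opprD addrA subrr sub0r normrN.
have /choice[w wP] n : exists w : W * W * W * W, z n != 0 -> z n + t n *: v n != 0 ->
  (forall y, y \in [:: w.1.1.1; w.1.1.2; w.1.2; w.2] -> `|z n - y| <= `|t n *: v n|) /\
  fibre_max c (z n + t n *: v n) <= fibre_max c (z n) + t n * ((J (z n))^-1 *
   (As w.1.1.1 (v n) - nehari_time c (z n + t n *: v n) `^ (q - s) * f w.1.2 (v n)
    - nehari_time c (z n + t n *: v n) `^ (r - s) * g w.2 (v n)
    - fibre_max c (z n + t n *: v n) * Bs w.1.1.2 (v n))).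
  have [z0|/negP z0] := boolP (z n != 0); last by exists (0, 0, 0, 0).
  have [y0|/negP y0] := boolP (z n + t n *: v n != 0); last by exists (0, 0, 0, 0).
  by have [a [b [df [dg h]]]] := fibre_max_increment c0 z0 y0; exists (a, b, df, dg).
have n0 : \forall n \near \oo, z n != 0 /\ z n + t n *: v n != 0.
  have h1 : \forall n \near \oo, z n != 0 by exact: (zx _ (near_neq0 x0)).
  have h2 : \forall n \near \oo, z n + t n *: v n != 0 by exact: (yx _ (near_neq0 x0)).
  by move: h1 h2; apply: filterS2 => n.
have w_cvg (k : W * W * W * W -> W) :
    (forall o, k o \in [:: o.1.1.1; o.1.1.2; o.1.2; o.2]) -> k (w n) @[n --> \oo] --> x.
  move=> kP; pose u n := if (z n != 0) && (z n + t n *: v n != 0) then k (w n) else z n.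
  have ux : u n @[n --> \oo] --> x.
    apply: z_cvg => n; rewrite /u; case: ifPn => [/andP[z0 y0]|_].
      by have [h _] := wP n z0 y0; apply: le_trans (tv n); exact: h.
    by rewrite subrr normr0 invr_ge0 ler0n.
  apply: cvg_trans ux; apply: near_eq_cvg; move: n0; apply: filterS => n [z0 y0].
  by rewrite /u z0 y0.
have wa := w_cvg (fun o => o.1.1.1) (fun o => mem_head _ _).
have wb : (w n).1.1.2 @[n --> \oo] --> x.
  by apply: (w_cvg (fun o => o.1.1.2)) => o; rewrite !inE eqxx orbT.
have wf : (w n).1.2 @[n --> \oo] --> x.
  by apply: (w_cvg (fun o => o.1.2)) => o; rewrite !inE eqxx !orbT.
have wg : (w n).2 @[n --> \oo] --> x.
  by apply: (w_cvg (fun o => o.2)) => o; rewrite !inE eqxx !orbT.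
pose E n : dual W := (J (z n))^-1 *: (As (w n).1.1.1
  - nehari_time c (z n + t n *: v n) `^ (q - s) *: f (w n).1.2
  - nehari_time c (z n + t n *: v n) `^ (r - s) *: g (w n).2
  - fibre_max c (z n + t n *: v n) *: Bs (w n).1.1.2).
have Ec : E n @[n --> \oo] --> fibre_diff c x.
  apply: fibre_diff_cvg => //.
  - have h := cvg_comp _ _ zx (@potential_continuous _ _ _ Bp x); exact: h.
  - exact: (cvg_comp _ _ yx (nehari_time_continuous c0 x0)).
  - exact: (cvg_comp _ _ yx (fibre_max_continuous c0 x0)).
  - exact: (cvg_comp _ _ wa (Ap.1 x)).
  - exact: (cvg_comp _ _ wb (Bp.1 x)).
  - exact: (cvg_comp _ _ wf (f_potential.1 x)).
  - exact: (cvg_comp _ _ wg (g_potential.1 x)).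
have En : \forall n \near \oo, `|fibre_diff c x - E n| < e by apply: cvgr_dist_lt Ec _ _.
have [n [[z0 y0] hn]] : exists n, (z n != 0 /\ z n + t n *: v n != 0) /\
    `|fibre_diff c x - E n| < e.
  by apply: (@filter_ex _ \oo); apply: filterS2 n0 En.
have [_ h2 /andP[h3 _] h4] := pP n; have [_ h5] := wP n z0 y0.
have := dual_le (fibre_diff c x - E n) (v n); rewrite dual_subE => h6.
have h7 : `|fibre_diff c x - E n| * `|v n| <= e.
  by rewrite (le_trans _ (ltW hn))// ler_piMr.
have h8 : E n (v n) <= fibre_diff c x (v n) + e.
  by rewrite -lerBlDl (le_trans _ h7)// (le_trans _ h6)// distrC ler_norm.
suff : fibre_max c (z n + t n *: v n) <= fibre_max c (z n) + t n * (fibre_diff c x (v n) + e).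
  by rewrite leNgt h4.
apply: (le_trans h5); rewrite lerD2l; apply: (ler_wpM2l h3); apply: le_trans h8.
by rewrite /E dual_scaleE !dual_subE !dual_scaleE.
Qed.

Lemma Phi_is_diff (m : R) w : is_diff w (Phi As Bs f g m : W -> R^o)
  ((As w : W -> R^o) - m *: (Bs w : W -> R^o) - (f w : W -> R^o) - (g w : W -> R^o)).
Proof.
have h1 := potential_is_diff Ap w; have h2 := potential_is_diff Bp w.
have h3 := potential_is_diff f_potential w; have h4 := potential_is_diff g_potential w.
exact: (is_diffB (is_diffB (is_diffB h1 (is_diffZ m h2)) h3) h4).
Qed.

(** [w] is the projection x_T of [x] onto the Nehari set. Every vector is some u_T, so homogeneity
    turns the vanishing of [fibre_diff c x] on u into the equation at [w], up to the factor T^s. *)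
Lemma critical_fibre_max c x : 0 < c -> x != 0 -> fibre_diff c x = 0 ->
  exists w, [/\ w != 0, lambda_fun As Bs f g c w = fibre_max c x,
    critical_point (lambda_fun As Bs f g c) w,
    critical_point (Phi As Bs f g (fibre_max c x)) w &
    Phi As Bs f g (fibre_max c x) w = c].
Proof.
move=> c0 x0 D0; have T0 := nehari_time_gt0 c0 x0; set T := nehari_time c x in T0.
pose w := sc x T; set l := fibre_max c x.
have w0 : w != 0 by exact: scaling_neq0.
have Jw := weight_gt0 w0.
have lw : lambda_fun As Bs f g c w = l by exact: fibre_max_project.
have Tp : forall e, T `^ (e - s) * T `^ s = T `^ e.
  by move=> e; rewrite -powRD ?subrK// (gt_eqF T0) implybT.
have dw v : As w v - l * Bs w v - f w v - g w v = 0.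
  have Ti : 0 <= T^-1 by rewrite invr_ge0 ltW.
  have -> : v = sc (sc v T^-1) T.
    by rewrite (scalingM scP _ Ti (ltW T0)) mulVf ?gt_eqF// (scaling1 scP).
  set u := sc v _; rewrite /w.
  rewrite (scaled_homogeneous As_scaled _ _ (ltW T0)) (scaled_homogeneous Bs_scaled _ _ (ltW T0)).
  rewrite (H1f _ _ (ltW T0)) (H1g _ _ (ltW T0)).
  have : fibre_diff c x u = 0 by rewrite D0.
  rewrite fibre_diffE -/T -/l => /eqP; rewrite mulf_eq0 invr_eq0 gt_eqF ?weight_gt0//= => /eqP h.
  rewrite -(Tp q) -(Tp r) -[RHS](mulr0 (T `^ s)) -h; ring.
have lE : Phi As Bs f g l w = c.
  have : I w - F w - G w - c = l * J w by rewrite -lw divfK// gt_eqF.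
  by rewrite /Phi; lra.
exists w; split=> //.
- have h1 := is_diffB (Phi_is_diff 0 w) (is_diff_cst (c : R^o) w).
  have dJ := potential_is_diff Bp w.
  have dV : is_diff w (fun u => (J u)^-1 : R^o) (- (J w) ^- 2 \*: (Bs w : W -> R^o)).
    have dJ1 : differentiable (J : W -> R^o) w by have [] := dJ.
    have Jn : J w != 0 by rewrite gt_eqF.
    split; first exact: differentiableV.
    by rewrite diffV//; congr (_ \*: _); have [_ ->] := dJ.
  have h := is_diffM h1 dV.
  have E : (lambda_fun As Bs f g c : W -> R^o) = (Phi As Bs f g 0 - cst c) * (fun u => (J u)^-1).
    apply/funext => u; rewrite -[RHS]/((I u - 0 * J u - F u - G u - c) * (J u)^-1).
    by rewrite mul0r subr0.
  rewrite /critical_point E; apply: is_diff_eq h _; apply/funext => v /=.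
  have e2 := dw v; have e1 : I w - l * J w - F w - G w = c by [].
  rewrite -[LHS]/((Phi As Bs f g 0 w - c) * (- (J w) ^- 2 * Bs w v) +
     (J w)^-1 * (As w v - 0 * Bs w v - f w v - g w v - 0)) /Phi.
  rewrite -[RHS]/(0 : R).
  have -> : As w v - 0 * Bs w v - f w v - g w v - 0 = l * Bs w v by lra.
  have -> : I w - 0 * J w - F w - G w - c = l * J w by lra.
  by field; rewrite gt_eqF.
- apply: is_diff_eq (Phi_is_diff l w) _; apply/funext => v; exact: dw.
Qed.

(** * Compactness *)

Hypothesis W_reflexive : reflexive_space W.
Hypothesis A7 : forall (u : nat -> W) w, weak_cvg u w ->
  As (u j) (u j - w) @[j --> \oo] --> (0 : R) ->
  exists2 n : nat -> nat, {homo n : i j / (i < j)%N} & u (n j) @[j --> \oo] --> w.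
Hypothesis A9 : weak_to_strong Bs.
Hypothesis A10 : forall K : R, exists M : R, forall u, M <= `|u| -> K <= I u.
Hypotheses (H2f : weak_to_strong f) (H2g : weak_to_strong g).

Lemma energy_sublevel_bounded (K : R) : exists C : R, forall u, I u <= K -> `|u| <= C.
Proof.
have [M MP] := A10 (K + 1); exists M => u uK; rewrite leNgt; apply/negP => h.
by have := MP u (ltW h); lra.
Qed.

Lemma energy_sublevel_compact (K : R) (u : nat -> W) : (forall j, I (u j) <= K) ->
  exists n w, [/\ {homo n : i j / (i < j)%N}, weak_cvg (u \o n) w,
    J (u (n j)) @[j --> \oo] --> J w, F (u (n j)) @[j --> \oo] --> F w &
    G (u (n j)) @[j --> \oo] --> G w].
Proof.
move=> uK; have [C CP] := energy_sublevel_bounded K.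
have uC j : `|u j| <= C by exact: CP.
have [n [nh [w uw]]] := weak_subsequence W_reflexive uC.
have unC j : `|(u \o n) j| <= C by exact: uC.
exists n, w; split=> //.
- exact: (potential_weak_continuous Bp A9 unC uw).
- exact: (potential_weak_continuous f_potential H2f unC uw).
- exact: (potential_weak_continuous g_potential H2g unC uw).
Qed.

(** If the weak limit were 0, then J, F and G would tend to 0. At the time with c t^(-s) = 1/8 the
    height would have lower limit at least 3/8, although it is bounded by [a * J (u j)]. *)
Lemma fibre_max_weak_neq0 c (a : R) (u : nat -> W) w : 0 < c ->
  (forall j, 2^-1 <= I (u j)) -> (forall j, fibre_max c (u j) <= a) ->
  J (u j) @[j --> \oo] --> J w -> F (u j) @[j --> \oo] --> F w ->
  G (u j) @[j --> \oo] --> G w -> w != 0.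
Proof.
move=> c0 I2 ma cJ cF cG; apply/eqP => w0.
have u0 j : u j != 0 by apply: energy_neq0; rewrite (lt_le_trans _ (I2 j)).
rewrite w0 (potential0 Bp) in cJ; rewrite w0 (potential0 f_potential) in cF.
rewrite w0 (potential0 g_potential) in cG.
pose t := (8 * c) `^ s^-1; have t0 : 0 < t by rewrite powR_gt0// mulr_gt0.
have ts : c * t `^ (- s) = 8^-1.
  rewrite powRN -powRrM mulVf ?gt_eqF// powRr1; last by rewrite mulr_ge0// ltW.
  by rewrite invfM mulrCA mulfV ?mulr1// gt_eqF.
have h : J (u j) * a + t `^ (q - s) * F (u j) + t `^ (r - s) * G (u j) @[j --> \oo] -->
    0 * a + t `^ (q - s) * 0 + t `^ (r - s) * 0.
  exact: (cvgD (cvgD (cvgMr_tmp cJ) (cvgMl_tmp cF)) (cvgMl_tmp cG)).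
rewrite mul0r !mulr0 !addr0 in h.
have [j hj] : exists j, J (u j) * a + t `^ (q - s) * F (u j) + t `^ (r - s) * G (u j) < 4^-1.
  by apply: (@filter_ex _ \oo); apply: cvgr_lt h _ _.
have := le_trans (fibre_value_le c0 t0 (u0 j)) (ma j).
rewrite /fibre_value ler_pdivrMr ?weight_gt0// /height ts; have := I2 j.
by move: hj; set P := _ `^ _; set Q := _ `^ _; lra.
Qed.

Lemma unit_sequence c (a : R) (u : nat -> W) : 0 < c -> (forall j, I (u j) = 1) ->
  (forall j, fibre_max c (u j) <= a) ->
  exists n w, [/\ {homo n : i j / (i < j)%N}, w != 0, weak_cvg (u \o n) w,
    J (u (n j)) @[j --> \oo] --> J w &
    F (u (n j)) @[j --> \oo] --> F w /\ G (u (n j)) @[j --> \oo] --> G w].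
Proof.
move=> c0 I1 ma.
have [n [w [nh uw cJ cF cG]]] : exists n w, [/\ {homo n : i j / (i < j)%N},
    weak_cvg (u \o n) w, J (u (n j)) @[j --> \oo] --> J w,
    F (u (n j)) @[j --> \oo] --> F w & G (u (n j)) @[j --> \oo] --> G w].
  by apply: (@energy_sublevel_compact 1) => j; rewrite I1.
exists n, w; split=> //.
apply: (@fibre_max_weak_neq0 c a (u \o n)) => // j; last exact: ma.
by rewrite /= I1 invf_le1// ler1n.
Qed.

(** A sequence violating the estimate has a nonzero weak limit. Solving the formula of [fibre_diff]
    for [As] shows that [As] converges in norm along it, so (A7) gives a strong limit, critical at
    the level [l]. *)
Lemma palais_smale c (l : R) : 0 < c ->
  (forall x, x != 0 -> fibre_max c x = l -> fibre_diff c x <> 0) ->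
  exists e sigma : R, [/\ 0 < e, 0 < sigma & forall x, 2^-1 < I x < 2 ->
    `|fibre_max c x - l| < e -> exists2 v, `|v| <= 1 & fibre_diff c x v <= - (4 * sigma)].
Proof.
move=> c0 ncrit; apply: contrapT => nex.
have /choice[x xP] (n : nat) : exists x, [/\ 2^-1 < I x < 2,
    `|fibre_max c x - l| < n.+1%:R^-1 & `|fibre_diff c x| <= 4 * n.+1%:R^-1].
  apply: contrapT => /forallNP nx; apply: nex; exists n.+1%:R^-1, n.+1%:R^-1.
  split; rewrite ?invr_gt0 ?ltr0n// => x Ix mx; apply: contrapT => /forall2NP nv.
  apply: (nx x); split=> //; apply: dual_norm_le => v v1.
  have [//|/negP] := nv v; rewrite -ltNge => h1.
  have [|/negP] := nv (- v); first by rewrite normrN.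
  rewrite -ltNge dualN => h2.
  by rewrite ler_norml (ltW h1) /= -lerN2 ltW.
have Ix j : I (x j) <= 2 by have [/andP[_ /ltW]] := xP j.
have [n [w [nh xw cJ cF cG]]] := energy_sublevel_compact Ix.
have n1 : (n j).+1%:R^-1 @[j --> \oo] --> (0 : R).
  exact: (cvg_subseq nh (@cvg_harmonic R)).
have x0 j : x j != 0 by apply: energy_neq0; have [/andP[/(lt_trans _) h _] _ _] := xP j; exact: h.
have cm : fibre_max c (x (n j)) @[j --> \oo] --> l.
  apply/cvgrPdist_lt => e e0.
  have : \forall j \near \oo, (n j).+1%:R^-1 < e by apply: cvgr_lt n1 _ _.
  by apply: filterS => j; apply: lt_trans; have [_ h _] := xP (n j); rewrite distrC.
have w0 : w != 0.
  apply: (@fibre_max_weak_neq0 c (l + 1) (x \o n)) => // j /=; have [/andP[h _] h2 _] := xP (n j).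
    exact: ltW.
  have : (n j).+1%:R^-1 <= (1 : R) by rewrite invf_le1 ?ltr0n// ler1n.
  by move: h2; rewrite ltr_norml => /andP[_]; set o := _^-1; lra.
have ct : nehari_time c (x (n j)) @[j --> \oo] --> nehari_time c w.
  by apply: nehari_time_cvg => // k; split; [exact: F_lt0|exact: G_gt0].
have tp e : nehari_time c (x (n j)) `^ e @[j --> \oo] --> nehari_time c w `^ e.
  exact: powR_cvg (nehari_time_gt0 c0 w0) ct.
have cD : fibre_diff c (x (n j)) @[j --> \oo] --> 0.
  have h : 4 * (n j).+1%:R^-1 @[j --> \oo] --> (4 * 0 : R) by exact: cvgMl_tmp n1.
  rewrite mulr0 in h; apply/cvgr0Pnorm_lt => e e0.
  have : \forall j \near \oo, 4 * (n j).+1%:R^-1 < e by apply: cvgr_lt h _ _.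
  by apply: filterS => j; apply: le_lt_trans; have [] := xP (n j).
have cB := A9 xw; have cf := H2f xw; have cg := H2g xw.
have cA : exists L : dual W, As (x (n j)) @[j --> \oo] --> L.
  exists (J w *: 0 + l *: Bs w + nehari_time c w `^ (r - s) *: g w +
    nehari_time c w `^ (q - s) *: f w).
  rewrite (_ : (fun j => _) = fun j => J (x (n j)) *: fibre_diff c (x (n j)) +
      fibre_max c (x (n j)) *: Bs (x (n j)) +
      nehari_time c (x (n j)) `^ (r - s) *: g (x (n j)) +
      nehari_time c (x (n j)) `^ (q - s) *: f (x (n j))).
    exact: (cvgD (cvgD (cvgD (cvgZ cJ cD) (cvgZ cm cB)) (cvgZ (tp _) cg)) (cvgZ (tp _) cf)).
  apply/funext => j; rewrite /fibre_diff scalerA mulfV ?gt_eqF ?weight_gt0// scale1r.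
  by rewrite !subrK.
have {cA}[L cA] := cA.
have [C CP] := energy_sublevel_bounded 2.
have h1 : (As (x (n j)) (x (n j) - w) - L (x (n j) - w) : R^o) @[j --> \oo] --> (0 : R^o).
  apply: (@dual_cvg0 _ _ _ \oo _ _ _ (C + `|w|) _ cA).
  by apply: nearW => j; rewrite (le_trans (ler_normB _ _))// lerD2r CP.
have h2 : (L (x (n j) - w) : R^o) @[j --> \oo] --> (0 : R^o).
  rewrite (_ : (fun j => _) = fun j => L (x (n j)) - L w); last first.
    by apply/funext => j; rewrite dualB.
  have h : (L (x (n j)) - L w : R^o) @[j --> \oo] --> (L w - L w : R^o).
    by apply: cvgB; [exact: xw|exact: cvg_cst].
  by rewrite subrr in h.
have h3 : As (x (n j)) (x (n j) - w) @[j --> \oo] --> (0 : R).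
  rewrite -[0](@addr0 R^o) (_ : (fun j => _) = fun j =>
    (As (x (n j)) (x (n j) - w) - L (x (n j) - w)) + L (x (n j) - w)).
    exact: cvgD h1 h2.
  by apply/funext => j; rewrite /= subrK.
have [k kh xk] := A7 xw h3.
have cmk := cvg_subseq kh cm; have cDk := cvg_subseq kh cD.
apply: (ncrit w w0).
  exact: (cvg_unique _ (cvg_comp _ _ xk (fibre_max_continuous c0 w0)) cmk).
exact: (cvg_unique _ (cvg_comp _ _ xk (fibre_diff_continuous c0 w0)) cDk).
Qed.

Lemma fibre_value_shift c c' t u :
  fibre_value c' t u = fibre_value c t u - (c' - c) * t `^ (- s) / J u.
Proof. by rewrite /fibre_value /height; ring. Qed.

(** Both parameters are compared at the maximizing time of [c']; the maximizing time of [c] gives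
    the reverse bound [fibre_max_lipschitz]. *)
Lemma fibre_max_decreasing c c' u : 0 < c -> c < c' -> u != 0 ->
  fibre_max c' u <= fibre_max c u - (c' - c) * nehari_time c' u `^ (- s) / J u.
Proof.
move=> c0 cc' u0; have c'0 := lt_trans c0 cc'.
rewrite {1}/fibre_max (fibre_value_shift c) lerD2r.
exact: fibre_value_le (nehari_time_gt0 c'0 u0) u0.
Qed.

Lemma fibre_max_lipschitz c c' u : 0 < c -> c < c' -> u != 0 ->
  fibre_max c u - (c' - c) * nehari_time c u `^ (- s) / J u <= fibre_max c' u.
Proof.
move=> c0 cc' u0; have c'0 := lt_trans c0 cc'.
rewrite {1}/fibre_max -(fibre_value_shift c).
exact: fibre_value_le (nehari_time_gt0 c0 u0) u0.
Qed.

Lemma fibre_max_le c c' u : 0 < c -> c <= c' -> u != 0 -> fibre_max c' u <= fibre_max c u.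
Proof.
move=> c0; rewrite le_eqVlt => /orP[/eqP -> //|cc'] u0.
apply: le_trans (fibre_max_decreasing c0 cc' u0) _; rewrite gerBl.
by rewrite !mulr_ge0 ?powR_ge0 ?subr_ge0 ?invr_ge0 ?(ltW cc')// ltW// weight_gt0.
Qed.

(** * Estimates on the unit energy level *)

(** Only negative maxima need a bound; on that sublevel weak limits are nonzero, so already the
    value at time 1 is bounded below. *)
Lemma fibre_max_lower c : 0 < c -> exists b : R, forall u, I u = 1 -> b <= fibre_max c u.
Proof.
move=> c0; have [|C C0 hC] := @seq_bounded_above R W [set u | I u = 1 /\ fibre_max c u <= 0]
    (fun u => - fibre_value c 1 u).
  move=> u uS; have I1 j : I (u j) = 1 by have [] := uS j.
  have m0 j : fibre_max c (u j) <= 0 by have [] := uS j.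
  have [n [w [nh w0 _ cJ [cF cG]]]] := unit_sequence c0 I1 m0.
  exists n => //; exists (- (height q s r c 1 (F w) (G w) 1 / J w)).
  apply: cvgN; apply: fibre_value_cvg cJ cF cG _ => //.
  - by rewrite gt_eqF// weight_gt0.
  - by under eq_fun do rewrite I1; exact: cvg_cst.
  - exact: cvg_cst.
exists (- C) => u I1; have [m0|m0] := leP (fibre_max c u) 0.
  have u0 : u != 0 by apply: energy_neq0; rewrite I1 ltr01.
  have := hC u (conj I1 m0); have := fibre_value_le c0 ltr01 u0; lra.
by rewrite ltW// (lt_trans _ m0)// oppr_lt0.
Qed.

(** J and G are weakly continuous and positive at weak limits, which the bound on [fibre_max] keeps
    away from 0. *)
Lemma sublevel_lower c (a : R) : 0 < c -> exists2 d : R, 0 < d &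
  forall u, I u = 1 -> fibre_max c u <= a -> d <= J u /\ d <= G u.
Proof.
move=> c0; pose S := [set u | I u = 1 /\ fibre_max c u <= a].
have pos u : S u -> 0 < J u /\ 0 < G u.
  move=> [I1 _]; have u0 : u != 0 by apply: energy_neq0; rewrite I1 ltr01.
  by split; [exact: weight_gt0|exact: G_gt0].
have h (u : nat -> W) : (forall j, S (u j)) -> exists2 n, {homo n : i j / (i < j)%N} &
    exists2 w, w != 0 & J (u (n j)) @[j --> \oo] --> J w /\ G (u (n j)) @[j --> \oo] --> G w.
  move=> uS; have I1 j : I (u j) = 1 by have [] := uS j.
  have m0 j : fibre_max c (u j) <= a by have [] := uS j.
  have [n [w [nh w0 _ cJ [cF cG]]]] := unit_sequence c0 I1 m0.
  by exists n => //; exists w.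
have [|C C0 hC] := @seq_bounded_above R W S (fun u => (J u)^-1).
  move=> u /h[n nh [w w0 [cJ _]]]; exists n => //; exists (J w)^-1.
  by apply: cvgV cJ; rewrite gt_eqF// weight_gt0.
have [|C' C'0 hC'] := @seq_bounded_above R W S (fun u => (G u)^-1).
  move=> u /h[n nh [w w0 [_ cG]]]; exists n => //; exists (G w)^-1.
  by apply: cvgV cG; rewrite gt_eqF// G_gt0.
exists (Num.min C^-1 C'^-1); first by rewrite lt_min !invr_gt0 C0.
move=> u I1 m1; have Su : S u by [].
have [J0 G0] := pos u Su; rewrite !ge_min; split; apply/orP; [left|right].
  by rewrite invf_ple ?posrE// hC.
by rewrite invf_ple ?posrE// hC'.
Qed.

Lemma energy_unit_upper : exists2 C : R, 0 < C &
  forall u, I u = 1 -> [/\ J u <= C, - F u <= C & G u <= C].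
Proof.
pose S := [set u | I u = 1].
have h (u : nat -> W) : (forall j, S (u j)) -> exists2 n, {homo n : i j / (i < j)%N} &
    exists w, [/\ J (u (n j)) @[j --> \oo] --> J w, F (u (n j)) @[j --> \oo] --> F w &
      G (u (n j)) @[j --> \oo] --> G w].
  move=> uS; have I1 j : I (u j) <= 1 by rewrite uS.
  have [n [w [nh _ cJ cF cG]]] := energy_sublevel_compact I1.
  by exists n => //; exists w.
have [|C C0 hC] := @seq_bounded_above R W S J.
  by move=> u /h[n nh [w [cJ _ _]]]; exists n => //; exists (J w).
have [|C' C'0 hC'] := @seq_bounded_above R W S (fun u => - F u).
  move=> u /h[n nh [w [_ cF _]]]; exists n => //; exists (- F w); exact: cvgN cF.
have [|C'' C''0 hC''] := @seq_bounded_above R W S G.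
  by move=> u /h[n nh [w [_ _ cG]]]; exists n => //; exists (G w).
exists (C + C' + C''); first by rewrite !addr_gt0.
by move=> u I1; have := hC u I1; have := hC' u I1; have := hC'' u I1; split; lra.
Qed.

(** The slope with the extreme data [- C] and [C] lies below the slope of every [u] of unit energy
    and every [c' >= c], so its zero comes first. *)
Lemma nehari_time_lower c : 0 < c -> exists2 t : R, 0 < t &
  forall c' u, c <= c' -> I u = 1 -> t <= nehari_time c' u.
Proof.
move=> c0; have [C C0 hC] := energy_unit_upper; have NC0 : - C < 0 by rewrite oppr_lt0.
have [t0 tE] := peakP q_gt0 q_lt_s s_lt_r c0 NC0 C0; set t := peak _ _ _ _ _ _ in t0 tE.
exists t => // c' u cc' I1; have u0 : u != 0 by apply: energy_neq0; rewrite I1 ltr01.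
have c'0 := lt_le_trans c0 cc'.
rewrite leNgt (gt_peak q_gt0 q_lt_s s_lt_r c'0 (F_lt0 u0) (G_gt0 u0) t0) -leNgt -tE.
have [_ F1 G1] := hC u I1; rewrite /slope.
have h1 : (s - q) * t `^ q * (- C) <= (s - q) * t `^ q * F u.
  by rewrite ler_wpM2l ?mulr_ge0 ?powR_ge0 ?subr_ge0 ?(ltW q_lt_s)//; lra.
have h2 : (r - s) * t `^ r * G u <= (r - s) * t `^ r * C.
  by rewrite ler_wpM2l ?mulr_ge0 ?powR_ge0 ?subr_ge0 ?(ltW s_lt_r).
have h3 : c * s <= c' * s by rewrite ler_wpM2r// ltW.
move: h1 h2 h3; set P := _ `^ q; set Q := _ `^ r; lra.
Qed.

Lemma nehari_time_upper c (a : R) : 0 < c -> exists2 t : R, 0 < t &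
  forall u, I u = 1 -> fibre_max c u <= a -> nehari_time c u <= t.
Proof.
move=> c0; have [|C C0 hC] := @seq_bounded_above R W [set u | I u = 1 /\ fibre_max c u <= a]
    (nehari_time c).
  move=> u uS; have I1 j : I (u j) = 1 by have [] := uS j.
  have m0 j : fibre_max c (u j) <= a by have [] := uS j.
  have [n [w [nh w0 _ cJ [cF cG]]]] := unit_sequence c0 I1 m0.
  exists n => //; exists (nehari_time c w).
  apply: nehari_time_cvg => // k; have u0 : u (n k) != 0.
    by apply: energy_neq0; rewrite I1 ltr01.
  by split; [exact: F_lt0|exact: G_gt0].
by exists C => // u I1 m1; exact: hC.
Qed.

Lemma powRN_le (x y : R) : 0 < x -> x <= y -> y `^ (- s) <= x `^ (- s).
Proof.
move=> x0 xy; have y0 := lt_le_trans x0 xy; rewrite !powRN lef_pV2 ?posrE ?powR_gt0//.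
by apply: (ge0_ler_powR (ltW s_gt0)); rewrite ?nnegrE// ltW.
Qed.

(** The rate t^(-s) / J of decrease is bounded below by means of upper bounds for the maximizing
    time and for J. *)
Lemma fibre_max_gap c c' (a : R) : 0 < c -> c < c' -> exists2 d : R, 0 < d &
  forall u, I u = 1 -> fibre_max c u <= a -> fibre_max c' u <= fibre_max c u - d.
Proof.
move=> c0 cc'; have c'0 := lt_trans c0 cc'; have [C C0 hC] := energy_unit_upper.
have [t t0 ht] := nehari_time_upper a c'0.
exists ((c' - c) * t `^ (- s) / C).
  by rewrite !mulr_gt0 ?subr_gt0 ?invr_gt0 ?powR_gt0.
move=> u I1 m1; have u0 : u != 0 by apply: energy_neq0; rewrite I1 ltr01.
apply: (le_trans (fibre_max_decreasing c0 cc' u0)); rewrite lerD2l lerN2.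
have m2 : fibre_max c' u <= a by exact: le_trans (fibre_max_le c0 (ltW cc') u0) m1.
have [J1 _ _] := hC u I1; have J0 := weight_gt0 u0.
apply: ler_pM; rewrite ?mulr_ge0 ?invr_ge0 ?powR_ge0 ?subr_ge0 ?(ltW cc') ?(ltW C0)//.
  by rewrite ler_wpM2l ?subr_ge0 ?(ltW cc')// powRN_le ?nehari_time_gt0// ht.
by rewrite lef_pV2.
Qed.

(** The rate of change is bounded above by means of lower bounds for the time and for J; the latter
    comes from the sublevel at [c2], which contains those at smaller parameters. *)
Lemma fibre_max_uniform c1 c2 (a : R) : 0 < c1 -> c1 < c2 -> exists2 K : R, 0 < K &
  forall c c' u, c1 <= c -> c < c' -> c' <= c2 -> I u = 1 -> fibre_max c' u <= a ->
    fibre_max c u <= fibre_max c' u + K * (c' - c).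
Proof.
move=> c10 c12; have c20 := lt_trans c10 c12.
have [t t0 ht] := nehari_time_lower c10; have [d d0 hd] := sublevel_lower a c20.
exists (t `^ (- s) / d); first by rewrite divr_gt0// powR_gt0.
move=> c c' u cc cc' c'c I1 m1; have u0 : u != 0 by apply: energy_neq0; rewrite I1 ltr01.
have c0 := lt_le_trans c10 cc; have c'0 := lt_trans c0 cc'.
have h := fibre_max_lipschitz c0 cc' u0.
have [|J1 _] := hd u I1 _; first exact: le_trans (fibre_max_le c'0 c'c u0) m1.
have J0 := weight_gt0 u0.
suff : (c' - c) * nehari_time c u `^ (- s) / J u <= t `^ (- s) / d * (c' - c) by lra.
rewrite -mulrA mulrC ler_wpM2r ?subr_ge0 ?(ltW cc')//.
apply: ler_pM; rewrite ?powR_ge0 ?invr_ge0 ?(ltW J0)//; last by rewrite lef_pV2.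
by rewrite powRN_le// ht.
Qed.

(** In the limit of counterexamples the height without its term in c would be at most K J(w) at
    every time. But t^(q - s), which multiplies the positive number - F(w), is unbounded as t tends
    to 0. *)
Lemma fibre_max_at0 (K : R) : exists2 c0 : R, 0 < c0 &
  forall c u, 0 < c -> c < c0 -> I u = 1 -> K <= fibre_max c u.
Proof.
apply: contrapT => /forall2NP nK.
have /choice[p pP] (j : nat) : exists p : R * W,
    [/\ 0 < p.1, p.1 < j.+1%:R^-1, I p.2 = 1 & fibre_max p.1 p.2 < K].
  have [/negP|] := nK j.+1%:R^-1; first by rewrite invr_gt0 ltr0n.
  move=> /existsNP[c /existsNP[u]] /not_implyP[c0] /not_implyP[cj] /not_implyP[I1 /negP].
  by rewrite -ltNge => h; exists (c, u).
pose c j := (p j).1; pose u j := (p j).2.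
have c0 j : 0 < c j by have [] := pP j.
have cj j : c j < j.+1%:R^-1 by have [] := pP j.
have I1 j : I (u j) = 1 by have [] := pP j.
have mK j : fibre_max (c j) (u j) <= K by have [_ _ _ /ltW] := pP j.
have u0 j : u j != 0 by apply: energy_neq0; rewrite I1 ltr01.
have c1 j : c j <= 1 by rewrite (le_trans (ltW (cj j)))// invf_le1 ?ltr0n// ler1n.
have m1 j : fibre_max 1 (u j) <= K by rewrite (le_trans _ (mK j))// fibre_max_le.
have [n [w [nh w0 _ cJ [cF cG]]]] := unit_sequence ltr01 I1 m1.
have cc : c (n j) @[j --> \oo] --> (0 : R).
  have n1 : (n j).+1%:R^-1 @[j --> \oo] --> (0 : R).
    exact: (cvg_subseq nh (@cvg_harmonic R)).
  apply: (squeeze_cvgr _ (cvg_cst 0) n1).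
  by apply: nearW => j; rewrite (ltW (c0 _)) (ltW (cj _)).
have Jw := weight_gt0 w0; have Fw := F_lt0 w0; have Gw := G_gt0 w0.
have lim_le t : 0 < t ->
    (1 - t `^ (q - s) * F w - t `^ (r - s) * G w) / J w <= K.
  move=> t0.
  have h : (1 - t `^ (q - s) * F (u (n j)) - t `^ (r - s) * G (u (n j))
      - c (n j) * t `^ (- s)) / J (u (n j)) @[j --> \oo] -->
      (1 - t `^ (q - s) * F w - t `^ (r - s) * G w - 0 * t `^ (- s)) / J w.
    apply: cvgM; last by apply: cvgV cJ; rewrite gt_eqF.
    apply: cvgB; last exact: cvgMr_tmp cc.
    apply: cvgB; last exact: cvgMl_tmp cG.
    apply: cvgB; last exact: cvgMl_tmp cF.
    exact: cvg_cst.
  rewrite mul0r subr0 in h.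
  apply: (cvgr_to_le h); apply: nearW => j; apply: le_trans (mK (n j)).
  by have := fibre_value_le (c0 (n j)) t0 (u0 (n j)); rewrite /fibre_value /height I1.
(* Chosen so that z times - F(w) exceeds - F(w) by |K| J(w) + G(w). As z >= 1, the time with t^(q -
   s) = z is at most 1 and the term in G costs at most G(w). *)
pose z := 1 + (`|K| * J w + G w) / (- F w).
have e0 : 0 <= (`|K| * J w + G w) / (- F w).
  by rewrite divr_ge0// ?oppr_ge0 ?(ltW Fw)// addr_ge0 ?(ltW Gw)// mulr_ge0// ltW.
have z1 : 1 <= z by rewrite /z lerDl.
have qs : q - s < 0 by rewrite subr_lt0.
pose t := z `^ (q - s)^-1; have t0 : 0 < t by rewrite powR_gt0// (lt_le_trans ltr01).
have tq : t `^ (q - s) = z.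
  by rewrite -powRrM mulVf ?lt_eqF// powRr1// (le_trans ler01).
have tr : t `^ (r - s) <= 1.
  rewrite -powRrM -[leRHS](powRr0 z); apply: ler_powR => //.
  by rewrite mulr_le0_ge0 ?invr_le0 ?subr_ge0 ?ltW.
have := lim_le t t0; rewrite tq ler_pdivrMr//.
have h1 : z * - F w = - F w + `|K| * J w + G w.
  by rewrite /z mulrDl mul1r divfK ?addrA// oppr_eq0 lt_eqF.
have h2 : t `^ (r - s) * G w <= G w by rewrite ler_piMl// ltW.
have h3 : K * J w <= `|K| * J w by rewrite ler_wpM2r ?ler_norm// ltW.
by move: h1 h2 h3; set P := _ `^ _; lra.
Qed.

(** Times beyond [tau] are handled by the term in G, bounded below on the sublevel; times before
    [tau] by c' t^(-s) with c' large. [L] is chosen such that 1 - L = - |K| C. *)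
Lemma fibre_max_atinfty c (a K : R) : 0 < c -> exists2 c1 : R, 0 < c1 &
  forall c' u, c1 <= c' -> I u = 1 -> fibre_max c u <= a -> fibre_max c' u <= - K.
Proof.
move=> c0; have [C C0 hC] := energy_unit_upper; have [d d0 hd] := sublevel_lower a c0.
pose L := 1 + `|K| * C; have L0 : 0 < L by rewrite ltr_pwDl// mulr_ge0// ltW.
pose tau := (1 + (C + L) / d) `^ (r - s)^-1.
have e0 : 0 <= (C + L) / d by rewrite divr_ge0// ?(ltW d0)// addr_ge0// ltW.
have z0 : 0 < 1 + (C + L) / d by rewrite ltr_pwDl.
have tau0 : 0 < tau by exact: powR_gt0.
have rs : 0 < r - s by rewrite subr_gt0.
have tau1 : 1 <= tau.
  rewrite /tau -[leLHS](powRr0 (1 + (C + L) / d)); apply: ler_powR; first by rewrite lerDl.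
  by rewrite invr_ge0 ltW.
have taur : tau `^ (r - s) = 1 + (C + L) / d.
  by rewrite -powRrM mulVf ?gt_eqF// powRr1// ltW.
(* For t < tau and after multiplication by t^(-s), the summand C tau^q absorbs the term in F and L
   tau^s yields at least L. *)
pose c1 := c + C * tau `^ q + L * tau `^ s.
have c10 : 0 < c1 by rewrite /c1 -addrA ltr_pwDl// addr_ge0// mulr_ge0 ?powR_ge0// ltW.
exists c1 => // c' u c1c' I1 m1; have u0 : u != 0 by apply: energy_neq0; rewrite I1 ltr01.
have c'0 := lt_le_trans c10 c1c'; have T0 := nehari_time_gt0 c'0 u0.
have [_ G1] := hd u I1 m1; have [J1 F1 _] := hC u I1.
have Jw := weight_gt0 u0; have Fw := F_lt0 u0; have Gw := G_gt0 u0.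
rewrite /fibre_max /fibre_value ler_pdivrMr// /height I1.
set t := nehari_time c' u in T0 *.
have KJ : - K * J u >= - (`|K| * C).
  have : K * J u <= `|K| * C by apply: le_trans (ler_norm _) _; rewrite normrM ler_wpM2l// gtr0_norm.
  by rewrite mulNr; lra.
suff : 1 + t `^ (q - s) * C - t `^ (r - s) * d - c' * t `^ (- s) <= - (`|K| * C).
  have h1 : t `^ (q - s) * - F u <= t `^ (q - s) * C by rewrite ler_wpM2l ?powR_ge0.
  have h2 : t `^ (r - s) * d <= t `^ (r - s) * G u by rewrite ler_wpM2l ?powR_ge0.
  by move: h1 h2; set P := _ `^ (q - s); set Q := _ `^ (r - s); set S := _ `^ _; lra.
have S0 : 0 <= t `^ (- s) by exact: powR_ge0.
have [tt|tt] := leP tau t.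
  have t1 : 1 <= t := le_trans tau1 tt.
  have h1 : t `^ (q - s) * C <= C.
    rewrite ler_piMl ?(ltW C0)// -[leRHS](powRr0 t); apply: ler_powR => //.
    by rewrite subr_le0 ltW.
  have h2 : C + L <= t `^ (r - s) * d.
    rewrite -ler_pdivrMr//; apply: (@le_trans _ _ (tau `^ (r - s))); first by rewrite taur lerDr.
    by apply: (ge0_ler_powR (ltW rs)); rewrite ?nnegrE ?(ltW tau0) ?(ltW T0).
  have h3 : 0 <= c' * t `^ (- s) by rewrite mulr_ge0// ltW.
  by move: h1 h2 h3; rewrite /L; set P := _ `^ (q - s); set Q := _ `^ (r - s); set S := _ `^ _; lra.
have h1 : t `^ (q - s) * C <= t `^ (- s) * (tau `^ q * C).
  rewrite addrC powRD; last by rewrite (gt_eqF T0) implybT.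
  rewrite -mulrA ler_wpM2l// ler_wpM2r ?(ltW C0)//.
  by apply: (ge0_ler_powR (ltW q_gt0)); rewrite ?nnegrE ?(ltW tau0) ?(ltW T0) ?(ltW tt).
have h2 : L <= t `^ (- s) * (L * tau `^ s).
  rewrite mulrCA ler_peMr ?(ltW L0)// -[leLHS](_ : tau `^ (- s) * tau `^ s = 1).
    by rewrite ler_wpM2r ?powR_ge0// powRN_le// ltW.
  by rewrite powRN mulVf// gt_eqF// powR_gt0.
have h3 : t `^ (- s) * c1 <= t `^ (- s) * c' by rewrite ler_wpM2l.
have h4 : 0 <= t `^ (r - s) * d by rewrite mulr_ge0 ?powR_ge0 ?(ltW d0).
have h5 : 0 <= t `^ (- s) * c by rewrite mulr_ge0 ?(ltW c0).
move: h1 h2 h3 h4 h5; rewrite /c1 /L; set P := t `^ (q - s); set Q := t `^ (r - s).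
by set S := t `^ (- s); set X := tau `^ _; set Y := tau `^ _; lra.
Qed.

(** Finitely many vectors e_i suffice for u -> (Bs u e_i) to have no zero on the sublevel, and
    [fr_index_le] applies. Otherwise there are points u_n with [Bs u_n] vanishing on all earlier
    vectors and half normed by a new one; this contradicts norm convergence of a subsequence to a
    nonzero limit. *)
Lemma fr_index_sublevel c (a : R) : 0 < c -> exists m : nat,
  (fr_index [set u | I u = 1%R /\ fibre_max c u <= a]%R <= m%:R%:E)%E.
Proof.
move=> c0; set S := [set u | I u = 1 /\ fibre_max c u <= a].
suff [l lP] : exists l : seq W, forall u, S u -> exists2 e, e \in l & Bs u e != 0.
  exists (size l); apply: (@fr_index_le _ _ _ _ (fun u => \row_(i < size l) Bs u l`_i)).
  - move=> u [I1 m1]; split; first by rewrite (potentialN (scaled_odd As_scaled)).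
    by rewrite fibre_maxN.
  - apply: continuous_subspaceT => u; apply: cvg_rV => j.
    rewrite mxE; under eq_fun do rewrite mxE.
    have h : (Bs v l`_j : R^o) @[v --> u] --> (Bs u l`_j : R^o).
      by apply: (@dual_cvg _ _ _ (nbhs u) Bs (Bs u) (fun=> l`_j) l`_j); [exact: Bp.1|exact: cvg_cst].
    exact: h.
  - by move=> u Su; apply/rowP => j; rewrite !mxE (scaled_odd Bs_scaled) dual_oppE.
  - move=> u /lP[e el]; apply: contraNneq => /rowP/(_ (Ordinal (etrans (index_mem e l) el))).
    by rewrite !mxE nth_index// => ->.
apply: contrapT => /forallNP nl.
(* With b the norm of the limit and errors below b/8, a value of at least half of 7b/8 would have to
   be less than 2b/8. *)
have lin (b x1 x2 p1 p2 p3 y z m : R) : x1 < b / 8 -> x2 < b / 8 -> p3 <= p1 ->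
    z <= p2 -> p1 <= x1 -> p2 <= x2 -> b <= x1 + m -> y <= p3 + z -> m / 2 <= y ->
    0 < b -> False by move=> *; lra.
have /choice[h hP] (l : seq W) : exists p : W * W, [/\ S p.1, `|p.2| <= 1,
    `|Bs p.1| / 2 <= `|Bs p.1 p.2| & forall e, e \in l -> Bs p.1 e = 0].
  have /existsNP[u /not_implyP[Su /forall2NP nu]] := nl l.
  have Be e : e \in l -> Bs u e = 0.
    by move=> el; have [//|/negP] := nu e; rewrite negbK => /eqP.
  suff [e e1 he] : exists2 e : W, `|e| <= 1 & `|Bs u| / 2 <= `|Bs u e|.
    by exists (u, e).
  apply: contrapT => /forall2NP ne.
  have B0 : 0 < `|Bs u|.
    rewrite normr_gt0; apply/eqP => B0.
    have u0 : u != 0 by apply: energy_neq0; rewrite Su.1 ltr01.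
    by have := A8 u0; rewrite B0 ltxx.
  have : `|Bs u| <= `|Bs u| / 2.
    apply: dual_norm_le => e e1; have [//|/negP] := ne e.
    by rewrite -ltNge => /ltW.
  by lra.
pose L := fix L n : seq W := if n is m.+1 then (h (L m)).2 :: L m else [::].
pose u n := (h (L n)).1; pose e n := (h (L n)).2.
have eL i j : (i < j)%N -> e i \in L j.
  elim: j => // j ih; rewrite ltnS leq_eqVlt => /orP[/eqP ->|/ih ij].
    exact: mem_head.
  by rewrite /= inE ij orbT.
have Su j : S (u j) by have [] := hP (L j).
have I1 j : I (u j) = 1 by have [] := Su j.
have m1 j : fibre_max c (u j) <= a by have [] := Su j.
have [n [w [nh w0 uw _ _]]] := unit_sequence c0 I1 m1.
have cB := A9 uw.
have B0 : 0 < `|Bs w|.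
  by rewrite normr_gt0; apply/eqP => B0; have := A8 w0; rewrite B0 ltxx.
have : \forall j \near \oo, `|Bs w - Bs (u (n j))| < `|Bs w| / 8.
  by apply: cvgr_dist_lt cB _ _; rewrite divr_gt0.
move=> [N _ hN]; have b1 := hN N (leqnn N); have b2 := hN N.+1 (leqnSn N).
rewrite /= in b1 b2.
have [_ e1 hb _] := hP (L (n N)); have [_ _ _ hz] := hP (L (n N.+1)).
have z : Bs (u (n N.+1)) (e (n N)) = 0 by apply: hz; apply: eL; exact: nh.
have d1 := dual_le (Bs w - Bs (u (n N))) (e (n N)).
have d2 := dual_le (Bs w - Bs (u (n N.+1))) (e (n N)).
have d1' : `|Bs w - Bs (u (n N))| * `|e (n N)| <= `|Bs w - Bs (u (n N))| by rewrite ler_piMr.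
have d2' : `|Bs w - Bs (u (n N.+1))| * `|e (n N)| <= `|Bs w - Bs (u (n N.+1))| by rewrite ler_piMr.
rewrite dual_subE in d1; rewrite dual_subE z subr0 in d2.
have n1 := ler_normD (Bs w - Bs (u (n N))) (Bs (u (n N))); rewrite subrK in n1.
have n2 := ler_normD (- (Bs w (e (n N)) - Bs (u (n N)) (e (n N)))) (Bs w (e (n N))).
rewrite normrN opprB subrK in n2.
have hb' : `|Bs (u (n N))| / 2 <= `|Bs (u (n N)) (e (n N))| := hb.
exact: lin b1 b2 d1 d2 d1' d2' n1 n2 hb' B0.
Qed.

(** * Minimax levels *)

(** The scaling is continuous relative to t >= 0 only; a positive limit time eventually keeps the
    sequence there. *)
Lemma scaling_cvg (T : Type) (H : set_system T) (FH : Filter H) (u : T -> W) (a : T -> R) v t :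
  0 < t -> u k @[k --> H] --> v -> a k @[k --> H] --> t ->
  sc (u k) (a k) @[k --> H] --> sc v t.
Proof.
move=> t0 uv at_; pose A := [set x : W * R | 0 <= x.2].
have /subspace_continuousP/(_ (v, t) (ltW t0)) h := scaling_continuous scP.
have ua : (u k, a k) @[k --> H] --> (v, t) by exact: cvg_pair uv at_.
have a0 : \forall k \near H, A (u k, a k).
  have : \forall k \near H, 0 < a k by apply: cvgr_gt at_ _ _.
  by apply: filterS => k /ltW.
have {}ua : (u k, a k) @[k --> H] --> within A (nbhs (v, t)).
  move=> P /= PA; have : \forall k \near H, A (u k, a k) -> P (u k, a k) by exact: ua PA.
  by move: a0; apply: filterS2 => k Ak; apply.
exact: (cvg_comp _ _ ua h).
Qed.

Definition energy_normalize u := sc u (I u `^ (- s^-1)).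

Lemma energy_normalize_gt0 u : u != 0 -> 0 < I u `^ (- s^-1).
Proof. by move=> u0; rewrite powR_gt0// energy_gt0. Qed.

Lemma energy_normalizeE u : u != 0 -> I (energy_normalize u) = 1.
Proof.
move=> u0; have I0 := energy_gt0 u0.
have t0 : 0 <= I u `^ (- s^-1) by exact: powR_ge0.
rewrite /energy_normalize (energy_scale u t0) -powRrM mulNr mulVf ?(gt_eqF s_gt0)//.
by rewrite (powR_inv1 (ltW I0)) mulVf// (gt_eqF I0).
Qed.

Lemma energy_normalizeN u : energy_normalize (- u) = - energy_normalize u.
Proof.
rewrite /energy_normalize (potentialN (scaled_odd As_scaled)).
by apply: scalingN; exact: powR_ge0.
Qed.

Lemma energy_normalize_continuous x : x != 0 -> {for x, continuous energy_normalize}.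
Proof.
move=> x0; apply: scaling_cvg; [exact: energy_normalize_gt0|exact: cvg_id|].
by apply: powR_cvg; [exact: energy_gt0|exact: (potential_continuous Ap)].
Qed.

Lemma fr_index_image (M : set W) (h : W -> W) : symmetric_set M ->
  {within M, continuous h} -> (forall u, M u -> h (- u) = - h u) ->
  symmetric_set (h @` M) /\ (fr_index M <= fr_index (h @` M))%E.
Proof.
move=> MN ch hN; have hMN : symmetric_set (h @` M).
  by move=> _ [u Mu <-]; exists (- u); [exact: MN|exact: hN].
by split=> //; apply: (fr_index_mono MN hMN ch _ hN) => u Mu; exists u.
Qed.

Local Notation lam := (minimax sc As Bs f g).

Lemma minimax_le c k (a : R) (M : set W) : 0 < c -> (forall u, M u -> u != 0) ->
  symmetric_set M -> (k%:R%:E <= fr_index M)%E -> (forall u, M u -> fibre_max c u <= a) ->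
  (lam c k <= a%:E)%E.
Proof.
move=> c0 M0 MN Mk Ma; pose h u := sc u (nehari_time c u).
have [|u /M0 u0|hMN hk] := @fr_index_image M h MN.
- apply/subspace_continuousP => x /M0 x0; apply: cvg_within_filter.
  by apply: scaling_cvg; [exact: nehari_time_gt0|exact: cvg_id|exact: nehari_time_continuous].
- by rewrite /h nehari_timeN scalingN// ltW// nehari_time_gt0.
apply: (@le_trans _ _ (ereal_sup [set (lambda_fun As Bs f g c u)%:E | u in h @` M])).
  apply: ereal_inf_lbound; exists (h @` M) => //; split=> //; last exact: le_trans hk.
  by move=> _ [u Mu <-]; apply: nehari_project => //; exact: M0.
apply: ge_ereal_sup => _ [_ [u Mu <-] <-]; rewrite lee_fin fibre_max_project//; last exact: M0.
exact: Ma.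
Qed.

Lemma minimax_lt c k (a : R) : 0 < c -> (lam c k < a%:E)%E -> exists M : set W,
  [/\ forall u, M u -> I u = 1, symmetric_set M, (k%:R%:E <= fr_index M)%E &
      forall u, M u -> fibre_max c u < a].
Proof.
move=> c0 /ereal_inf_lt[_ [M [Mn MN Mk] <-] sa].
have M0 u : M u -> u != 0 by move=> /Mn /nehariE[].
have [|u _|hMN hk] := @fr_index_image M energy_normalize MN.
- apply/subspace_continuousP => x /M0 x0; apply: cvg_within_filter.
  exact: energy_normalize_continuous.
- exact: energy_normalizeN.
exists (energy_normalize @` M); split=> //.
- by move=> _ [u Mu <-]; apply: energy_normalizeE; exact: M0.
- exact: le_trans hk.
- move=> _ [u Mu <-]; rewrite fibre_max_scale ?energy_normalize_gt0 ?M0//.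
  rewrite -fibre_max_nehari//; last exact: Mn.
  by rewrite -lte_fin; apply: le_lt_trans sa; apply: ereal_sup_ubound; exists u.
Qed.

(** Mean value theorem with a bound for [As] on a ball slightly larger than the unit energy level:
    moving by [d] changes the energy by at most 1/4. *)
Lemma energy_uniform : exists2 d : R, 0 < d &
  forall x y, I x = 1 -> `|x - y| <= d -> 2^-1 < I y < 2.
Proof.
have [C CP] := energy_sublevel_bounded 1.
pose B := [set u : W | `|u| <= C + 1].
have bB : bounded_set B.
  by exists (C + 1); split; [exact: num_real|move=> K CK u uB; exact: le_trans (ltW CK)].
have [K0 [_ hK]] := scaled_bounded As_scaled bB.
pose K := Num.max 1 (K0 + 1); have K1 : 0 < K by rewrite lt_max ltr01.
have hK' u : B u -> `|As u| <= K.
  by move=> Bu; apply: (hK K); [rewrite lt_max ltrDl ltr01 orbT|exists u].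
exists (Num.min 1 (K^-1 / 4)); first by rewrite lt_min ltr01 !mulr_gt0// invr_gt0.
move=> x y I1; rewrite le_min => /andP[d1 d2].
have [t /andP[t0 t1] E] := potential_mvt Ap x (y - x).
have xC : `|x| <= C by apply: CP; rewrite I1.
have yx : `|y - x| <= 1 by rewrite distrC.
have Bz : B (x + t *: (y - x)).
  rewrite /B /= (le_trans (ler_normD _ _))// lerD// normrZ gtr0_norm//.
  by rewrite (le_trans _ yx)// ler_piMl// ltW.
have h : `|As (x + t *: (y - x)) (y - x)| <= 4^-1.
  apply: (le_trans (dual_le _ _)); apply: (@le_trans _ _ (K * `|y - x|)).
    by rewrite ler_wpM2r// hK'.
  by rewrite distrC mulrC -ler_pdivlMr// mulrC.
move: E h; rewrite [x + (y - x)]addrC subrK I1 => <-.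
by rewrite ler_norml => /andP[h1 h2]; apply/andP; split; lra.
Qed.

Lemma minimax_critical c k (l : R) : 0 < c -> lam c k = l%:E ->
  exists x, [/\ x != 0, fibre_max c x = l & fibre_diff c x = 0].
Proof.
move=> c0 lE; apply: contrapT => /forallNP nx.
have [x x0 ml D0|e [sigma [e0 s0 PS]]] := @palais_smale c l c0.
  exact: (nx x).
have [d d0 hd] := energy_uniform.
pose Y := [set x | 2^-1 < I x < 2].
have Y0 x : Y x -> x != 0.
  by move=> /andP[h _]; apply: energy_neq0; apply: lt_trans h; rewrite invr_gt0.
(* With a band of this width the polygons have length at most 2 e' / sigma <= d, so they stay where
   the energy is between 1/2 and 2 and the Palais-Smale estimate holds. *)
pose e' := Num.min e (sigma * d / 2).
have e'0 : 0 < e' by rewrite lt_min e0 divr_gt0// mulr_gt0.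
have e'e : e' <= e by rewrite ge_min lexx.
have e'd : (l + e' - (l - e')) / sigma <= d.
  rewrite ler_pdivrMr//; have : e' <= sigma * d / 2 by rewrite ge_min lexx orbT.
  by lra.
have [|M [M1 MN Mk Ml]] := @minimax_lt c k (l + e') c0.
  by rewrite lE lte_fin ltrDl.
have oY : open Y.
  have cI := potential_continuous Ap.
  rewrite openE => x /andP[h1 h2]; rewrite /interior /=.
  have n1 : \forall y \near x, 2^-1 < I y by apply: cvgr_gt (cI x) _ _.
  have n2 : \forall y \near x, I y < 2 by apply: cvgr_lt (cI x) _ _.
  by move: n1 n2; apply: filterS2 => y k1 k2; rewrite /Y /= k1 k2.
have YN : symmetric_set Y.
  by move=> x; rewrite /Y /= (potentialN (scaled_odd As_scaled)).
have Mc x : Y x -> {for x, continuous (fibre_max c)}.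
  by move=> /Y0; exact: fibre_max_continuous.
have Dc x : Y x -> {for x, continuous (fibre_diff c)}.
  by move=> /Y0; exact: fibre_diff_continuous.
have Dm x (e1 : R) : Y x -> 0 < e1 -> exists2 d1 : R, 0 < d1 &
    forall z v t, `|x - z| < d1 -> `|v| <= 1 -> 0 <= t <= d1 ->
      fibre_max c (z + t *: v) <= fibre_max c z + t * (fibre_diff c x v + e1).
  by move=> /Y0; exact: fibre_max_diff.
have Ds x : Y x -> l - e' < fibre_max c x < l + e' ->
    exists2 v, `|v| <= 1 & fibre_diff c x v <= - (4 * sigma).
  move=> Yx /andP[h1 h2]; apply: PS => //; apply: lt_le_trans e'e.
  by rewrite ltr_norml; apply/andP; split; lra.
have [| | |eta [ceta etaN etaM]] := @deformation R W Y (fibre_max c) (fibre_diff c)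
    (l - e') (l + e') sigma oY YN Mc (fibre_maxN c) Dc (fibre_diffN c) Dm s0 Ds M (l - e' / 2) _ _ Ml.
- by lra.
- by lra.
- by move=> x y Mx xy; apply: (hd x y (M1 x Mx)); exact: le_trans e'd.
have [hMN hk] := fr_index_image MN ceta etaN.
have : (lam c k <= (l - e' / 2)%:E)%E.
  apply: (@minimax_le c k _ (eta @` M)) => //.
  - by move=> _ [u Mu <-]; apply: Y0; exact: (etaM u Mu).1.
  - exact: le_trans hk.
  - by move=> _ [u Mu <-]; apply: ltW; exact: (etaM u Mu).2.
by rewrite lE lee_fin; lra.
Qed.

(** * Finiteness and growth of the minimax levels *)

Hypothesis W_infinite : infinite_dimensional W.

Lemma independent_sequence : exists e : nat -> W,
  forall n (a : nat -> R), \sum_(i < n) a i *: e i = 0 -> forall i, (i < n)%N -> a i = 0.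
Proof.
have /choice[h hP] (l : seq W) : exists u, forall a : 'I_(size l) -> R,
    u <> \sum_(i < size l) a i *: l`_i.
  exact: W_infinite (fun i : 'I_(size l) => l`_i).
pose L := fix L n : seq W := if n is m.+1 then rcons (L m) (h (L m)) else [::].
pose e n := h (L n); exists e.
have LE n : L n = mkseq e n by elim: n => // n ih; rewrite mkseqS -ih.
have eP n (a : nat -> R) : e n <> \sum_(i < n) a i *: e i.
  move=> E; apply: (hP (L n) (fun i => a i)); rewrite -/(e n) E.
  rewrite -(big_mkord xpredT (fun i => a i *: (L n)`_i)) LE size_mkseq big_mkord.
  by apply: eq_bigr => i _; rewrite nth_mkseq.
elim=> // n ih a; rewrite big_ord_recr /= => E.
have an : a n = 0.
  apply: contrapT => /eqP an; apply: (eP n (fun i => - (a n)^-1 * a i)).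
  move: E => /eqP; rewrite addrC addr_eq0 => /eqP E.
  rewrite -[LHS](scale1r) -(mulVf an) -scalerA E scalerN -scaleNr scaler_sumr.
  by apply: eq_bigr => i _; rewrite scalerA.
move: E; rewrite an scale0r addr0 => /ih ai i; rewrite ltnS leq_eqVlt => /orP[/eqP -> //|].
exact: ai.
Qed.

(** The l1 sphere of a (k + 1)-dimensional subspace, brought to unit energy: its index is bounded
    below by Borsuk-Ulam, and compactness bounds [fibre_max] on it for every c. *)
Lemma unit_set_exists k : exists M : set W, [/\ forall u, M u -> I u = 1,
  symmetric_set M, (k.+1%:R%:E <= fr_index M)%E &
  forall c, 0 < c -> exists a : R, forall u, M u -> fibre_max c u <= a].
Proof.
have [e eP] := independent_sequence.
pose T (p : 'rV[R]_k.+1) := \sum_(i < k.+1) p 0 i *: e i.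
have T0 p : l1_sphere R k p -> T p != 0.
  move=> v1; apply/eqP => Tv; have v0 : p = 0.
    apply/rowP => i; rewrite mxE -[i]inord_val.
    apply: (eP k.+1 (fun j => p 0 (inord j))) (ltn_ord i).
    by rewrite -[RHS]Tv; apply: eq_bigr => j _; rewrite inord_val.
  move: v1; rewrite /l1_sphere /= /l1 big1 => [/eqP|i _]; first by rewrite eq_sym oner_eq0.
  by rewrite v0 mxE normr0.
have TN p : T (- p) = - T p.
  by rewrite /T -sumrN; apply: eq_bigr => i _; rewrite mxE scaleNr.
have cT : continuous T.
  move=> p; apply: continuous_sum_fun => i.
  have c := @coord_continuous R 1 k.+1 0 i p; exact: (cvgZr_tmp c).
pose h p := energy_normalize (T p).
have ch p : l1_sphere R k p -> {for p, continuous h}.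
  move=> /T0 Tv; exact: (cvg_comp _ _ (cT p) (energy_normalize_continuous Tv)).
have hN p : h (- p) = - h p by rewrite /h TN energy_normalizeN.
have SN p : l1_sphere R k p -> l1_sphere R k (- p) by rewrite /l1_sphere /= l1N.
have MN : symmetric_set (h @` l1_sphere R k).
  by move=> _ [p v1 <-]; exists (- p); [exact: SN|exact: hN].
exists (h @` l1_sphere R k); split=> //.
- by move=> _ [p v1 <-]; apply: energy_normalizeE; exact: T0.
- apply: (@fr_index_ge _ _ _ k h) => //.
  by apply/subspace_continuousP => p v1; apply: cvg_within_filter; exact: ch.
- move=> c c0; have cm : compact ((fun p => fibre_max c (T p)) @` l1_sphere R k).
    apply: continuous_compact l1_sphere_compact.
    apply/subspace_continuousP => p v1; apply: cvg_within_filter.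
    exact: (cvg_comp _ _ (cT p) (fibre_max_continuous c0 (T0 p v1))).
  have [a [_ aP]] := compact_bounded cm; exists (a + 1) => _ [p v1 <-].
  rewrite fibre_max_scale ?energy_normalize_gt0 ?T0//.
  apply: (le_trans (ler_norm _)); apply: (aP (a + 1)); first by rewrite ltrDl.
  by exists p.
Qed.

Lemma minimax_fin c k : 0 < c -> (0 < k)%N -> lam c k \is a fin_num.
Proof.
move=> c0 k0; have [M [M1 MN Mk /(_ c c0)[a Ma]]] := unit_set_exists k.-1.
have M0 u : M u -> u != 0 by move=> /M1 I1; apply: energy_neq0; rewrite I1 ltr01.
have [b bP] := fibre_max_lower c0.
rewrite prednK// in Mk; rewrite fin_real//; apply/andP; split; last first.
  by apply: le_lt_trans (ltry a); exact: minimax_le Ma.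
apply: lt_le_trans (ltNyr b) _; rewrite leNgt; apply/negP => /(minimax_lt c0)[N [N1 NN Nk Nb]].
(* The empty set has index 0 and is excluded by k > 0. *)
have [N0|/set0P[u Nu]] := eqVneq N set0.
  by move: Nk; rewrite N0 fr_index0 lee_fin lern0 gtn_eqF.
by have := Nb u Nu; rewrite ltNge bP// N1.
Qed.

Lemma minimax_mono c k l : (k <= l)%N -> (lam c k <= lam c l)%E.
Proof.
move=> kl; apply: le_ereal_inf => _ [M [Mn MN Ml] <-]; exists M => //; split=> //.
by apply: le_trans Ml; rewrite lee_fin ler_nat.
Qed.

Lemma minimax_unbounded c (a : R) : 0 < c ->
  exists N, forall k, (N <= k)%N -> (a%:E <= lam c k)%E.
Proof.
move=> c0; have [m hm] := fr_index_sublevel a c0; exists m.+1 => k mk.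
rewrite leNgt; apply/negP => /(minimax_lt c0)[M [M1 MN Mk Ma]].
have : (fr_index M <= m%:R%:E)%E.
  apply: le_trans hm; apply: (fr_index_mono (g := id)) => //.
  - by move=> u [I1 m1]; split; rewrite ?fibre_maxN// (potentialN (scaled_odd As_scaled)).
  - by apply: continuous_subspaceT => u; exact: cvg_id.
  - by move=> u Mu; split; [exact: M1|exact/ltW/Ma].
move=> /(le_trans Mk); rewrite lee_fin ler_nat => km.
by have := leq_trans mk km; rewrite ltnn.
Qed.

(** * Dependence of the minimax levels on c *)

Local Notation mu := (fun c k => fine (lam c k)).

Lemma minimax_decreasing k c c' : (0 < k)%N -> 0 < c -> c < c' -> mu c' k < mu c k.
Proof.
move=> k0 c0 cc'; have c'0 := lt_trans c0 cc'.
have [d d0 hd] := fibre_max_gap (mu c k + 1) c0 cc'.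
have lE : lam c k = (mu c k)%:E by rewrite fineK// minimax_fin.
(* At most 1, to stay in the sublevel for which the gap [d] was obtained, and at most d/2, to keep
   half of the gap in the infimum. *)
pose e := Num.min 1 (d / 2).
have e0 : 0 < e by rewrite lt_min ltr01 divr_gt0.
have e1 : e <= 1 by rewrite ge_min lexx.
have ed : e <= d / 2 by rewrite ge_min lexx orbT.
have [|M [M1 MN Mk Ma]] := @minimax_lt c k (mu c k + e) c0.
  by rewrite {1}lE lte_fin ltrDl.
have : (lam c' k <= (mu c k - d / 2)%:E)%E.
  apply: (@minimax_le _ _ _ M) => // u Mu.
    by apply: energy_neq0; rewrite M1// ltr01.
  have m := Ma u Mu; apply: (le_trans (hd u (M1 u Mu) _)); first by lra.
  by lra.
by rewrite -{1}(fineK (minimax_fin c'0 k0)) lee_fin; lra.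
Qed.

Lemma minimax_le_mono k c c' : (0 < k)%N -> 0 < c -> c <= c' -> mu c' k <= mu c k.
Proof.
by move=> k0 c0; rewrite le_eqVlt => /orP[/eqP -> //|/(minimax_decreasing k0 c0)/ltW].
Qed.

(** Nearly optimal sets for all [c'] in the interval lie below the common bound [mu c1 k + 1], so
    one constant serves them all. *)
Lemma minimax_uniform k c1 c2 : (0 < k)%N -> 0 < c1 -> c1 < c2 ->
  exists2 K : R, 0 < K & forall c c', c1 <= c -> c < c' -> c' <= c2 ->
    mu c k <= mu c' k + K * (c' - c).
Proof.
move=> k0 c10 c12; have [K K0 hK] := fibre_max_uniform (mu c1 k + 1) c10 c12.
exists K => // c c' c1c cc' c'c2; have c0 := lt_le_trans c10 c1c; have c'0 := lt_trans c0 cc'.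
apply/ler_addgt0Pr => e e0; pose e' := Num.min 1 e.
have e'0 : 0 < e' by rewrite lt_min ltr01.
have e'1 : e' <= 1 by rewrite ge_min lexx.
have e'e : e' <= e by rewrite ge_min lexx orbT.
have [|M [M1 MN Mk Ma]] := @minimax_lt c' k (mu c' k + e') c'0.
  by rewrite -{1}(fineK (minimax_fin c'0 k0)) lte_fin ltrDl.
have m1 : mu c' k <= mu c1 k by apply: minimax_le_mono => //; exact: le_trans c1c (ltW cc').
have : (lam c k <= (mu c' k + K * (c' - c) + e)%:E)%E.
  apply: (@minimax_le _ _ _ M) => // u Mu.
    by apply: energy_neq0; rewrite M1// ltr01.
  have m := Ma u Mu; apply: (le_trans (hK c c' u c1c cc' c'c2 (M1 u Mu) _)).
    by apply: (le_trans (ltW m)); apply: lerD.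
  by rewrite addrAC lerD2r (le_trans (ltW m))// lerD2l.
by rewrite -{1}(fineK (minimax_fin c0 k0)) lee_fin.
Qed.

Lemma minimax_continuous k c : (0 < k)%N -> 0 < c ->
  {for c, continuous (fun c : R => mu c k)}.
Proof.
move=> k0 c0; have h1 : 0 < c / 2 by rewrite divr_gt0.
have h2 : c / 2 < c * 2 by lra.
have [K K0 hK] := minimax_uniform k0 h1 h2.
apply/cvgrPdist_lt => e e0.
have : \forall c' \near c, `|c - c'| < Num.min (c / 2) (e / K).
  by apply: (@cvgr_dist_lt _ _ _ _ _ id c cvg_id); rewrite lt_min h1 divr_gt0.
apply: filterS => c'; rewrite lt_min => /andP[]; rewrite ltr_norml => /andP[d1 d2].
rewrite ltr_pdivlMr// mulrC => hc.
have [cc'|c'c|->] := ltgtP c c'; last by rewrite subrr normr0.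
- have := hK c c' (ltac:(lra)) cc' (ltac:(lra)).
  have := minimax_decreasing k0 c0 cc'.
  move: hc; rewrite distrC gtr0_norm ?subr_gt0// => hc m1 m2.
  by rewrite gtr0_norm ?subr_gt0//; lra.
- have c'0 : 0 < c' by lra.
  have := hK c' c (ltac:(lra)) c'c (ltac:(lra)).
  have := minimax_decreasing k0 c'0 c'c.
  move: hc; rewrite gtr0_norm ?subr_gt0// => hc m1 m2.
  by rewrite distrC gtr0_norm ?subr_gt0//; lra.
Qed.

Lemma minimax_at0 k (K : R) : (0 < k)%N -> exists2 c0 : R, 0 < c0 &
  forall c, 0 < c -> c < c0 -> K <= mu c k.
Proof.
move=> k0; have [c0 c00 h] := fibre_max_at0 K; exists c0 => // c cp cc0.
rewrite leNgt; apply/negP => mK.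
have : (lam c k < K%:E)%E by rewrite -(fineK (minimax_fin cp k0)) lte_fin.
move=> /(minimax_lt cp)[N [N1 NN Nk Nb]].
have [N0|/set0P[u Nu]] := eqVneq N set0.
  by move: Nk; rewrite N0 fr_index0 lee_fin lern0 gtn_eqF.
by have := Nb u Nu; rewrite ltNge h// N1.
Qed.

(** A single competitor suffices: [fibre_max] is bounded on it at c = 1 and therefore tends to -oo
    uniformly on it. *)
Lemma minimax_atinfty k (K : R) : (0 < k)%N -> exists2 c1 : R, 0 < c1 &
  forall c, c1 <= c -> mu c k <= - K.
Proof.
move=> k0; have [M [M1 MN Mk /(_ 1 ltr01)[a Ma]]] := unit_set_exists k.-1.
rewrite prednK// in Mk; have [c1 c10 h] := fibre_max_atinfty a K ltr01.
exists c1 => // c c1c; have c0 := lt_le_trans c10 c1c.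
have : (lam c k <= (- K)%:E)%E.
  apply: (@minimax_le _ _ _ M) => // u Mu; last by apply: h => //; [exact: M1|exact: Ma].
  by apply: energy_neq0; rewrite M1// ltr01.
by rewrite -{1}(fineK (minimax_fin c0 k0)) lee_fin.
Qed.

(** This makes the norms blow up: critical points whose values tend to infinity leave every ball. *)
Lemma Phi_bounded (l K : R) : exists C : R, forall u, `|u| <= K -> Phi As Bs f g l u <= C.
Proof.
have bB : bounded_set [set u : W | `|u| <= K].
  by exists K; split; [exact: num_real|move=> M KM u uB; exact: le_trans (ltW KM)].
have [M0 [_ hM]] := scaled_bounded As_scaled bB.
pose M := Num.max 1 (M0 + 1); have M1 : 0 <= M by rewrite le_max ler01.
have IK u : `|u| <= K -> I u <= M * K.
  move=> uK; have [t /andP[t0 t1] ->] := potential_scale Ap u.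
  apply: (le_trans (ler_norm _)); apply: (le_trans (dual_le _ _)).
  apply: ler_pM => //; apply: (hM M); first by rewrite lt_max ltrDl ltr01 orbT.
  by exists (t *: u) => //=; rewrite normrZ gtr0_norm// (le_trans _ uK)// ler_piMl// ltW.
have [|C C0 hC] := @seq_bounded_above R W [set u | `|u| <= K] (fun u => - (l * J u) - F u - G u).
  move=> u uK; have Iu j : I (u j) <= M * K by apply: IK; exact: uK.
  have [n [w [nh _ cJ cF cG]]] := energy_sublevel_compact Iu.
  exists n => //; exists (- (l * J w) - F w - G w).
  exact: (cvgB (cvgB (cvgN (cvgMl_tmp cJ)) cF) cG).
exists (M * K + C) => u uK; have := hC u uK; have := IK u uK; rewrite /Phi; lra.
Qed.

(** * Critical points and critical values of Phi *)

Hypothesis H3 : forall (alpha beta gamma delta : R) u,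
  alpha *: As u = beta *: Bs u + gamma *: f u + delta *: g u ->
  s * alpha * I u = s * beta * J u + q * gamma * F u + r * delta * G u.

(** (H3) with coefficients 1, l, 1, 1 eliminates I and J: s Phi(u) = (q - s) F(u) + (r - s) G(u),
    and both terms are positive. *)
Lemma Phi_critical_gt0 (l : R) u : u != 0 -> critical_point (Phi As Bs f g l) u ->
  0 < Phi As Bs f g l u.
Proof.
move=> u0 cu; have d1 := Phi_is_diff l u.
have E : As u = l *: Bs u + f u + g u.
  apply/val_inj/funext => v.
  have : (As u v - l * Bs u v - f u v - g u v : R) = 0.
    have [_ e1] := d1; have [_ e2] := cu.
    by have := congr1 (fun h : W -> R^o => h v) (etrans (esym e1) e2).
  move=> e0; rewrite -[LHS]/(As u v) -[RHS]/(l * Bs u v + f u v + g u v).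
  by move: e0; set a := As u v; set b := l * _; set x := f u v; set y := g u v; lra.
have := @H3 1 l 1 1 u; rewrite !scale1r => /(_ E); rewrite !mulr1.
have Fu := F_lt0 u0; have Gu := G_gt0 u0 => h.
have h1 : (s - q) * F u < 0 by rewrite pmulr_rlt0// subr_gt0.
have h2 : 0 < (r - s) * G u by rewrite mulr_gt0// subr_gt0.
by rewrite -(pmulr_rgt0 _ s_gt0) /Phi; lra.
Qed.

Lemma minimax_critical_values c : 0 < c ->
  [/\ (forall k l, (1 <= k <= l)%N -> (lam c k <= lam c l)%E),
      lam c k @[k --> \oo] --> +oo%E,
      (forall k, (1 <= k)%N -> exists u : W,
        [/\ u != 0, critical_point (lambda_fun As Bs f g c) u &
            (lambda_fun As Bs f g c u)%:E = lam c k]) &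
      (forall k, (1 <= k)%N -> exists u : W,
        [/\ u != 0, critical_point (Phi As Bs f g (mu c k)) u &
            Phi As Bs f g (mu c k) u = c])].
Proof.
move=> c0; have crit k : (1 <= k)%N -> exists w, [/\ w != 0,
    critical_point (lambda_fun As Bs f g c) w, lambda_fun As Bs f g c w = mu c k,
    critical_point (Phi As Bs f g (mu c k)) w & Phi As Bs f g (mu c k) w = c].
  move=> k0; have lE : lam c k = (mu c k)%:E by rewrite fineK// minimax_fin.
  have [x [x0 mx D0]] := minimax_critical c0 lE.
  have [w [w0 lw cl cP Pw]] := critical_fibre_max c0 x0 D0.
  by exists w; rewrite -mx.
split.
- by move=> k l /andP[_ kl]; exact: minimax_mono.
- apply/cvgeyPge => a; have [N hN] := minimax_unbounded a c0.
  by exists N => // k Nk; exact: hN.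
- move=> k k0; have [w [w0 cl lw _ _]] := crit k k0.
  by exists w; split=> //; rewrite lw fineK// minimax_fin.
- by move=> k k0; have [w [w0 _ _ cP Pw]] := crit k k0; exists w.
Qed.

Lemma minimax_curve k : (1 <= k)%N ->
  (forall c : R, 0 < c -> lam c k \is a fin_num) /\
  [/\ (forall c : R, 0 < c -> {for c, continuous (fun c : R => mu c k)}),
      (forall c1 c2 : R, 0 < c1 -> c1 < c2 -> mu c2 k < mu c1 k),
      mu c k @[c --> 0^'+] --> +oo & mu c k @[c --> +oo] --> -oo].
Proof.
move=> k0; split; first by move=> c c0; exact: minimax_fin.
split.
- by move=> c c0; exact: minimax_continuous.
- by move=> c1 c2 c10 c12; exact: minimax_decreasing.
- apply/cvgryPge => a; have [c0 c00 h] := minimax_at0 a k0.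
  near=> c; apply: h; first by near: c; exact: nbhs_right_gt.
  by near: c; exact: nbhs_right_lt.
- apply/cvgrNyPle => a; have [c1 c10 h] := minimax_atinfty (- a) k0.
  near=> c; rewrite -[leRHS]opprK; apply: h.
  by near: c; apply: nbhs_pinfty_ge; exact: num_real.
Unshelve. all: by end_near. Qed.

Lemma minimax_level (l : R) k : (1 <= k)%N -> exists2 c : R, 0 < c & mu c k = l.
Proof.
move=> k0; have [c0 c00 h0] := minimax_at0 l k0.
have [c1 c10 h1] := minimax_atinfty (- l) k0.
pose a := c0 / 2; pose b := Num.max a c1.
have a0 : 0 < a by rewrite divr_gt0.
have ab : a <= b by rewrite le_max lexx.
have ha : l <= mu a k by apply: h0 => //; rewrite /a; lra.
have hb : mu b k <= l by rewrite -[leRHS]opprK; apply: h1; rewrite le_max lexx orbT.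
have [||c] := @IVT R (fun c => mu c k) a b l ab.
- apply: continuous_in_subspaceT => c; rewrite inE /= in_itv /= => /andP[ac _].
  by apply: minimax_continuous => //; exact: lt_le_trans ac.
- by rewrite ge_min le_max ha hb orbT.
- by rewrite in_itv /= => /andP[ac _] E; exists c => //; exact: lt_le_trans ac.
Qed.

(** Levels are nondecreasing in k and strictly decreasing in c, so the solutions c_k are
    nondecreasing. If c_k < B, the level at B of the same index is below [l], which fails for large
    k since the levels at B tend to infinity. *)
Lemma Phi_critical_sequence (l : R) : exists v : nat -> W,
  [/\ (forall k, v k != 0 /\ critical_point (Phi As Bs f g l) (v k)),
      nondecreasing_seq (fun k => Phi As Bs f g l (v k)),
      Phi As Bs f g l (v k) @[k --> \oo] --> +oo & `|v k| @[k --> \oo] --> +oo].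
Proof.
(* The shift of the index reflects that sequences start at 0 and minimax levels at 1. *)
have /choice[c cP] (k : nat) : exists c : R, 0 < c /\ mu c k.+1 = l.
  by have [c c0 h] := @minimax_level l k.+1 isT; exists c.
have c0 k : 0 < c k by have [] := cP k.
have cl k : mu (c k) k.+1 = l by have [] := cP k.
have /choice[v vP] (k : nat) : exists u, [/\ u != 0,
    critical_point (Phi As Bs f g l) u & Phi As Bs f g l u = c k].
  have [_ _ _ /(_ k.+1 isT)[u]] := minimax_critical_values (c0 k).
  by rewrite cl => h; exists u.
have PE k : Phi As Bs f g l (v k) = c k by have [] := vP k.
have le_mu d k m : 0 < d -> (0 < k)%N -> (k <= m)%N -> mu d k <= mu d m.
  move=> d0 k0 km; rewrite -lee_fin !fineK ?minimax_fin ?(leq_trans k0 km)//.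
  exact: minimax_mono.
have cmono k m : (k <= m)%N -> c k <= c m.
  move=> km; rewrite leNgt; apply/negP => cc.
  have := @minimax_decreasing m.+1 _ _ isT (c0 m) cc.
  by rewrite cl ltNge -(cl k) le_mu.
have cinf : c k @[k --> \oo] --> +oo.
  apply/cvgryPge => A; pose B := Num.max 1 A.
  have B0 : 0 < B by rewrite lt_max ltr01.
  have [N hN] := minimax_unbounded (l + 1) B0; exists N => // k /= Nk.
  apply: (@le_trans _ _ B); first by rewrite le_max lexx orbT.
  rewrite leNgt; apply/negP => cB.
  have h1 : l + 1 <= mu B k.+1.
    by rewrite -lee_fin fineK ?minimax_fin//; apply: hN; exact: leqW.
  by have := @minimax_decreasing k.+1 _ _ isT (c0 k) cB; rewrite cl; lra.
exists v; split.
- by move=> k; have [] := vP k.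
- by move=> k m /cmono; rewrite !PE.
- by under eq_fun do rewrite PE.
- apply/cvgryPge => A; have [C hC] := Phi_bounded l A.
  have : \forall k \near \oo, C < c k by move/cvgryPgt: cinf; exact.
  apply: filterS => k Ck; rewrite leNgt; apply/negP => /ltW /hC.
  by rewrite PE leNgt Ck.
Qed.

End reduced.

Theorem theorem2p24 (R : realType) (W : completeNormedModType R)
  (sc : W -> R -> W) (q s r : R) (As Bs f g : W -> dual W)
  (W_reflexive : reflexive_space W)
  (W_infinite : infinite_dimensional W)
  (q_gt0 : 0 < q) (q_lt_s : q < s) (s_lt_r : s < r)
  (A1_A5 : is_scaling s sc)
  (As_scaled : scaled_operator s sc As)
  (Bs_scaled : scaled_operator s sc Bs)
  (f_odd : odd_operator f) (f_potential : potential_operator f)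
  (g_odd : odd_operator g) (g_potential : potential_operator g)
  (A6 : forall u, u != 0 -> 0 < As u u)
  (A7 : forall (u : nat -> W) (w : W), weak_cvg u w ->
     As (u j) (u j - w) @[j --> \oo] --> (0 : R) ->
     exists2 n : nat -> nat, {homo n : i j / (i < j)%N} &
       u (n j) @[j --> \oo] --> w)
  (A8 : forall u, u != 0 -> 0 < Bs u u)
  (A9 : weak_to_strong Bs)
  (A10 : forall K : R, exists M : R, forall u, M <= `|u| -> K <= potential As u)
  (A11 : forall (lambda : R) (u : W), As u = lambda *: Bs u ->
     potential As u = lambda * potential Bs u)
  (H1f : homogeneous sc q f) (H1g : homogeneous sc r g)
  (H2f : weak_to_strong f) (H2g : weak_to_strong g)
  (H3 : forall (alpha beta gamma delta : R) (u : W),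
     alpha *: As u = beta *: Bs u + gamma *: f u + delta *: g u ->
     s * alpha * potential As u =
       s * beta * potential Bs u + q * gamma * potential f u
       + r * delta * potential g u)
  (F_lt0 : forall u, u != 0 -> potential f u < 0)
  (G_gt0 : forall u, u != 0 -> 0 < potential g u)
  (h_neq0 : forall (c : R) (u : W), nehari sc As Bs f g c u ->
     (s - q) *: f u - (r - s) *: g u != 0) :
  let Phi := Phi As Bs f g in
  let lambda_ := lambda_fun As Bs f g in
  let lam := minimax sc As Bs f g in
  [/\ (forall c : R, 0 < c ->
        [/\ (forall k l, (1 <= k <= l)%N -> (lam c k <= lam c l)%E),
            lam c k @[k --> \oo] --> +oo%E,
            (forall k, (1 <= k)%N -> exists u : W,
              [/\ u != 0, critical_point (lambda_ c) u &
                  (lambda_ c u)%:E = lam c k]) &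
            (forall k, (1 <= k)%N -> exists u : W,
              [/\ u != 0, critical_point (Phi (fine (lam c k))) u &
                  Phi (fine (lam c k)) u = c])]),
      (forall k, (1 <= k)%N ->
        (forall c : R, 0 < c -> lam c k \is a fin_num) /\
        [/\ (forall c : R, 0 < c ->
               {for c, continuous (fun c : R => fine (lam c k))}),
            (forall c1 c2 : R, 0 < c1 -> c1 < c2 ->
               fine (lam c2 k) < fine (lam c1 k)),
            fine (lam c k) @[c --> 0^'+] --> +oo &
            fine (lam c k) @[c --> +oo] --> -oo]) &
      (forall lambda : R,
        (exists v : nat -> W,
          [/\ (forall k, v k != 0 /\ critical_point (Phi lambda) (v k)),
              nondecreasing_seq (fun k => Phi lambda (v k)),
              Phi lambda (v k) @[k --> \oo] --> +oo &
              `|v k| @[k --> \oo] --> +oo]) /\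
        ~ (exists u : W, [/\ u != 0, critical_point (Phi lambda) u &
             ~ (0 < Phi lambda u)]))].
Proof.
move=> Phi0 lambda_ lam; split.
- by move=> c c0; apply: (@minimax_critical_values R W sc q s r As Bs f g).
- by move=> k k1; apply: (@minimax_curve R W sc q s r As Bs f g).
- move=> l; split; first by apply: (@Phi_critical_sequence R W sc q s r As Bs f g).
  move=> [u [u0 cu]]; apply.
  by apply: (@Phi_critical_gt0 R W sc q s r As Bs f g).
Qed.
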